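(* Let $Y^{(0)}$ be a polynomial vector field on $\mathbb C^n$ and let $x_0\in\mathcal U$ be a non-singular point of the system $\frac{dy}{dx}=A(x)y$. There is a polynomial vertical symmetry $Y$ of $X$ with coefficients in $\mathcal K$ such that $Y(x_0)=Y^{(0)}$ if and only if $\sigma_*Y^{(0)}=Y^{(0)}$ for each Galoisian matrix $\sigma\in\mathrm{Gal}(x_0,X)$.
   Context: Let $\mathcal U$ be a nonempty connected open subset of $\mathbb{CP}_1$ with affine coordinate $x$. A function field $\mathcal K$ is a subfield of the field of meromorphic functions on $\mathcal U$ that contains the constants $\mathbb C$ and is closed under $\frac{d}{dx}$; fix one. Fix $n\ge 1$ and $A(x)=(a_{ij}(x))\in\mathfrak{gl}(n,\mathcal K)$, and consider the linear system $\frac{dy}{dx}=A(x)y$, $y=(y_1,\ldots,y_n)$, with associated meromorphic vector field on $\mathcal U\times\mathbb C^n$ $$X=\frac{\partial}{\partial x}+\sum_{i,j=1}^n a_{ij}(x)y_j\frac{\partial}{\partial y_i}.$$ The singularities of the system are the poles of $A(x)$; the point at infinity (if in $\mathcal U$) counts as a singularity if the system rewritten in the coordinate $t=1/x$ has a pole at $t=0$. Symmetries: a polynomial vertical symmetry of $X$ with coefficients in $\mathcal K$ is a vector field $Y=\sum_i P_i(x,y)\frac{\partial}{\partial y_i}$ with $P_i\in\mathcal K[y_1,\ldots,y_n]$ and $[X,Y]=0$. $Y(x_0)$ denotes its restriction to the fibre $\{x_0\}\times\mathbb C^n$, viewed as a polynomial vector field on $\mathbb C^n$ (a vector field $\sum_i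 P_i(y)\frac{\partial}{\partial y_i}$ with $P_i\in\mathbb C[y_1,\ldots,y_n]$). For $\sigma\in\mathrm{GL}(n,\mathbb C)$ and a vector field $Z$ on $\mathbb C^n$, $\sigma_*Z(p)=\sigma\,Z(\sigma^{-1}p)$. Galois group: for a finite-dimensional complex (algebraic) linear representation $\Psi:\mathrm{GL}(n,\mathbb C)\to\mathrm{GL}(E)$ with differential $\Psi':\mathfrak{gl}(n,\mathbb C)\to\mathrm{End}(E)$, the induced Lie--Vessiot system is $\frac{dv}{dx}=\Psi'(A(x))(v)$. A $\mathcal K$-rational solution is a solution $v(x)\in E\otimes_{\mathbb C}\mathcal K$. A $\mathcal K$-exponential pre-solution is an element $w(x)\in E\otimes_{\mathbb C}\mathcal K$ for which there is $b(x)\in\mathcal K$ with $\frac{dw}{dx}-\Psi'(A(x))(w)=-b(x)w$. For a non-singular point $x_0\in\mathcal U$, a matrix $\sigma\in\mathrm{GL}(n,\mathbb C)$ is Galoisian at $x_0$ if for every such representation $(E,\Psi)$: (a) $\Psi(\sigma)(v(x_0))=v(x_0)$ for every $\mathcal K$-rational solution $v(x)$ of the induced Lie--Vessiot system; (b) for every $\mathcal K$-exponential pre-solution $w(x)$ of the induced Lie--Vessiot system such that $w(x_0)$ is well defined, $\Psi(\sigma)(w(x_0))\in\mathbb C\,w(x_0)$. The Galoisian matrices at $x_0$ form the Galois group $\mathrm{Gal}(x_0,X)\subseteq\mathrm{GL}(n,\mathbb C)$. *)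

(* Defs.v *)
From HB Require Import structures.
From mathcomp Require Import all_boot all_order all_algebra.
From mathcomp Require Import all_classical all_reals all_analysis.
From mathcomp Require Import complex.
From mathcomp Require Import -(notations) mpoly.
Import Order.TTheory GRing.Theory Num.Theory numFieldNormedType.Exports.

Set Implicit Arguments.
Unset Strict Implicit.
Unset Printing Implicit Defensive.

Local Open Scope classical_set_scope.
Local Open Scope ring_scope.

(* The other notations of mpoly clash with those of the analysis library. *)
Notation "{ 'mpoly' T [ n ] }" := (mpoly n T)
  (at level 0, T, n at level 2, format "{ 'mpoly'  T [ n ] }").

(* The topology of [one_point_compactification] on [option C] is that of the
   Riemann sphere: [Some a] is the point x = a and [None] the point at
   infinity. The alias [R[i]^o] carries the norm topology of C. *)
Notation CP1 R := (one_point_compactification (R[i]^o)).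

Section meromorphic.
Variable R : realType.
Local Notation C := R[i].

(* A meromorphic function is represented by a total function on CP1 whose
   values at the poles and outside the domain are irrelevant: equality of
   meromorphic functions is [mero_eq] below, not Leibniz equality. *)

Definition chart (p : CP1 R) (z : C) : CP1 R :=
  match p with
  | Some a => Some (a + z)
  | None => if z == 0 then None else Some z^-1
  end.

Definition mero_eq (U : set (CP1 R)) (f g : CP1 R -> C) : Prop :=
  forall p, U p -> \forall z \near (0 : C^o)^', f (chart p z) = g (chart p z).

(* f (chart p z) = z ^- N * \sum_k a_k z ^+ k in a punctured disc *)
Definition laurent_at (f : CP1 R -> C) (p : CP1 R) (N : nat) (a : nat -> C) :=
  \forall z \near (0 : C^o)^',
    series (fun k => a k * z ^+ k : C^o) @ \oo --> (z ^+ N * f (chart p z) : C^o).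

Definition meromorphic_at (f : CP1 R -> C) (p : CP1 R) : Prop :=
  exists N a, laurent_at f p N a.

Definition has_value (f : CP1 R -> C) (p : CP1 R) (c : C) : Prop :=
  exists2 a, laurent_at f p 0 a & a 0%N = c.

Definition regular_at (f : CP1 R -> C) (p : CP1 R) : Prop :=
  exists c, has_value f p c.

Definition ddx (f : CP1 R -> C) (p : CP1 R) : C :=
  match p with
  | Some a => derive1 (fun z : C => f (Some z) : C^o) a
  | None => 0
  end.

(* A differential subfield of the field of meromorphic functions on U, as a
   set of representatives closed under [mero_eq]. The inverse is taken
   pointwise with 0^-1 = 0, so it represents the inverse of every nonzero
   class. *)
Record function_field (U : set (CP1 R)) (K : set (CP1 R -> C)) : Prop := {
  ff_mero : forall f, K f -> forall p, U p -> meromorphic_at f p;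
  ff_eq : forall f g, K f -> mero_eq U f g -> K g;
  ff_cst : forall c : C, K (cst c);
  ff_sub : forall f g, K f -> K g -> K (f - g);
  ff_mul : forall f g, K f -> K g -> K (f * g);
  ff_inv : forall f, K f -> K (fun p => (f p)^-1);
  ff_ddx : forall f, K f -> K (ddx f) }.

End meromorphic.

(* Vector fields on U x C^n with coefficients in S[y_1, ..., y_n], where d acts
   on S as d/dx: the component of index [None] is the one along d/dx, that of
   index [Some i] the one along d/dy_i. *)
Section vector_fields.
Variables (S : comNzRingType) (d : S -> S) (n : nat).

Definition vfield := option 'I_n -> {mpoly S[n]}.

Definition vf_act (Z : vfield) (P : {mpoly S[n]}) : {mpoly S[n]} :=
  Z None * map_mpoly d P + \sum_(i < n) Z (Some i) * mderiv i P.

Definition bracket (Z W : vfield) : vfield :=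
  fun k => vf_act Z (W k) - vf_act W (Z k).

Definition vfieldX (A : 'M[S]_n) : vfield := fun k =>
  match k with
  | None => 1
  | Some i => \sum_(j < n) A i j *: mpolyX S (mnm1 j)
  end.

Definition vertical (P : 'I_n -> {mpoly S[n]}) : vfield :=
  fun k => if k is Some i then P i else 0.

End vector_fields.

Section systems.
Variables (R : realType) (n : nat).
Local Notation C := R[i].
Local Notation fct := (CP1 R -> C).

Definition mx_at m k (M : 'M[fct]_(m, k)) (p : CP1 R) : 'M[C]_(m, k) :=
  map_mx (fun f => f p) M.

Definition mx_has_value m k (M : 'M[fct]_(m, k)) p (c : 'M[C]_(m, k)) :=
  forall i j, has_value (M i j) p (c i j).

(* With t = 1/x the system reads dy/dt = - t^-2 A(1/t) y = - x^2 A(x) y. *)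
Definition nonsingular (A : 'M[fct]_n) (p : CP1 R) : Prop :=
  forall i j, match p with
  | Some _ => regular_at (A i j) p
  | None => regular_at
      (fun q => if q is Some x then - x ^+ 2 * A i j q else 0) p
  end.

Definition vertical_symmetry (U : set (CP1 R)) (K : set fct) (A : 'M[fct]_n)
    (P : 'I_n -> {mpoly fct[n]}) : Prop :=
  (forall i m, K (mcoeff m (P i))) /\
  (forall k m,
     mero_eq U (mcoeff m (bracket (@ddx R) (vfieldX A) (vertical P) k)) (cst 0)).

Definition restricts_to (P : 'I_n -> {mpoly fct[n]}) (p : CP1 R)
    (Y0 : 'I_n -> {mpoly C[n]}) : Prop :=
  forall i m, has_value (mcoeff m (P i)) p (mcoeff m (Y0 i)).

Definition vf_map (Y0 : 'I_n -> {mpoly C[n]}) (y : 'cV[C]_n) : 'cV[C]_n :=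
  \col_i meval (fun j => y j 0) (Y0 i).

Definition vf_push (s : 'M[C]_n) (Z : 'cV[C]_n -> 'cV[C]_n) :
    'cV[C]_n -> 'cV[C]_n :=
  fun y => s *m Z (invmx s *m y).

(* Algebraic representations GL(n, C) -> GL(m, C). Only the values of [Psi] on
   invertible matrices matter; the coordinate ring of GL(n, C) is
   C[s_ij, 1 / \det s]. *)
Record algebraic_rep m (Psi : 'M[C]_n -> 'M[C]_m) : Prop := {
  rep1 : Psi 1%:M = 1%:M;
  repM : forall s t, s \in unitmx -> t \in unitmx ->
    Psi (s *m t) = Psi s *m Psi t;
  rep_regular : exists (r : nat) (p : 'I_m -> 'I_m -> {mpoly C[n * n]}),
    forall s, s \in unitmx -> forall i j,
    Psi s i j = meval (fun k => mxvec s 0 k) (p i j) / \det s ^+ r }.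

Definition drep m (Psi : 'M[C]_n -> 'M[C]_m) (B : 'M[C]_n) : 'M[C]_m :=
  \matrix_(i, j) derive1 (fun t : C => Psi (1%:M + t *: B) i j : C^o) 0.

(* dw/dx - Psi'(A) w = - b w; for b = 0 this is the Lie-Vessiot system. *)
Definition pre_solution (U : set (CP1 R)) (A : 'M[fct]_n) m
    (Psi : 'M[C]_n -> 'M[C]_m) (b : fct) (w : 'cV[fct]_m) : Prop :=
  forall i, mero_eq U
    (fun p => ddx (w i 0) p - (drep Psi (mx_at A p) *m mx_at w p) i 0)
    (fun p => - b p * w i 0 p).

Definition rational_solution U (K : set fct) A m (Psi : 'M[C]_n -> 'M[C]_m)
    (v : 'cV[fct]_m) : Prop :=
  (forall i, K (v i 0)) /\ pre_solution U A Psi (cst 0) v.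

Definition exponential_pre_solution U (K : set fct) A m
    (Psi : 'M[C]_n -> 'M[C]_m) (w : 'cV[fct]_m) : Prop :=
  (forall i, K (w i 0)) /\ exists2 b, K b & pre_solution U A Psi b w.

Definition galoisian (U : set (CP1 R)) (K : set fct) (A : 'M[fct]_n)
    (x0 : CP1 R) (s : 'M[C]_n) : Prop :=
  s \in unitmx /\
  forall m (Psi : 'M[C]_n -> 'M[C]_m), algebraic_rep Psi ->
    (forall v v0, rational_solution U K A Psi v -> mx_has_value v x0 v0 ->
       Psi s *m v0 = v0) /\
    (forall w w0, exponential_pre_solution U K A Psi w ->
       mx_has_value w x0 w0 -> exists c : C, Psi s *m w0 = c *: w0).

End systems.

(* Main.v *)
From HB Require Import structures.
Require Import Defs.
From mathcomp Require Import all_boot all_order all_algebra generic_quotient.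
From mathcomp Require Import all_classical all_reals all_analysis.
From mathcomp Require Import complex ring lra zify.
From mathcomp Require Import -(notations) mpoly.
Import Order.TTheory GRing.Theory Num.Theory numFieldNormedType.Exports.
Local Open Scope classical_set_scope.
Local Open Scope ring_scope.

Set Implicit Arguments.
Unset Strict Implicit.
Unset Printing Implicit Defensive.

(** Everything takes place in the differential field [M] of formal Laurent series
    at [x0]. By the identity theorem a function in [K] is determined by its
    expansion there ([germ_eq]), so that [K] is a differential subfield of [M].
    Since [x0] is not singular, the system has a fundamental matrix [Phi] of
    power series that is the identity at [x0] ([fundamental_matrix]). At infinity
    the same holds in the coordinate [z = 1 / x], with [d/dx = - z ^ 2 d/dz].

    Transport along [Phi] turns the bracket with [X] into differentiation of the
    coefficients ([push_bracket]). Hence there is exactly one formal symmetry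
    with initial value [Y0], the image of [Y0] under [Phi], and the question is
    whether its coefficients lie in [K]. They form a solution of the Lie-Vessiot
    system induced by the action of the linear group on vector fields of bounded
    degree ([vf_algebraic_rep]). If they lie in [K], they are a rational solution,
    and Galoisian matrices fix its initial value [Y0].

    For the converse, call a constant matrix [s] a specialization if [Phi s]
    satisfies all algebraic relations over [K] that [Phi] satisfies. A rational
    solution is a polynomial in [Phi] and in the inverse of its determinant whose
    value lies in [K], which is such a relation; in the same way the directions
    of exponential pre-solutions are given by relations. So the specializations
    are Galoisian ([specializable_galoisian]). It remains to see that a
    polynomial [q] in [Phi] whose value [z] is not changed by specializations
    lies in [K] ([invariant_rational]). In the variable [s] of [Phi s] the ideal
    of the relations is stable under differentiation of the coefficients, which
    makes it generated by polynomials with constant coefficients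
    ([translated_relations_constant]). The specializations are the zeros of these
    polynomials, so by the Nullstellensatz a power of [q - z] is a combination of
    relations. Hence [q] is nilpotent up to [z] modulo an ideal that is defined
    over [K], and its minimal polynomial modulo this ideal is a power of ['X - z]
    with coefficients in [K]; therefore [z] lies in [K] ([nilpotent_rational]).
    The Nullstellensatz is derived from the uncountability of the complex
    numbers. *)


(** * The Nullstellensatz over an uncountable field *)

Definition is_ideal {S : comNzRingType} (J : S -> Prop) : Prop :=
  [/\ J 0, forall x y, J x -> J y -> J (x + y) & forall a x, J x -> J (a * x)].

Section ideals.
Context {S : comNzRingType} {J : S -> Prop} (idealJ : is_ideal J).

Lemma ideal_opp x : J x -> J (- x).
Proof. by case: idealJ => _ _ JM Jx; rewrite -mulN1r; apply: JM. Qed.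

Lemma ideal_sub x y : J x -> J y -> J (x - y).
Proof. by case: (idealJ) => _ JD _ Jx Jy; apply: JD => //; apply: ideal_opp. Qed.

Lemma ideal_mulr a x : J x -> J (x * a).
Proof. by case: idealJ => _ _ JM Jx; rewrite mulrC; apply: JM. Qed.

Lemma ideal_sum I (r : seq I) (P : pred I) (F : I -> S) :
  (forall i, P i -> J (F i)) -> J (\sum_(i <- r | P i) F i).
Proof. by case: idealJ => J0 JD _ JF; apply: (big_ind J). Qed.

Lemma ideal_congrM a b a' b' :
  J (a - b) -> J (a' - b') -> J (a * a' - b * b').
Proof.
case: idealJ => _ JD JM Jab Jab'.
have -> : a * a' - b * b' = a' * (a - b) + b * (a' - b') by ring.
by apply: JD; apply: JM.
Qed.

Lemma ideal_congrX k a b : J (a - b) -> J (a ^+ k - b ^+ k).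
Proof.
move=> Jab; elim: k => [|k IHk]; first by rewrite !expr0 subrr; case: idealJ.
by rewrite !exprS; apply: ideal_congrM.
Qed.

Lemma ideal_radical_sum I (r : seq I) (F : I -> S) :
  (forall i, exists k, J (F i ^+ k)) -> exists k, J ((\sum_(i <- r) F i) ^+ k).
Proof.
case: (idealJ) => J0 JD JM JF; elim: r => [|i r [l Jl]].
  by exists 1%N; rewrite big_nil expr1.
rewrite big_cons; have [k Jk] := JF i; exists (k + l)%N.
rewrite exprDn; apply: ideal_sum => j _; rewrite -mulr_natr; apply: ideal_mulr.
have [ltjk | lekj] := ltnP (k + l - j) k.
  have -> : nat_of_ord j = ((j - l) + l)%N by have := ltn_ord j; lia.
  by rewrite exprD; apply/JM/JM.
rewrite -(subnKC lekj) exprD; apply/ideal_mulr/ideal_mulr/Jk.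
Qed.

(** An ideal that is maximal among those avoiding the powers of [h] meets
    those powers modulo every element outside it: this makes it prime. *)
Lemma exists_maximal_ideal (h : S) : (forall k, ~ J (h ^+ k)) ->
  exists p : S -> Prop, [/\ is_ideal p, forall x, J x -> p x,
    forall k, ~ p (h ^+ k) &
    forall a, ~ p a -> exists g k, p (a * g - h ^+ k)].
Proof.
move=> hJ; case: (idealJ) => J0 JD JM.
pose P (X : set S) := [/\ forall x y, X x -> X y -> X (x + y),
  forall a x, X x -> X (a * x), forall k, ~ X (h ^+ k) &
  forall x y, X x -> J y -> X y].
have [F FP Ftot|p [[pD pM hp Jp] pmax]] := @Zorn_bigcup S P.
  split.
  - move=> x y [X FX Xx] [Y FY Yy].
    have [/(_ _ Xx) Yx|/(_ _ Yy) Xy] := Ftot _ _ FX FY.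
      by exists Y => //; case: (FP _ FY) => + _ _ _; apply.
    by exists X => //; case: (FP _ FX) => + _ _ _; apply.
  - by move=> a x [X FX Xx]; exists X => //; case: (FP _ FX) => _ + _ _; apply.
  - by move=> k [X FX Xh]; case: (FP _ FX) => _ _ + _; apply; exact: Xh.
  - move=> x y [X FX Xx] Jy; exists X => //.
    by case: (FP _ FX) => _ _ _ XJ; exact: XJ Xx Jy.
have p0 : p 0.
  have [[x px]|p_empty] := pselect (exists x, p x).
    by rewrite -(mul0r x); exact: pM.
  exfalso; apply: (pmax J); last by split.
  split; first by move=> x px; case: p_empty; exists x.
  by move=> J_p; apply: p_empty; exists 0; apply: J_p.
exists p; split=> //; first by move=> x; apply: Jp p0.
move=> a pa; apply: contrapT => no_gk.
pose B : set S := [set x | exists g, p (x - a * g)].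
have pB : p `<=` B by move=> x px; exists 0; rewrite mulr0 subr0.
apply: (pmax B); first split=> //.
  by move=> Bp; apply/pa/Bp; exists 1; rewrite mulr1 subrr.
split.
- move=> x y [g pg] [g' pg']; exists (g + g').
  have -> : x + y - a * (g + g') = (x - a * g) + (y - a * g') by ring.
  exact: pD.
- move=> b x [g pg]; exists (b * g).
  have -> : b * x - a * (b * g) = b * (x - a * g) by ring.
  exact: pM.
- move=> k [g pg]; apply: no_gk; exists g, k.
  by rewrite -opprB -mulN1r; exact: pM.
- by move=> x y _ Jy; apply: pB; exact: Jp p0 Jy.
Qed.

End ideals.

(** The consequence of uncountability that the proof uses: some class of every
    countable partition is infinite. *)
Definition uncountable_like (C : Type) : Prop :=
  forall g : C -> nat, exists k, forall t, exists c : 'I_t -> C,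
    injective c /\ forall i, g (c i) = k.

Section nullstellensatz.
Context {C : closedFieldType} (C_unc : uncountable_like C) {N : nat}.
Local Notation A := {mpoly C[N]}.

Lemma mpoly_lindep d t (g : 'I_t -> A) :
  (#|{: bmultinom N d}| < t)%N -> (forall i, (msize (g i) <= d)%N) ->
  exists2 u : 'I_t -> C, (exists i, u i != 0) & \sum_i u i *: g i = 0.
Proof.
move=> lt_t g_d; set D := #|{: bmultinom N d}| in lt_t.
pose G : 'M[C]_(t, D) := \matrix_(i, j) mcoeff (bmnm (enum_val j)) (g i).
have : kermx G != 0.
  rewrite kermx_eq0 /row_free neq_ltn (leq_ltn_trans (rank_leq_col _)) //.
move/rowV0Pn => [u /sub_kermxP uG /rV0Pn u0].
exists (u 0) => //; apply/mpolyP => m; rewrite mcoeff0 linear_sum /=.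
have [lt_md | le_dm] := ltnP (mdeg m) d; last first.
  apply: big1 => i _; rewrite mcoeffZ [mcoeff m _]memN_msupp_eq0 ?mulr0 //.
  by apply: msize_mdeg_ge; exact: leq_trans (g_d i) le_dm.
move/rowP/(_ (enum_rank (BMultinom lt_md))): uG; rewrite !mxE => uGm.
rewrite -[RHS]uGm; apply: eq_bigr => i _.
by rewrite mcoeffZ !mxE enum_rankK.
Qed.

Section avoiding.
Variables (p : A -> Prop) (h : A).
Hypotheses (p_ideal : is_ideal p) (hp : forall k, ~ p (h ^+ k)).
Hypothesis p_max : forall a, ~ p a -> exists g k, p (a * g - h ^+ k).

Lemma avoiding_prime a b : p (a * b) -> p a \/ p b.
Proof.
move=> pab; apply: contrapT => /not_orP[/p_max[g [k pg]] /p_max[g' [k' pg']]].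
apply: (@hp (k + k')); rewrite exprD.
have [_ _ pM] := p_ideal.
have := ideal_congrM p_ideal pg pg'.
have -> : a * g * (b * g') = g * g' * (a * b) by ring.
move=> pdiff; have -> : h ^+ k * h ^+ k' =
  g * g' * (a * b) - (g * g' * (a * b) - h ^+ k * h ^+ k') by ring.
by apply: (ideal_sub p_ideal) => //; apply: pM.
Qed.

Lemma avoiding_const (c : C) : p (mpolyC N c) -> c = 0.
Proof.
have [_ _ pM] := p_ideal; move=> pc; apply: contrapT => /eqP c0.
apply: (@hp 0%N); rewrite expr0 -[1](mpolyC1 N C) -(mulVf c0) mpolyCM.
exact: pM.
Qed.

(** If no [x - c] were in [p], then each [x - c] would have an inverse [g c]
    up to a power of [h] modulo [p]. Uncountably many [g c] cannot be linearly
    independent in a space of countable dimension, and a linear relation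
    between them is a nonzero polynomial in [x] that lies in [p]. *)
Lemma avoiding_value (x : A) : exists c, p (x - mpolyC N c).
Proof.
have [p0 pD pM] := p_ideal.
apply: contrapT => no_c.
have inv_c c : exists gk : A * nat, p ((x - mpolyC N c) * gk.1 - h ^+ gk.2).
  have [|g [k pg]] := @p_max (x - mpolyC N c); last by exists (g, k).
  by move=> pc; apply: no_c; exists c.
have [gk gkP] := choice inv_c.
(* Infinitely many [g c] share the same degree and the same power of [h]. *)
pose code c := pickle (msize (gk c).1, (gk c).2).
have [q qP] := C_unc code.
have [c0 [_ c0P]] := qP 1%N.
pose d := msize (gk (c0 ord0)).1; pose k := (gk (c0 ord0)).2.
have [c [c_inj cP']] := qP (#|{: bmultinom N d}|.+1).
have {cP'} cP i : msize (gk (c i)).1 = d /\ (gk (c i)).2 = k.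
  have /(pcan_inj pickleK)[-> ->//] : code (c i) = code (c0 ord0).
  by rewrite cP' c0P.
have [||u [i0 ui0] u_g] := @mpoly_lindep d _ (fun i => (gk (c i)).1).
- exact: ltnSn.
- by move=> i; case: (cP i) => ->.
pose L i := x - mpolyC N (c i).
have pu : p ((\sum_i u i *: \prod_(j | j != i) L j) * h ^+ k).
  have -> : (\sum_i u i *: \prod_(j | j != i) L j) * h ^+ k =
     (\prod_j L j) * (\sum_i u i *: (gk (c i)).1)
     - \sum_i (u i *: \prod_(j | j != i) L j) * (L i * (gk (c i)).1 - h ^+ k).
    rewrite mulr_sumr mulr_suml -sumrB; apply: eq_bigr => i _.
    rewrite [\prod_j L j](bigD1 i) //=.
    rewrite -!scalerAl -!scalerAr -scalerBr; congr (_ *: _); ring.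
  rewrite u_g mulr0; apply: (ideal_sub p_ideal) => //.
  apply: (ideal_sum p_ideal) => i _; apply: pM.
  by case: (cP i) => _ <-; exact: gkP.
have {pu} pu : p (\sum_i u i *: \prod_(j | j != i) L j).
  by have [//|/hp] := avoiding_prime pu.
(* The relation is a polynomial [F] in [x]; its value at [c i0] is a nonzero
   multiple of [u i0]. *)
pose F : {poly C} := \sum_i u i *: \prod_(j | j != i) ('X - (c j)%:P).
have x_comm : commr_rmorph (@mpolyC N C) x by move=> a; exact: mulrC.
have Fx : horner_morph x_comm F =
    \sum_i u i *: \prod_(j | j != i) L j.
  rewrite /F rmorph_sum; apply: eq_bigr => i _.
  rewrite -mul_polyC rmorphM /= horner_morphC mul_mpolyC; congr (_ *: _).
  rewrite rmorph_prod; apply: eq_bigr => j _.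
  by rewrite rmorphB /= horner_morphX horner_morphC.
have F0 : F != 0.
  apply: contraNneq ui0 => F0; have := congr1 (horner^~ (c i0)) F0.
  rewrite horner0 /F horner_sum (bigD1 i0) //= [X in _ + X]big1 ?addr0; last first.
    move=> i ii0; rewrite hornerZ horner_prod (bigD1 i0) 1?eq_sym //=.
    by rewrite hornerXsubC subrr mul0r mulr0.
  rewrite hornerZ horner_prod => /eqP; rewrite mulf_eq0 => /orP[//|].
  move/prodf_eq0 => [j ji0].
  by rewrite hornerXsubC subr_eq0 (inj_eq c_inj) eq_sym (negPf ji0).
have [r Fr] := closed_field_poly_normal F.
have : p (horner_morph x_comm F) by rewrite Fx.
rewrite Fr -mul_polyC rmorphM /= horner_morphC => /avoiding_prime[].
  by move/avoiding_const/eqP; rewrite lead_coef_eq0 (negPf F0).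
rewrite rmorph_prod.
elim: r {Fr} => [|z r IHr].
  by rewrite big_nil => p1; apply: (@hp 0%N); rewrite expr0.
rewrite big_cons => /avoiding_prime[|//].
by rewrite rmorphB /= horner_morphX horner_morphC => pz; apply: no_c; exists z.
Qed.

End avoiding.

(** Modulo a maximal ideal that avoids the powers of [h], every variable is a
    constant by [avoiding_value]; these constants are the point. *)
Theorem nullstellensatz (J : A -> Prop) (h : A) :
  is_ideal J -> (forall k, ~ J (h ^+ k)) ->
  exists c : 'I_N -> C, (forall f, J f -> meval c f = 0) /\ meval c h != 0.
Proof.
move=> idealJ /(exists_maximal_ideal idealJ)[p [p_ideal Jp hp p_max]].
have [c cP] := choice (fun i => avoiding_value p_ideal hp p_max (mpolyX C (mnm1 i))).
have pc f : p (f - mpolyC N (meval c f)).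
  rewrite {1}[f]mpolyE mevalE rmorph_sum -sumrB.
  apply: (ideal_sum p_ideal) => m _.
  rewrite -mul_mpolyC rmorphM /=; apply: (ideal_congrM p_ideal).
    by rewrite subrr; case: p_ideal.
  rewrite mpolyXE_id rmorph_prod /=.
  apply: (big_ind2 (fun a b => p (a - b))) => [|a b a' b' pa pb|i _].
  - by rewrite subrr; case: p_ideal.
  - exact: (ideal_congrM p_ideal).
  - by rewrite rmorphXn /=; apply: (ideal_congrX p_ideal).
exists c; split=> [f Jf|].
  apply: (avoiding_const p_ideal hp).
  have -> : mpolyC N (meval c f) = f - (f - mpolyC N (meval c f)) by ring.
  by apply: (ideal_sub p_ideal) => //; exact: Jp.
apply/eqP => hc; apply: (@hp 1%N).
by have := pc h; rewrite hc mpolyC0 subr0 expr1.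
Qed.

End nullstellensatz.

(** * Polynomials in several variables and derivations *)

Section mpoly_tools.

Lemma mpoly_ring_ind n (S : comNzRingType) (P : {mpoly S[n]} -> Prop) :
  (forall c, P (mpolyC n c)) -> (forall i, P (mpolyX S (mnm1 i))) ->
  (forall p q, P p -> P q -> P (p + q)) ->
  (forall p q, P p -> P q -> P (p * q)) -> forall p, P p.
Proof.
move=> PC PX PD PM; elim/mpolyind => [|c m p _ _ Pp].
  by rewrite -(mpolyC0 n S); apply: (PC).
apply: (PD) => //; rewrite -mul_mpolyC; apply: (PM) => //.
rewrite mpolyXE_id. apply: (big_ind P) => // [|i _].
  by rewrite -(mpolyC1 n S); apply: (PC).
elim: (m i) => [|k IHk]; last by rewrite exprS; apply: (PM).
by rewrite expr0 -(mpolyC1 n S); apply: (PC).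
Qed.

Lemma rmorph_mmap {n} {S T U : comNzRingType} (r : {rmorphism T -> U})
    (g : {rmorphism S -> T}) (h : 'I_n -> T) p :
  r (mmap g h p) = mmap (r \o g) (r \o h) p.
Proof.
elim/mpoly_ring_ind: p => [c|i|p q|p q].
- by rewrite !mmapC.
- by rewrite !mmapX !mmap1U.
- by rewrite !rmorphD /= => -> ->.
- by rewrite !rmorphM /= => -> ->.
Qed.

Lemma eq_mmap {n} {S T : comNzRingType} (g g' : S -> T) (h h' : 'I_n -> T) p :
  g =1 g' -> h =1 h' -> mmap g h p = mmap g' h' p.
Proof.
move=> eq_g eq_h; apply: eq_bigr => m _; rewrite eq_g; congr (_ * _).
exact: mmap1_eq.
Qed.

Lemma mmap_map_mpoly {n} {S T U : comNzRingType} (g : {rmorphism T -> U})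
    (f : {rmorphism S -> T}) (h : 'I_n -> U) p :
  mmap g h (map_mpoly f p) = mmap (g \o f) h p.
Proof.
rewrite rmorph_mmap; apply: eq_mmap => [c|i] /=; first by rewrite mmapC.
by rewrite mmapX mmap1U.
Qed.

Lemma mmap_mpolyX_id {n} {S : comNzRingType} (p : {mpoly S[n]}) :
  mmap (@mpolyC n S) (fun i => mpolyX S (mnm1 i)) p = p.
Proof.
elim/mpoly_ring_ind: p => [c|i|p q|p q].
- by rewrite mmapC.
- by rewrite mmapX mmap1U.
- by rewrite rmorphD /= => -> ->.
- by rewrite rmorphM /= => -> ->.
Qed.

Lemma mcoeff_sum_msupp {n} {S T : nzRingType} (c : multinom n -> T)
    (p : {mpoly S[n]}) m :
  mcoeff m (\sum_(k <- msupp p) c k *: mpolyX T k) =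
  if m \in msupp p then c m else 0.
Proof.
rewrite linear_sum /=; under eq_bigr do rewrite mcoeffZ mcoeffX.
have [m_p | m_p] := ifPn.
  rewrite (bigD1_seq m) ?msupp_uniq //= eqxx mulr1 big1 ?addr0 // => k.
  by move/negPf=> ->; rewrite mulr0.
rewrite big1_seq // => k /andP[_ k_p]; have [km|_] := eqVneq k m.
  by rewrite km (negPf m_p) in k_p.
by rewrite mulr0.
Qed.

Lemma mpoly_choice {n} {S T : nzRingType} (Q : S -> T -> Prop)
    (p : {mpoly S[n]}) :
  Q 0 0 -> (forall m, exists c, Q (mcoeff m p) c) ->
  exists q : {mpoly T[n]}, forall m, Q (mcoeff m p) (mcoeff m q).
Proof.
move=> Q0 /choice[c cP]; exists (\sum_(m <- msupp p) c m *: mpolyX T m) => m.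
by rewrite mcoeff_sum_msupp; case: ifPn => [//|/memN_msupp_eq0 ->].
Qed.

(** The derivation of total functions is not additive everywhere, which is why
    only the value at zero is assumed. *)
Lemma mcoeff_map_mpoly0 {n} {S T : nzRingType} (f : S -> T)
    (p : {mpoly S[n]}) m :
  f 0 = 0 -> mcoeff m (map_mpoly f p) = f (mcoeff m p).
Proof.
move=> f0; have -> : map_mpoly f p =
    \sum_(k <- msupp p) f (mcoeff k p) *: mpolyX T k.
  by apply: eq_bigr => k _; rewrite mmap1_id mul_mpolyC.
by rewrite mcoeff_sum_msupp; case: ifPn => // /memN_msupp_eq0 ->.
Qed.

End mpoly_tools.

Definition leibniz {S : pzRingType} (d : S -> S) : Prop :=
  forall x y, d (x * y) = d x * y + x * d y.

Section derivations.
Context {S : comNzRingType} {d : {additive S -> S}} (dM : leibniz d).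

Lemma leibniz1 : d 1 = 0.
Proof.
have := dM 1 1; rewrite !mulr1 mul1r => /eqP.
by rewrite -{1}[d 1]addr0 (inj_eq (addrI _)) eq_sym => /eqP.
Qed.

Lemma leibnizX x k : d (x ^+ k.+1) = (k.+1)%:R * x ^+ k * d x.
Proof.
elim: k => [|k IHk]; first by rewrite expr1 expr0 !mul1r.
by rewrite exprS dM IHk [in RHS]mulrSr exprS; ring.
Qed.

Lemma leibniz_map_mpoly n : leibniz (map_mpoly d : {mpoly S[n]} -> _).
Proof.
have ZX c m : map_mpoly d (c *: mpolyX S m : {mpoly S[n]}) = d c *: mpolyX S m.
  apply/mpolyP => k; rewrite mcoeff_map_mpoly !mcoeffZ mcoeffX.
  by case: eqP; rewrite ?mulr1 ?mulr0 ?raddf0.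
elim/mpolyind => [q|c m p _ _ IHp q].
  by rewrite mul0r !raddf0 mul0r mul0r addr0.
rewrite mulrDl !raddfD /= IHp ZX mulrDl; set x := map_mpoly d (_ * q).
suff -> : x = d c *: mpolyX S m * q + c *: mpolyX S m * map_mpoly d q by ring.
rewrite {}/x; elim/mpolyind: q => [|e k q _ _ IHq].
  by rewrite mulr0 !raddf0 mulr0 mulr0 addr0.
rewrite mulrDr !raddfD /= IHq ZX !mulrDr.
suff -> : map_mpoly d (c *: mpolyX S m * (e *: mpolyX S k)) =
  d c *: mpolyX S m * (e *: mpolyX S k) + c *: mpolyX S m * (d e *: mpolyX S k)
  by ring.
rewrite -!(scalerAl, scalerAr) !scalerA -mpolyXD ZX dM scalerDl.
by rewrite mulrC [X in _ + X *: _]mulrC.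
Qed.

Lemma map_mpoly_leibnizZ n c (p : {mpoly S[n]}) :
  map_mpoly d (c *: p) = d c *: p + c *: map_mpoly d p.
Proof.
rewrite -mul_mpolyC leibniz_map_mpoly !mul_mpolyC; congr (_ + _).
by rewrite map_mpolyC mul_mpolyC.
Qed.

Lemma map_mx_leibniz m n p (X : 'M[S]_(m, n)) (Y : 'M[S]_(n, p)) :
  map_mx d (X *m Y) = map_mx d X *m Y + X *m map_mx d Y.
Proof.
apply/matrixP => i j; rewrite !mxE raddf_sum -big_split; apply: eq_bigr => k _ /=.
by rewrite !mxE dM.
Qed.

End derivations.

Section chain_rule.
Context {n : nat} {S T : comNzRingType} {g : {rmorphism S -> T}}.
Context {D : {additive S -> S}} {d : {additive T -> T}}.
Hypotheses (DM : leibniz D) (dM : leibniz d) (dg : forall x, d (g x) = g (D x)).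

Lemma chain_rule (h : 'I_n -> T) p :
  d (mmap g h p) =
  mmap g h (map_mpoly D p) + \sum_k mmap g h (mderiv k p) * d (h k).
Proof.
elim/mpoly_ring_ind: p => [c|i|p q Hp Hq|p q Hp Hq].
- rewrite map_mpolyC !mmapC dg big1 ?addr0 // => k _.
  by rewrite mderivC raddf0 mul0r.
- have -> : map_mpoly D (mpolyX S (mnm1 i)) = 0.
    apply/mpolyP => k; rewrite mcoeff_map_mpoly mcoeffX mcoeff0.
    by case: eqP => _; rewrite ?raddf0 // (leibniz1 DM).
  rewrite raddf0 add0r mmapX mmap1U (bigD1 i) //= big1 ?addr0 => [|k ki].
    rewrite mderivX mnm1E eqxx scale1r.
    have -> : mnm_sub (mnm1 i) (mnm1 i) = mnm0 by apply/mnmP => j; rewrite mnmBE mnm0E subnn.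
    by rewrite mmapX mmap11 mul1r.
  by rewrite mderivX mnm1E eq_sym (negPf ki) scale0r raddf0 mul0r.
- rewrite !raddfD /= Hp Hq addrACA; congr (_ + _).
  under [RHS]eq_bigr do rewrite !raddfD mulrDl.
  by rewrite big_split.
- rewrite rmorphM /= dM Hp Hq (leibniz_map_mpoly DM) rmorphD !rmorphM /=.
  rewrite !(mulrDl, mulrDr).
  rewrite addrACA; congr (_ + _).
  under [RHS]eq_bigr do rewrite mderivM rmorphD !rmorphM /=.
  under [RHS]eq_bigr do rewrite mulrDl.
  rewrite big_split /=; congr (_ + _).
    by rewrite mulr_suml; apply: eq_bigr => k _; ring.
  by rewrite mulr_sumr; apply: eq_bigr => k _; ring.
Qed.

End chain_rule.

(** * Linear algebra over a subfield *)

Record is_subfield {M : fieldType} (K : M -> Prop) : Prop := {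
  sf1 : K 1;
  sfB : forall x y, K x -> K y -> K (x - y);
  sfM : forall x y, K x -> K y -> K (x * y);
  sfV : forall x, K x -> K x^-1 }.

Section subfield_theory.
Context {M : fieldType} {K : M -> Prop} (subK : is_subfield K).

Lemma sf0 : K 0.
Proof. by rewrite -(subrr 1); apply: (sfB subK); apply: sf1 subK. Qed.

Lemma sfN x : K x -> K (- x).
Proof. by move=> Kx; rewrite -sub0r; apply: (sfB subK) => //; apply: sf0. Qed.

Lemma sfD x y : K x -> K y -> K (x + y).
Proof. by move=> Kx Ky; rewrite -[y]opprK; apply: (sfB subK) => //; apply: sfN. Qed.

Lemma sf_sum I (r : seq I) (P : pred I) (F : I -> M) :
  (forall i, P i -> K (F i)) -> K (\sum_(i <- r | P i) F i).
Proof. by move=> KF; apply: (big_ind K) => //; [apply: sf0 | apply: sfD]. Qed.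

Lemma sfMn x k : K x -> K (x *+ k).
Proof.
move=> Kx; elim: k => [|k IHk]; first by rewrite mulr0n; apply: sf0.
by rewrite mulrS; apply: sfD.
Qed.

Definition coefs_in {n} (p : {mpoly M[n]}) := forall m, K (mcoeff m p).

Lemma coefs_inC n c : K c -> coefs_in (mpolyC n c).
Proof.
by move=> Kc m; rewrite mcoeffC; apply: (sfM subK) => //; case: eqP => _; [apply: (sf1 subK) | apply: sf0].
Qed.

Lemma coefs_inX n m : coefs_in (mpolyX M m : {mpoly M[n]}).
Proof. by move=> k; rewrite mcoeffX; case: eqP => _; [apply: (sf1 subK) | apply: sf0]. Qed.

Lemma coefs_inB n (p q : {mpoly M[n]}) : coefs_in p -> coefs_in q -> coefs_in (p - q).
Proof. by move=> Kp Kq m; rewrite mcoeffB; apply: (sfB subK). Qed.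

Lemma coefs_inD n (p q : {mpoly M[n]}) : coefs_in p -> coefs_in q -> coefs_in (p + q).
Proof. by move=> Kp Kq m; rewrite mcoeffD; apply: sfD. Qed.

Lemma coefs_in_sum n I (r : seq I) (P : pred I) (F : I -> {mpoly M[n]}) :
  (forall i, P i -> coefs_in (F i)) -> coefs_in (\sum_(i <- r | P i) F i).
Proof.
move=> KF; apply: (big_ind coefs_in) => //; last exact: coefs_inD.
by move=> m; rewrite mcoeff0; apply: sf0.
Qed.

Lemma coefs_inM n (p q : {mpoly M[n]}) : coefs_in p -> coefs_in q -> coefs_in (p * q).
Proof. by move=> Kp Kq m; rewrite mcoeffM; apply: sf_sum => k _; apply: (sfM subK). Qed.

Lemma coefs_inZ n c (p : {mpoly M[n]}) : K c -> coefs_in p -> coefs_in (c *: p).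
Proof. by move=> Kc Kp m; rewrite mcoeffZ; apply: (sfM subK). Qed.

Lemma coefs_in_prod n I (r : seq I) (P : pred I) (F : I -> {mpoly M[n]}) :
  (forall i, P i -> coefs_in (F i)) -> coefs_in (\prod_(i <- r | P i) F i).
Proof.
move=> KF; apply: (big_ind coefs_in) => //; last exact: coefs_inM.
by rewrite -(mpolyC1 n M); apply: coefs_inC (sf1 subK).
Qed.

Lemma coefs_inE n (p : {mpoly M[n]}) k : coefs_in p -> coefs_in (p ^+ k).
Proof.
move=> Kp; elim: k => [|k IHk]; last by rewrite exprS; apply: coefs_inM.
by rewrite expr0 -(mpolyC1 n M); apply: coefs_inC (sf1 subK).
Qed.

Lemma coefs_in_deriv n (p : {mpoly M[n]}) i : coefs_in p -> coefs_in (mderiv i p).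
Proof. by move=> Kp m; rewrite mcoeff_mderiv; apply: sfMn. Qed.

(** The members of the family are indexed from [0] to [t] included. *)
Definition free_over (t : nat) (e : nat -> M) : Prop :=
  forall c : nat -> M, (forall i, K (c i)) -> \sum_(i < t.+1) c i * e i = 0 ->
  forall i, (i <= t)%N -> c i = 0.

Definition spans_over (t : nat) (e : nat -> M) (x : M) : Prop :=
  exists c : nat -> M, (forall i, K (c i)) /\ x = \sum_(i < t.+1) c i * e i.

(** The basis starts with [1] so that the component along [e 0] of an element
    of the subfield is the element itself. *)
Lemma exists_basis (s : seq M) : exists t e,
  [/\ e 0%N = 1, free_over t e & forall x, x \in s -> spans_over t e x].
Proof.
elim: s => [|x s [t [e [e0 e_free e_span]]]].
  exists 0%N, (fun=> 1); split=> // c Kc; rewrite big_ord1 mulr1 => c0 i.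
  by rewrite leqn0 => /eqP ->.
have [x_e | x_e] := pselect (spans_over t e x).
  by exists t, e; split=> // y; rewrite in_cons => /orP[/eqP ->|/e_span].
pose e' i := if i == t.+1 then x else e i.
have e'E (c : nat -> M) : \sum_(i < t.+2) c i * e' i =
    \sum_(i < t.+1) c i * e i + c t.+1 * x.
  rewrite big_ord_recr /= {2}/e' eqxx; congr (_ + _); apply: eq_bigr => i _.
  by rewrite /e' ltn_eqF // ltnS; have := ltn_ord i.
exists t.+1, e'; split=> //.
- move=> c Kc; rewrite e'E => c_e.
  have ct : c t.+1 = 0.
    apply: contrapT => /eqP ct; apply: x_e.
    exists (fun i => - (c t.+1)^-1 * c i); split=> [i|].
      by apply: (sfM subK) => //; apply/sfN/(sfV subK).
    under eq_bigr do rewrite -mulrA; rewrite -mulr_sumr.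
    have -> : \sum_(i < t.+1) c i * e i = - (c t.+1 * x).
      by apply/eqP; rewrite -addr_eq0 c_e.
    by rewrite mulNr mulrN opprK mulKf.
  move: c_e; rewrite ct mul0r addr0 => /(e_free _ Kc) c0 i.
  by rewrite leq_eqVlt => /orP[/eqP -> //|]; rewrite ltnS; apply: c0.
- have span_e y : spans_over t e y -> spans_over t.+1 e' y.
    move=> [c [Kc ->]]; exists (fun i => if i == t.+1 then 0 else c i).
    split=> [i|]; first by case: eqP => // _; apply: sf0.
    rewrite (e'E (fun i => if i == t.+1 then 0 else c i)) eqxx mul0r addr0.
    apply: eq_bigr => i _.
    by rewrite ltn_eqF // ltnS; have := ltn_ord i.
  move=> y; rewrite in_cons => /orP[/eqP ->|/e_span/span_e //].
  exists (fun i => (i == t.+1)%:R); split=> [i|].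
    by case: eqP => _; [apply: (sf1 subK) | apply: sf0].
  rewrite (e'E (fun i => (i == t.+1)%:R)) eqxx mul1r big1 ?add0r // => i _.
  by rewrite ltn_eqF ?mul0r // ltnS; have := ltn_ord i.
Qed.

Lemma free_over_mpoly n t e (F : nat -> {mpoly M[n]}) :
  free_over t e -> (forall i, coefs_in (F i)) ->
  \sum_(i < t.+1) e i *: F i = 0 -> forall i, (i <= t)%N -> F i = 0.
Proof.
move=> e_free KF F_e i le_it; apply/mpolyP => m; rewrite mcoeff0.
apply: (e_free (fun i => mcoeff m (F i)) _ _ i le_it) => [j|]; first exact: KF.
have := congr1 (mcoeff m) F_e; rewrite mcoeff0 linear_sum => mF_e.
by rewrite -[RHS]mF_e; apply: eq_bigr => j _; rewrite /= mcoeffZ mulrC.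
Qed.

Lemma mpoly_expand n t e (p : {mpoly M[n]}) :
  (forall m, spans_over t e (mcoeff m p)) ->
  exists F : nat -> {mpoly M[n]}, (forall i, coefs_in (F i)) /\
    p = \sum_(i < t.+1) e i *: F i.
Proof.
move=> /choice[c cP].
exists (fun i => \sum_(m <- msupp p) c m i *: mpolyX M m); split=> [i m|].
  by rewrite mcoeff_sum_msupp; case: ifP => _; [case: (cP m)|apply: sf0].
rewrite {1}[p]mpolyE; under [RHS]eq_bigr do rewrite scaler_sumr.
rewrite exchange_big /=; apply: eq_bigr => m _.
have [_ {1}->] := cP m; rewrite scaler_suml; apply: eq_bigr => i _.
by rewrite scalerA mulrC.
Qed.

End subfield_theory.
Arguments coefs_in {M} K {n} p.

Section spans.
Context {M : fieldType} {n : nat}.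
Local Notation A := {mpoly M[n]}.

Definition mspan (Q : A -> Prop) (f : A) : Prop :=
  exists s : seq (M * A), (forall x, x \in s -> Q x.2) /\
    f = \sum_(x <- s) x.1 *: x.2.

Lemma mspan0 Q : mspan Q 0.
Proof. by exists [::]; rewrite big_nil. Qed.

Lemma mspanD Q f g : mspan Q f -> mspan Q g -> mspan Q (f + g).
Proof.
move=> [s [Qs ->]] [s' [Qs' ->]]; exists (s ++ s'); rewrite big_cat; split=> //.
by move=> x; rewrite mem_cat => /orP[/Qs|/Qs'].
Qed.

Lemma mspan_sum Q I (r : seq I) (P : pred I) (F : I -> A) :
  (forall i, P i -> mspan Q (F i)) -> mspan Q (\sum_(i <- r | P i) F i).
Proof. by move=> QF; apply: (big_ind (mspan Q)) => //; [apply: mspan0|apply: mspanD]. Qed.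

Lemma mspan1 Q c f : Q f -> mspan Q (c *: f).
Proof.
by move=> Qf; exists [:: (c, f)]; rewrite big_seq1; split=> // x; rewrite inE => /eqP ->.
Qed.

Lemma mspan_ind Q (P : A -> Prop) :
  P 0 -> (forall c f g, Q f -> P g -> P (c *: f + g)) ->
  forall f, mspan Q f -> P f.
Proof.
move=> P0 PZD f [s [Qs ->]]; elim: s Qs => [|[c g] s IHs] Qs; first by rewrite big_nil.
rewrite big_cons; apply: PZD; first by apply: (Qs (c, g)); rewrite mem_head.
by apply: IHs => x xs; apply: Qs; rewrite in_cons xs orbT.
Qed.

Lemma mspanZ Q c f : mspan Q f -> mspan Q (c *: f).
Proof.
move: f; apply: mspan_ind => [|a f g Qf IHg]; first by rewrite scaler0; apply: mspan0.
by rewrite scalerDr scalerA; apply: mspanD => //; apply: mspan1.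
Qed.

Lemma mspan_ideal Q : (forall f g, Q f -> mspan Q (g * f)) -> is_ideal (mspan Q).
Proof.
move=> QM; split; [exact: mspan0 | exact: mspanD | move=> a f].
move: f; apply: mspan_ind => [|c f g Qf IHg]; first by rewrite mulr0; apply: mspan0.
by rewrite mulrDr -scalerAr; apply: mspanD => //; apply/mspanZ/QM.
Qed.

End spans.

(** * Polynomials in the entries of a matrix *)

Section matrix_polynomials.
Context {n : nat}.

Definition mxev {S T : comNzRingType} (g : S -> T) (s : 'M[T]_n) :
    {mpoly S[n * n]} -> T :=
  mmap g (fun k => mxvec s 0 k).

Definition genmx (S : comNzRingType) : 'M[{mpoly S[n * n]}]_n :=
  \matrix_(i, j) mpolyX S (mnm1 (mxvec_index i j)).

HB.instance Definition _ (S T : comNzRingType) (g : {rmorphism S -> T}) s :=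
  GRing.RMorphism.copy (mxev g s) (mmap g (fun k => mxvec s 0 k)).

Lemma mxvec_genmx S k : mxvec (genmx S) 0 k = mpolyX S (mnm1 k).
Proof. by case/mxvec_indexP: k => i j; rewrite mxvecE mxE. Qed.

Lemma mxevC {S T : comNzRingType} (g : {rmorphism S -> T}) s c :
  mxev g s (mpolyC _ c) = g c.
Proof. exact: mmapC. Qed.

Lemma mxevZ {S T : comNzRingType} (g : {rmorphism S -> T}) s c p :
  mxev g s (c *: p) = g c * mxev g s p.
Proof. exact: mmapZ. Qed.

Lemma mxev_genmx {S T : comNzRingType} (g : {rmorphism S -> T}) s :
  map_mx (mxev g s) (genmx S) = s.
Proof. by apply/matrixP => i j; rewrite !mxE /mxev mmapX mmap1U mxvecE. Qed.

Lemma rmorph_mxev {S T U : comNzRingType} (r : {rmorphism T -> U})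
    (g : {rmorphism S -> T}) s p :
  r (mxev g s p) = mxev (r \o g) (map_mx r s) p.
Proof.
by rewrite rmorph_mmap; apply: eq_mmap => // k /=; rewrite -map_mxvec mxE.
Qed.

Lemma mxev_map {S T U : comNzRingType} (g : {rmorphism T -> U})
    (f : {rmorphism S -> T}) s p :
  mxev g s (map_mpoly f p) = mxev (g \o f) s p.
Proof. exact: mmap_map_mpoly. Qed.

Lemma eq_mxev {S T : comNzRingType} (g g' : S -> T) s p :
  g =1 g' -> mxev g s p = mxev g' s p.
Proof. by move=> eq_g; apply: eq_mmap. Qed.

Lemma mxev_genmx_id {S : comNzRingType} p : mxev (@mpolyC _ S) (genmx S) p = p.
Proof.
rewrite -[RHS]mmap_mpolyX_id; apply: eq_mmap => // k; exact: mxvec_genmx.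
Qed.

(** The derivation of the polynomials in the entries of a matrix [s] that
    extends [D] and satisfies the linear system [s' = A s]. *)
Definition mxderiv {S : comNzRingType} (D : S -> S) (A : 'M[S]_n) p :=
  map_mpoly D p + \sum_k mderiv k p *
    mxvec (map_mx (@mpolyC (n * n) S) A *m genmx S) 0 k.

Lemma mxev_deriv {S T : comNzRingType} (g : {rmorphism S -> T})
    (D : {additive S -> S}) (d : {additive T -> T}) (A : 'M[S]_n) (s : 'M[T]_n) p :
  leibniz D -> leibniz d -> (forall x, d (g x) = g (D x)) ->
  map_mx d s = map_mx g A *m s ->
  d (mxev g s p) = mxev g s (mxderiv D A p).
Proof.
move=> DM dM dg ds; rewrite /mxev (chain_rule DM dM dg) rmorphD; congr (_ + _).
rewrite rmorph_sum; apply: eq_bigr => k _; rewrite rmorphM; congr (_ * _).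
rewrite -[RHS]/(mxev g s _); have := map_mxvec (mxev g s)
  (map_mx (@mpolyC (n * n) S) A *m genmx S).
move/matrixP/(_ 0 k); rewrite [LHS]mxE => ->; rewrite map_mxM mxev_genmx.
have -> : map_mx (mxev g s) (map_mx (@mpolyC (n * n) S) A) = map_mx g A.
  by apply/matrixP => i j; rewrite !mxE mxevC.
by rewrite -ds -map_mxvec mxE.
Qed.

End matrix_polynomials.

(** * The Galois correspondence *)

Section differential_field.
Context {C : closedFieldType} (C_unc : uncountable_like C).
Context {M : fieldType} (M_char0 : forall k, k.+1%:R != 0 :> M).
Context {iota : {rmorphism C -> M}} {D : {additive M -> M}} (DM : leibniz D).
Hypothesis D_const : forall x, D x = 0 <-> exists c, x = iota c.
Context {K : M -> Prop} (subK : is_subfield K).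
Hypotheses (K_const : forall c, K (iota c)) (K_D : forall x, K x -> K (D x)).
Context {N : nat} {A Phi Phi' : 'M[M]_N} (K_A : forall i j, K (A i j)).
Hypotheses (Phi_inv : Phi *m Phi' = 1%:M) (D_Phi : map_mx D Phi = A *m Phi).
Local Notation P := {mpoly M[N * N]}.
Local Notation PC := {mpoly C[N * N]}.
Local Notation toM := (map_mpoly iota).

Lemma D_iota c : D (iota c) = 0.
Proof. by apply/D_const; exists c. Qed.

Definition relation (f : P) : Prop := coefs_in K f /\ mxev idfun Phi f = 0.

(** Specializations of the fundamental matrix: translating [Phi] by such an
    [s] on the right is compatible with all algebraic relations over [K]. *)
Definition specializable (s : 'M[C]_N) : Prop :=
  forall f, relation f -> mxev idfun (Phi *m map_mx iota s) f = 0.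

Definition translate_mx (B : 'M[M]_N) : 'M[P]_N :=
  map_mx (@mpolyC (N * N) M) B *m genmx M.
Definition translate (B : 'M[M]_N) : P -> P :=
  mxev (@mpolyC (N * N) M) (translate_mx B).

HB.instance Definition _ (B : 'M[M]_N) := GRing.RMorphism.copy (translate B)
  (mxev (@mpolyC (N * N) M) (translate_mx B)).

Lemma translateC B c : translate B (mpolyC _ c) = mpolyC _ c.
Proof. exact: mxevC. Qed.

Lemma translateZ B c f : translate B (c *: f) = c *: translate B f.
Proof. by rewrite /translate mxevZ mul_mpolyC. Qed.

Lemma map_translateC (B B' : 'M[M]_N) : map_mx (translate B) (map_mx (@mpolyC (N * N) M) B') =
  map_mx (@mpolyC (N * N) M) B'.
Proof. by apply/matrixP => i j; rewrite !mxE translateC. Qed.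

Lemma translateM B B' f :
  translate B (translate B' f) = translate (B' *m B) f.
Proof.
rewrite {2}/translate rmorph_mxev /translate /translate_mx map_mxM map_translateC mxev_genmx.
rewrite mulmxA -map_mxM; apply: eq_mxev => c /=; exact: translateC.
Qed.

Lemma translate1 f : translate 1%:M f = f.
Proof. by rewrite /translate /translate_mx map_mx1 mul1mx mxev_genmx_id. Qed.

Lemma mxev_translate s B f :
  mxev idfun s (translate B f) = mxev idfun (B *m s) f.
Proof.
rewrite /translate rmorph_mxev /translate_mx map_mxM mxev_genmx.
have -> : map_mx (mxev idfun s) (map_mx (@mpolyC (N * N) M) B) = B.
  by apply/matrixP => i j; rewrite !mxE mxevC.
by apply: eq_mxev => c /=; rewrite mxevC.
Qed.

Definition relations := mspan relation.
(** The relations in the variable [s] of [X = Phi s]. The columns of [Phi] are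
    solutions, so that the derivation extending the system acts on this ideal
    through the coefficients alone. *)
Definition translated_relations :=
  mspan (fun f => exists2 g, relation g & f = translate Phi g).

Lemma relationsE f : relations f <-> translated_relations (translate Phi f).
Proof.
have Phi_inv' := mulmx1C Phi_inv; split.
  move: f; apply: mspan_ind => [|c f g f_rel IHg].
    by rewrite rmorph0; apply: mspan0.
  by rewrite rmorphD /= translateZ; apply: mspanD => //; apply: mspan1; exists f.
rewrite -{2}[f]translate1 -Phi_inv -translateM; move: (translate Phi f) => {f}.
apply: mspan_ind => [|c _ g [f f_rel ->] IHg]; first by rewrite rmorph0; apply: mspan0.
rewrite rmorphD /= translateZ translateM Phi_inv translate1.
by apply: mspanD => //; apply: mspan1.
Qed.

Lemma relations_ideal : is_ideal relations.
Proof.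
apply: mspan_ideal => f g [Kf f0]; rewrite [g]mpolyE mulr_suml.
apply: mspan_sum => m _; rewrite -scalerAl; apply: mspan1; split.
  by apply: (coefs_inM subK) => //; apply: (coefs_inX subK).
by rewrite rmorphM /= f0 mulr0.
Qed.

Lemma translated_relations_ideal : is_ideal translated_relations.
Proof.
have [r0 rD rM] := relations_ideal.
have E f : translated_relations f <-> relations (translate Phi' f).
  by rewrite relationsE translateM (mulmx1C Phi_inv) translate1.
split; first by apply/E; rewrite rmorph0.
  by move=> f g /E rf /E rg; apply/E; rewrite rmorphD; apply: rD.
by move=> f g /E rg; apply/E; rewrite rmorphM; apply: rM.
Qed.

Lemma relation_mxderiv f : relation f -> relation (mxderiv D A f).
Proof.
move=> [Kf f0]; split.
  apply: (coefs_inD subK) => //.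
    by move=> m; rewrite mcoeff_map_mpoly; apply: K_D.
  apply: (coefs_in_sum subK) => // k _; apply: (coefs_inM subK) => //; first exact: (coefs_in_deriv subK).
  case/mxvec_indexP: k => i j; rewrite mxvecE mxE.
  apply: (coefs_in_sum subK) => // l _; apply: (coefs_inM subK) => //; rewrite !mxE.
    by apply: (coefs_inC subK).
  exact: (coefs_inX subK).
rewrite -(mxev_deriv (d := D) f DM DM) ?f0 ?raddf0 //.
by rewrite D_Phi; congr (_ *m _); apply/matrixP => i j; rewrite mxE.
Qed.

Lemma translated_relations_deriv f :
  translated_relations f -> translated_relations (map_mpoly D f).
Proof.
have DM' := @leibniz_map_mpoly _ _ DM (N * N).
move: f; apply: mspan_ind => [|c _ g [f f_rel ->] IHg].
  by rewrite raddf0; apply: mspan0.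
rewrite raddfD /= (map_mpoly_leibnizZ DM); apply: mspanD => //; apply: mspanD; apply: mspan1.
  by exists f.
exists (mxderiv D A f); first exact: relation_mxderiv.
apply: (mxev_deriv (d := map_mpoly D) f DM DM') => [x|].
  by rewrite /= map_mpolyC.
apply/matrixP => i j; rewrite mulmxA -map_mxM -D_Phi !mxE raddf_sum /=.
apply: eq_bigr => k _; rewrite !mxE /= mul_mpolyC (map_mpoly_leibnizZ DM).
suff -> : map_mpoly D (mpolyX M (mnm1 (mxvec_index k j))) = 0 :> P.
  by rewrite scaler0 addr0 mul_mpolyC.
apply/mpolyP => m; rewrite mcoeff_map_mpoly mcoeffX mcoeff0.
by case: eqP; rewrite ?raddf0 ?(leibniz1 DM).
Qed.

Definition constant_relation (g : PC) := translated_relations (toM g).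

Lemma constant_relation_ideal : is_ideal constant_relation.
Proof.
have [r0 rD rM] := translated_relations_ideal; split.
- by rewrite /constant_relation raddf0.
- by move=> f g Jf Jg; rewrite /constant_relation raddfD; apply: rD.
- by move=> f g Jg; rewrite /constant_relation rmorphM; apply: rM.
Qed.

(** A differential ideal over [M] is generated by its elements with constant
    coefficients. Normalize one coefficient that is not constant to [1]: the
    derivative has fewer monomials. *)
Lemma translated_relations_constant f : translated_relations f ->
  mspan (fun h => exists2 g, constant_relation g & h = toM g) f.
Proof.
set J := mspan _; have [k] := ubnP (size (msupp f)).
elim: k f => [//|k IHk] f; rewrite ltnS => size_f f_rel.
have [_ _ rM] := translated_relations_ideal.
have rZ c g : translated_relations g -> translated_relations (c *: g).
  by rewrite -mul_mpolyC; apply: rM.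
have J_norm m g : translated_relations g -> {subset msupp g <= msupp f} ->
    m \in msupp f -> mcoeff m g = 1 -> J (map_mpoly D g).
  move=> g_rel g_f m_f gm; apply: IHk; last exact: translated_relations_deriv.
  apply: leq_trans size_f; apply: (@leq_ltn_trans (size (rem m (msupp f)))).
    apply: uniq_leq_size (msupp_uniq _) _ => l; rewrite mcoeff_msupp mcoeff_map_mpoly => Dl.
    rewrite (mem_rem_uniq _ (msupp_uniq f)) inE; apply/andP; split.
      by apply: contraNneq Dl => ->; rewrite gm (leibniz1 DM).
    apply: g_f; rewrite mcoeff_msupp; apply: contraNneq Dl => ->.
    by rewrite raddf0.
  by rewrite size_rem // prednK // -has_predT; apply/hasP; exists m.
have [->|f0] := eqVneq f 0; first exact: mspan0.
have [m0 m0_f] : exists m, m \in msupp f.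
  case: (msupp f) (msupp_eq0 f) => [|m s _]; first by rewrite eqxx (negPf f0).
  by exists m; rewrite mem_head.
pose c0 := mcoeff m0 f; have c0_neq0 : c0 != 0 by rewrite -mcoeff_msupp.
pose g := c0^-1 *: f.
have g_rel : translated_relations g by apply: rZ.
have fE : f = c0 *: g by rewrite /g scalerA divff // scale1r.
have g_f : {subset msupp g <= msupp f} by exact: msuppZ_le.
have gm0 : mcoeff m0 g = 1 by rewrite mcoeffZ mulVf.
have JDg : J (map_mpoly D g) by exact: J_norm g_rel g_f m0_f gm0.
have [g_const|/existsNP[m1 gm1]] := pselect (forall m, exists c, mcoeff m g = iota c).
  have [|h hP] := mpoly_choice (Q := fun x c => x = iota c) _ g_const.
    by rewrite rmorph0.
  have gE : g = toM h by apply/mpolyP => m; rewrite mcoeff_map_mpoly hP.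
  rewrite fE; apply: mspan1; exists h => //.
  by rewrite /constant_relation -gE.
(* Both [D g] and [D (u^-1 g)] have fewer monomials than [f], and [g] is a
   combination of them because [D u^-1] is not zero. *)
pose u := mcoeff m1 g.
have Du : D u != 0 by apply/eqP => /D_const.
have u0 : u != 0 by apply: contraNneq Du => ->; rewrite raddf0.
have JDug : J (map_mpoly D (u^-1 *: g)).
  apply: (J_norm m1); first exact: rZ.
  - by move=> m /msuppZ_le; apply: g_f.
  - by apply: g_f; rewrite mcoeff_msupp.
  - by rewrite mcoeffZ mulVf.
have DuV : D u^-1 != 0.
  apply: contraNneq Du => DuV; have := DM u^-1 u.
  rewrite mulVf // (leibniz1 DM) DuV mul0r add0r => /esym/eqP.
  by rewrite mulf_eq0 invr_eq0 (negPf u0).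
rewrite fE; apply: mspanZ.
have -> : g = (D u^-1)^-1 *: (map_mpoly D (u^-1 *: g) - u^-1 *: map_mpoly D g).
  by rewrite (map_mpoly_leibnizZ DM) addrK scalerA mulVf // scale1r.
apply/mspanZ/mspanD => //; rewrite -scaleNr; exact: mspanZ.
Qed.

(** Nullstellensatz step: a function that takes the value [z] at all
    specializations of [Phi] is equal to [z] up to a nilpotent modulo the
    relations. *)
Lemma specializable_nilpotent (q : PC) (z : M) :
  (forall s, specializable s -> mxev iota (Phi *m map_mx iota s) q = z) ->
  exists k, relations ((toM q - mpolyC _ z) ^+ k).
Proof.
move=> q_inv; pose h := translate Phi (toM q - mpolyC _ z).
suff [k hk] : exists k, translated_relations (h ^+ k).
  by exists k; apply/relationsE; rewrite rmorphXn.
have subC : is_subfield (fun x => exists c, x = iota c).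
  split; first by exists 1; rewrite rmorph1.
  - by move=> _ _ [x ->] [y ->]; exists (x - y); rewrite rmorphB.
  - by move=> _ _ [x ->] [y ->]; exists (x * y); rewrite rmorphM.
  - by move=> _ [x ->]; exists x^-1; rewrite fmorphV.
have [t [e [_ e_free e_span]]] :=
  exists_basis subC [seq mcoeff m h | m <- msupp h].
(* Write [h] along a family that is free over the constants, with components
   [G i] that have constant coefficients. *)
have [|F [CF hE]] := @mpoly_expand _ _ subC _ t e h.
  move=> m; have [m_h|/memN_msupp_eq0 ->] := boolP (m \in msupp h).
    exact/e_span/map_f.
  by exists (fun=> 0); split=> [i|];
    [exact: sf0 subC | rewrite big1 // => i _; rewrite mul0r].
have /choice[G GP] : forall i, exists g : PC, F i = toM g.
  move=> i; have [|g gP] := mpoly_choice (Q := fun x c => x = iota c) _ (fun m => CF i m).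
    by rewrite rmorph0.
  by exists g; apply/mpolyP => m; rewrite mcoeff_map_mpoly.
have G_nilp i : (i <= t)%N -> exists k, constant_relation (G i ^+ k).
  move=> le_it; apply: contrapT => /forallNP Gi.
  have [c [cJ cG]] := nullstellensatz C_unc constant_relation_ideal Gi.
  pose s : 'M[C]_N := vec_mx (\row_k c k).
  have evC g : mxev idfun (map_mx iota s) (toM g) = iota (meval c g).
    rewrite mxev_map (eq_mxev (g' := iota \o idfun)) //.
    rewrite -(rmorph_mxev iota [the {rmorphism C -> C} of idfun]).
    by congr (iota _); apply: eq_mmap => // k; rewrite vec_mxK mxE.
  have s_spec : specializable s.
    move=> f f_rel; rewrite -mxev_translate.
    have /translated_relations_constant : translated_relations (translate Phi f).
      by rewrite -[translate _ _]scale1r; apply: mspan1; exists f.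
    move: (translate Phi f); apply: mspan_ind => [|a _ g [b Jb ->] g0].
      by rewrite rmorph0.
    by rewrite rmorphD /= mxevZ /= evC cJ // rmorph0 mulr0 add0r.
  have h0 : mxev idfun (map_mx iota s) h = 0.
    rewrite mxev_translate rmorphB /= mxevC mxev_map /=.
    by rewrite (eq_mxev (g' := iota)) // q_inv // subrr.
  have : iota (meval c (G i)) = 0.
    apply: (e_free (fun i => iota (meval c (G i))) _ _ i le_it).
      by move=> j; exists (meval c (G j)).
    rewrite -[RHS]h0 hE rmorph_sum; apply: eq_bigr => j _.
    by rewrite /= mxevZ GP /= evC mulrC.
  by move/eqP; rewrite fmorph_eq0 (negPf cG).
have [_ _ rM] := translated_relations_ideal.
have [i|k Jk] := ideal_radical_sum translated_relations_ideal
    (index_enum 'I_t.+1) (F := fun i : 'I_t.+1 => e i *: F i).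
  have [k Jk] := G_nilp i (ltn_ord i); exists k.
  by rewrite exprZn -mul_mpolyC GP -rmorphXn; apply: rM.
by exists k; rewrite hE.
Qed.

Section rationality.
Variables (q : PC).
Local Notation Q := (toM q).

Lemma Q_comm : commr_rmorph (@mpolyC (N * N) M) Q.
Proof. by move=> c; exact: mulrC. Qed.

Local Notation subst := (horner_morph Q_comm).

Lemma subst_poly k (c : nat -> M) :
  subst (\poly_(j < k) c j) = \sum_(j < k) c j *: Q ^+ j.
Proof.
rewrite poly_def rmorph_sum; apply: eq_bigr => j _.
rewrite -mul_polyC rmorphM rmorphXn /=.
by rewrite horner_morphC horner_morphX mul_mpolyC.
Qed.

(** Linear algebra over [K]: a monic equation for [q] modulo the [M]-span of
    the relations can be replaced by its component along [1]. *)
Lemma monic_relation (g : {poly M}) : g \is monic -> relations (subst g) ->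
  exists g0 : {poly M}, [/\ size g0 = size g, g0 \is monic,
    forall j, K g0`_j & relation (subst g0)].
Proof.
move=> g_monic [s [s_rel gE]].
have [t [e [e0 e_free e_span]]] := exists_basis subK (polyseq g ++ [seq x.1 | x <- s]).
have /choice[c cP] : forall j, @spans_over M K t e g`_j.
  move=> j; have [lt_j|le_j] := ltnP j (size g).
    by apply: e_span; rewrite mem_cat mem_nth.
  rewrite nth_default //; exists (fun=> 0); split=> [i|]; first exact: sf0 subK.
  by rewrite big1 // => i _; rewrite mul0r.
have /choice[c' c'P] : forall x : M * P, exists c' : nat -> M,
    (forall i, K (c' i)) /\ (x \in s -> x.1 = \sum_(i < t.+1) c' i * e i).
  move=> x; have [xs|xs] := boolP (x \in s).
    have [|c' [Kc' c'E]] := e_span x.1; last by exists c'.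
    by rewrite mem_cat map_f ?orbT.
  by exists (fun=> 0); split=> // i; exact: sf0 subK.
have KQ j : coefs_in K (Q ^+ j).
  by apply: (coefs_inE subK) => m; rewrite mcoeff_map_mpoly; apply: K_const.
pose G i := \sum_(j < size g) c j i *: Q ^+ j.
pose H i := \sum_(x <- s) c' x i *: (if x \in s then x.2 else 0).
have KG i : coefs_in K (G i).
  by apply: (coefs_in_sum subK) => // j _; apply: (coefs_inZ subK) => //; case: (cP j).
have KH i : coefs_in K (H i).
  apply: (coefs_in_sum subK) => // x _; apply: (coefs_inZ subK) => //; first by case: (c'P x).
  case: ifP => [/s_rel[]//|_ m]; rewrite mcoeff0; exact: sf0 subK.
(* The components of both sides of the equation along [e 0 = 1]. *)
have GH : G 0%N = H 0%N.
  apply/eqP; rewrite -subr_eq0; apply/eqP.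
  apply: (free_over_mpoly e_free (F := fun i => G i - H i)) => // [i|].
    exact: (coefs_inB subK).
  under eq_bigr do rewrite scalerBr; rewrite sumrB; apply/eqP.
  rewrite subr_eq0; apply/eqP; transitivity (subst g).
    rewrite -[g]coefK subst_poly; under eq_bigr do rewrite scaler_sumr.
    rewrite exchange_big; apply: eq_bigr => j _ /=.
    have [_ ->] := cP j; rewrite scaler_suml; apply: eq_bigr => i _.
    by rewrite scalerA mulrC.
  rewrite gE; under [RHS]eq_bigr do rewrite scaler_sumr.
  rewrite [RHS]exchange_big; apply: eq_big_seq => x xs /=.
  have [_ ->//] := c'P x; rewrite xs scaler_suml; apply: eq_bigr => i _.
  by rewrite scalerA mulrC.
have c1 : c (size g).-1 0%N = 1.
  apply/eqP; rewrite -subr_eq0; apply/eqP.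
  have [Kc cE] := cP (size g).-1.
  apply: (e_free (fun i => c (size g).-1 i - (i == 0)%:R) _ _ 0%N (leq0n _)).
    move=> i; apply: (sfB subK) => //.
    by case: eqP => _; [exact: sf1 subK | exact: sf0 subK].
  under eq_bigr do rewrite mulrBl; rewrite sumrB -cE -/(lead_coef g).
  rewrite (eqP g_monic) big_ord_recl /= e0 mulr1 big1 ?addr0 ?subrr //.
  by move=> i _; rewrite mul0r.
have g_gt0 : (0 < size g)%N by rewrite size_poly_gt0 monic_neq0.
have size_g0 : size (\poly_(j < size g) c j 0%N) = size g.
  by apply: size_poly_eq; rewrite c1 oner_eq0.
exists (\poly_(j < size g) c j 0%N); split=> //.
- by rewrite monicE lead_coefE size_g0 coef_poly prednK // leqnn c1.
- by move=> j; rewrite coef_poly; case: ifP => _;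
    [case: (cP j) | exact: sf0 subK].
- rewrite subst_poly -/(G 0%N) GH; split; first exact: KH.
  rewrite rmorph_sum big1_seq // => x /andP[_ xs].
  by rewrite /= mxevZ xs; case: (s_rel x xs) => _ ->; rewrite mulr0.
Qed.

(** The monic polynomial of least degree that kills [q] modulo the relations
    has coefficients in [K], since replacing it by its component along [1]
    cannot change it. It divides a power of ['X - z], so it is one. *)
Lemma nilpotent_rational (z : M) k :
  mxev iota Phi q = z -> relations ((Q - mpolyC _ z) ^+ k) -> K z.
Proof.
move=> qz qzk; have [r0 rD rM] := relations_ideal.
pose I (g : {poly M}) := relations (subst g).
have IZ c g : I g -> I (c *: g).
  by rewrite /I -mul_polyC rmorphM; apply: rM.
have IB g h : I g -> I h -> I (g - h).
  by rewrite /I rmorphB; apply: (ideal_sub relations_ideal).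
pose h : {poly M} := ('X - z%:P) ^+ k.
have Ih : I h by rewrite /I rmorphXn rmorphB /= horner_morphX horner_morphC.
have h_monic : h \is monic by rewrite monic_exp // monicXsubC.
have [n n_ex n_min] : exists2 n, (exists g, [/\ g \is monic, I g & size g = n]) &
    forall g, I g -> g != 0 -> (n <= size g)%N.
  have ex_n : exists n, `[< exists g, [/\ g \is monic, I g & size g = n] >].
    by exists (size h); apply/asboolP; exists h.
  case: (ex_minnP ex_n) => n /asboolP n_ex n_min; exists n => // g Ig g0.
  apply: n_min; apply/asboolP; exists ((lead_coef g)^-1 *: g); split.
  - by rewrite monicE lead_coefZ mulVf // lead_coef_eq0.
  - exact: IZ.
  - by rewrite size_scale // invr_eq0 lead_coef_eq0.
have [g [g_monic Ig size_g]] := n_ex.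
have [g0 [size_g0 g0_monic Kg0 g0_rel]] := monic_relation g_monic Ig.
have Ig0 : I g0 by rewrite /I -[subst _]scale1r; apply: mspan1.
have g0E : g0 = g.
  apply/eqP; rewrite -subr_eq0; apply/negP => /negP d0.
  have := n_min _ (IB _ _ Ig0 Ig) d0; rewrite leqNgt => /negP; apply.
  have n_gt0 : (0 < n)%N by rewrite -size_g size_poly_gt0 monic_neq0.
  rewrite -(prednK n_gt0) ltnS; apply/leq_sizeP => j le_j; rewrite coefB.
  have [->|lt_j] := eqVneq j n.-1.
    rewrite -{1}size_g -{1}size_g0 -size_g -!lead_coefE.
    by rewrite (eqP g_monic) (eqP g0_monic) subrr.
  have le_nj : (n <= j)%N by rewrite -(prednK n_gt0) ltn_neqAle eq_sym lt_j.
  by rewrite !nth_default ?subrr // ?size_g // size_g0 size_g.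
have g_dvd : (g %| h)%R.
  apply/modp_eq0P; apply: contrapT => /eqP hg0.
  have Ihg : I (h %% g).
    have -> : h %% g = h - h %/ g * g by rewrite {2}(divp_eq h g) addrC addKr.
    by apply: IB => //; rewrite /I rmorphM; apply: rM.
  have := n_min _ Ihg hg0; rewrite leqNgt -size_g ltn_modp.
  by rewrite monic_neq0.
have /dvdp_exp_XsubCP[d [_ gd]] := g_dvd.
have {gd} gE : g = ('X - z%:P) ^+ d.
  by apply/eqP; rewrite -eqp_monic // monic_exp // monicXsubC.
have gz : g.[z] = 0.
  have [_ g0z] := g0_rel; rewrite -g0E -[RHS]g0z -[g0]coefK subst_poly.
  rewrite rmorph_sum horner_poly; apply: eq_bigr => j _.
  rewrite /= mxevZ rmorphXn /= mxev_map; congr (_ * _ ^+ _).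
  by rewrite -qz; apply: eq_mxev.
case: d gE => [gE|d gE]; first by move/eqP: gz; rewrite gE expr0 hornerC oner_eq0.
(* The subleading coefficient of [('X - z) ^ d.+1] determines [z], since the
   characteristic is zero. *)
have gdE : g`_d = - (d.+1%:R * z).
  have gprod : g = \prod_(a <- nseq d.+1 z) ('X - a%:P).
    by rewrite big_nseq -Monoid.iteropE gE.
  have := @coefPn_prod_XsubC M (nseq d.+1 z); rewrite size_nseq -gprod => -> //.
  by rewrite big_nseq iter_addr addr0 mulr_natl.
have -> : z = - g`_d * (d.+1%:R)^-1 by rewrite gdE opprK mulrAC divff ?mul1r.
apply: (sfM subK); first by apply: (sfN subK); rewrite -g0E.
by apply: (sfV subK); rewrite -(rmorph_nat iota).
Qed.

End rationality.

(** The Galois correspondence: an element of the solution field that is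
    invariant under all specializations of the fundamental matrix is rational. *)
Theorem invariant_rational (q : PC) :
  (forall s, specializable s ->
     mxev iota (Phi *m map_mx iota s) q = mxev iota Phi q) ->
  K (mxev iota Phi q).
Proof.
by move=> /specializable_nilpotent[k]; apply: nilpotent_rational.
Qed.

End differential_field.

(** * Derivations of fraction fields *)

Lemma quotient_rule_sub (L : fieldType) (a b a' b' da db da' db' : L) :
  b != 0 -> b' != 0 ->
  (((da * b' + a * db') - (da' * b + a' * db)) * (b * b')
    - (a * b' - a' * b) * (db * b' + b * db')) / (b * b') ^+ 2
  = (da * b - a * db) / b ^+ 2 - (da' * b' - a' * db') / b' ^+ 2.
Proof. by move=> b0 b'0; field; apply/andP. Qed.

Lemma quotient_rule_mul (L : fieldType) (a b a' b' da db da' db' : L) :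
  b != 0 -> b' != 0 ->
  ((da * a' + a * da') * (b * b') - a * a' * (db * b' + b * db')) / (b * b') ^+ 2
  = (da * b - a * db) / b ^+ 2 * (a' / b')
    + a / b * ((da' * b' - a' * db') / b' ^+ 2).
Proof. by move=> b0 b'0; field; apply/andP. Qed.

Section fraction_derivation.
Context {S : idomainType}.
Local Notation F := (@FracField.tofrac S).
Local Open Scope quotient_scope.

Lemma fracE (x : {fraction S}) : exists a b, b != 0 /\ x = F a / F b.
Proof.
elim/quotW: x => r; exists (frac r).1, (frac r).2; split; first exact: denom_ratioP.
have b0 : F (frac r).2 != 0 by rewrite tofrac_eq0 denom_ratioP.
apply: (mulIf b0); rewrite divfK // /GRing.mul /= !piE.
apply/eqP; rewrite FracField.equivf_def /FracField.mulf.
rewrite !numer_Ratio ?denom_Ratio ?oner_neq0 ?mulf_neq0 ?denom_ratioP ?oner_neq0 //.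
by rewrite !mulr1 mulrC.
Qed.

Context {d : {additive S -> S}} (dM : leibniz d).

Lemma frac_eq (a b a' b' : S) : b != 0 -> b' != 0 ->
  F a / F b = F a' / F b' <-> a * b' = a' * b.
Proof.
move=> b0 b'0; have [fb fb'] : F b != 0 /\ F b' != 0 by rewrite !tofrac_eq0.
split=> [/eqP|E]; last by apply/eqP; rewrite eqr_div // -!tofracM E.
by rewrite eqr_div // -!tofracM tofrac_eq => /eqP.
Qed.

(** The quotient rule, for an arbitrary choice of numerator and denominator on
    which the result does not depend by [frac_derivE]. *)
Definition frac_deriv of leibniz d := fun x : {fraction S} =>
  let a := sval (cid (fracE x)) in let b := sval (cid (svalP (cid (fracE x)))) in
  F (d a * b - a * d b) / F (b ^+ 2).

Lemma frac_derivE a b : b != 0 ->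
  frac_deriv dM (F a / F b) = F (d a * b - a * d b) / F (b ^+ 2).
Proof.
rewrite /frac_deriv => b0; case: cid => /= a' ?; case: cid => /= b' [b'0].
move=> /frac_eq-/(_ b0 b'0) E; apply/frac_eq; rewrite ?expf_neq0 //.
have dE : d a * b' + a * d b' = d a' * b + a' * d b by rewrite -!dM E.
have -> : (d a' * b' - a' * d b') * b ^+ 2 =
  b' * b * (d a' * b) - (a' * b) * b * d b' by ring.
have -> : d a' * b = d a * b' + a * d b' - a' * d b by rewrite dE addrK.
rewrite -E; have -> : b' * b * (d a * b' + a * d b' - a' * d b) - a * b' * b * d b' =
  b' * b * (d a * b') - b' * (a' * b) * d b by ring.
by rewrite -E; ring.
Qed.

Lemma frac_derivF a : frac_deriv dM (F a) = F (d a).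
Proof.
rewrite -[F a]divr1 -tofrac1 frac_derivE ?oner_neq0 //.
by rewrite (leibniz1 dM) mulr0 subr0 mulr1 expr1n divr1.
Qed.

Lemma frac_deriv_is_additive : zmod_morphism (frac_deriv dM).
Proof.
move=> x y; have [a [b [b0 ->]]] := fracE x; have [a' [b' [b'0 ->]]] := fracE y.
have [fb fb'] : F b != 0 /\ F b' != 0 by rewrite !tofrac_eq0.
rewrite -mulNr addf_div // -tofracN -!tofracM -tofracD mulNr.
rewrite !frac_derivE ?mulf_neq0 // (raddfB d) /= !dM.
rewrite !(tofracB, tofracN, tofracD, tofracM, tofracXn).
exact: quotient_rule_sub.
Qed.

HB.instance Definition _ := GRing.isZmodMorphism.Build _ _ (frac_deriv dM)
  frac_deriv_is_additive.

Lemma frac_deriv_leibniz : leibniz (frac_deriv dM).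
Proof.
move=> x y; have [a [b [b0 ->]]] := fracE x; have [a' [b' [b'0 ->]]] := fracE y.
have [fb fb'] : F b != 0 /\ F b' != 0 by rewrite !tofrac_eq0.
rewrite mulf_div -!tofracM !frac_derivE ?mulf_neq0 // !dM.
rewrite !(tofracB, tofracD, tofracM, tofracXn).
exact: quotient_rule_mul.
Qed.

End fraction_derivation.

(** * Formal power series *)

(** A record rather than the type of sequences, whose ring structure is the
    pointwise one. *)
Record ps (C : Type) := Ps { psc : nat -> C }.

Lemma psP C (a b : ps C) : (forall k, psc a k = psc b k) -> a = b.
Proof. by case: a b => [a] [b] /= /funext ->. Qed.

HB.instance Definition _ C := gen_eqMixin (ps C).
HB.instance Definition _ C := gen_choiceMixin (ps C).

Section power_series.
Context {C : fieldType}.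
Local Notation ps := (ps C).
Implicit Types a b : ps.

Definition psadd a b : ps := Ps (fun k => psc a k + psc b k).
Definition psopp a : ps := Ps (fun k => - psc a k).
Definition psmul a b : ps := Ps (fun k => \sum_(i < k.+1) psc a i * psc b (k - i)).
Definition psC (c : C) : ps := Ps (fun k => if k == 0%N then c else 0).
Definition trunc k a : {poly C} := \poly_(i < k) psc a i.

Lemma psaddA : associative psadd.
Proof. by move=> a b c; apply: psP => k /=; rewrite addrA. Qed.
Lemma psaddC : commutative psadd.
Proof. by move=> a b; apply: psP => k /=; rewrite addrC. Qed.
Lemma psadd0 : left_id (psC 0) psadd.
Proof. by move=> a; apply: psP => k /=; rewrite if_same add0r. Qed.
Lemma psaddN : left_inverse (psC 0) psopp psadd.
Proof. by move=> a; apply: psP => k /=; rewrite if_same addNr. Qed.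

HB.instance Definition _ := GRing.isZmodule.Build ps psaddA psaddC psadd0 psaddN.

Lemma psc_trunc k i a : (i < k)%N -> psc a i = (trunc k a)`_i.
Proof. by move=> ik; rewrite coef_poly ik. Qed.

(** The ring laws are inherited from those of polynomials, with which the
    product agrees up to any given order. *)
Lemma psc_mul k i a b : (i < k)%N ->
  psc (psmul a b) i = (trunc k a * trunc k b)`_i.
Proof.
move=> ik; rewrite coefM; apply: eq_bigr => j _; rewrite !coef_poly.
by rewrite !(leq_ltn_trans _ ik) ?leq_subr // -ltnS ltn_ord.
Qed.

Lemma coef_trunc_mul k i a b (p : {poly C}) : (i < k)%N ->
  (trunc k (psmul a b) * p)`_i = (trunc k a * trunc k b * p)`_i.
Proof.
move=> ik; rewrite !coefM; apply: eq_bigr => j _; congr (_ * _).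
have jk : (j < k)%N by apply: leq_ltn_trans ik; rewrite -ltnS.
by rewrite -psc_trunc // (psc_mul _ _ jk).
Qed.

Lemma psmulC : commutative psmul.
Proof. by move=> a b; apply: psP => k; rewrite !(psc_mul _ _ (ltnSn k)) mulrC. Qed.
Lemma psmulA : associative psmul.
Proof.
move=> a b c; apply: psP => k; rewrite [in LHS]psmulC !(psc_mul _ _ (ltnSn k)).
by rewrite !coef_trunc_mul // mulrC mulrA.
Qed.
Lemma psmul1 : left_id (psC 1) psmul.
Proof.
move=> a; apply: psP => k /=; rewrite big_ord_recl /= mul1r subn0 big1 ?addr0 //.
by move=> i _; rewrite mul0r.
Qed.
Lemma psmulDl : left_distributive psmul psadd.
Proof.
move=> a b c; apply: psP => k /=; rewrite -big_split /=.
by apply: eq_bigr => i _; rewrite mulrDl.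
Qed.
Lemma ps1_neq0 : psC 1 != 0.
Proof. by apply/eqP => /(congr1 (fun a => psc a 0))/=/eqP; rewrite oner_eq0. Qed.

HB.instance Definition _ := GRing.Zmodule_isComNzRing.Build ps
  psmulA psmulC psmul1 psmulDl ps1_neq0.

Lemma psc0 k : psc (0 : ps) k = 0. Proof. by rewrite /= if_same. Qed.
Lemma psc1 k : psc (1 : ps) k = (k == 0%N)%:R. Proof. by case: k. Qed.
Lemma pscD a b k : psc (a + b) k = psc a k + psc b k. Proof. by []. Qed.
Lemma pscN a k : psc (- a) k = - psc a k. Proof. by []. Qed.
Lemma pscM a b k : psc (a * b) k = \sum_(i < k.+1) psc a i * psc b (k - i).
Proof. by []. Qed.
Lemma psc_sum I (r : seq I) (P : pred I) (F : I -> ps) k :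
  psc (\sum_(i <- r | P i) F i) k = \sum_(i <- r | P i) psc (F i) k.
Proof. by apply: (big_morph (fun a => psc a k)) => //; exact: psc0. Qed.

Definition ps_unit : pred ps := fun a => `[< exists b, b * a = 1 >].
Definition ps_inv a : ps :=
  if pselect (exists b, b * a = 1) is left P then sval (cid P) else a.

Lemma ps_mulV : {in ps_unit, left_inverse 1 ps_inv *%R}.
Proof.
move=> a /asboolP a_unit; rewrite /ps_inv; case: pselect => // P.
exact: (svalP (cid P)).
Qed.
Lemma ps_unitP a b : b * a = 1 -> ps_unit a.
Proof. by move=> ba; apply/asboolP; exists b. Qed.
Lemma ps_inv_out : {in [predC ps_unit], ps_inv =1 id}.
Proof.
move=> a /negP a_unit; rewrite /ps_inv; case: pselect => // P.
by case: a_unit; apply/asboolP.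
Qed.

HB.instance Definition _ := GRing.ComNzRing_hasMulInverse.Build ps
  ps_mulV ps_unitP ps_inv_out.

Lemma ps_order a : a != 0 ->
  exists m, psc a m != 0 /\ forall i, (i < m)%N -> psc a i = 0.
Proof.
move=> a0; have ex_m : exists m, psc a m != 0.
  apply: contrapT => /forallNP am; case/eqP: a0; apply: psP => k.
  by rewrite psc0; apply/eqP/negP => /negP/am.
case: (ex_minnP ex_m) => m am m_min; exists m; split=> // i lt_im.
by apply/eqP; apply: contraLR lt_im => /m_min; rewrite -leqNgt.
Qed.

Lemma pscM_order a b m l : (forall i, (i < m)%N -> psc a i = 0) ->
  (forall i, (i < l)%N -> psc b i = 0) ->
  psc (a * b) (m + l) = psc a m * psc b l.
Proof.
move=> am bl; have lt_m : (m < (m + l).+1)%N by rewrite ltnS leq_addr.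
rewrite pscM (bigD1 (Ordinal lt_m)) //= addKn big1 ?addr0 // => i im.
have [lt_im | le_mi] := ltnP i m; first by rewrite am ?mul0r.
rewrite [psc b _]bl ?mulr0 //; have := ltn_ord i.
by move: im; rewrite -val_eqE /=; lia.
Qed.

Lemma ps_integral a b : a * b = 0 -> (a == 0) || (b == 0).
Proof.
move=> ab; apply: contraT; rewrite negb_or.
move=> /andP[/ps_order[m [am m_min]] /ps_order[l [bl l_min]]].
have : psc (a * b) (m + l) = psc (0 : ps) (m + l) by rewrite ab.
by rewrite pscM_order // psc0 => /eqP; rewrite mulf_eq0 (negPf am) (negPf bl).
Qed.

HB.instance Definition _ := GRing.ComUnitRing_isIntegral.Build ps ps_integral.

Lemma psC_is_zmod_morphism : zmod_morphism psC.
Proof. by move=> x y; apply: psP => -[|k] //=; rewrite subrr. Qed.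
Lemma psC_is_monoid_morphism : monoid_morphism psC.
Proof.
split=> // x y; apply: psP => -[|k]; rewrite pscM.
  by rewrite big_ord_recl big_ord0 /= addr0.
by rewrite big1 // => -[[|i] ?] _; rewrite /= ?subn0 ?mulr0 ?mul0r.
Qed.
HB.instance Definition _ := GRing.isZmodMorphism.Build C ps psC psC_is_zmod_morphism.
HB.instance Definition _ := GRing.isMonoidMorphism.Build C ps psC psC_is_monoid_morphism.

Lemma pscCM c a k : psc (psC c * a) k = c * psc a k.
Proof.
rewrite pscM big_ord_recl /= subn0 big1 ?addr0 // => i _; exact: mul0r.
Qed.

(** The value at the origin. *)
Definition ps0 a : C := psc a 0.

Lemma ps0_is_zmod_morphism : zmod_morphism ps0.
Proof. by []. Qed.
Lemma ps0_is_monoid_morphism : monoid_morphism ps0.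
Proof. by split=> // a b; rewrite /ps0 pscM big_ord_recl big_ord0 addr0. Qed.
HB.instance Definition _ := GRing.isZmodMorphism.Build ps C ps0 ps0_is_zmod_morphism.
HB.instance Definition _ := GRing.isMonoidMorphism.Build ps C ps0 ps0_is_monoid_morphism.

Definition psX : ps := Ps (fun k => (k == 1)%:R).

Lemma psc_mulXn k a i : psc (psX ^+ k * a) i = if (i < k)%N then 0 else psc a (i - k).
Proof.
elim: k i => [|k IHk] i; first by rewrite expr0 mul1r subn0.
have XE b j : psc (psX * b) j = if j is j'.+1 then psc b j' else 0.
  case: j => [|j]; first by rewrite pscM big_ord_recl big_ord0 /= mul0r addr0.
  rewrite pscM !big_ord_recl /= mul0r add0r mul1r subn1 big1 ?addr0 // => l _.
  by rewrite mul0r.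
by rewrite exprS -mulrA XE; case: i => //= i; rewrite IHk ltnS subSS.
Qed.

Lemma psX_neq0 : psX != 0.
Proof.
by apply/eqP => /(congr1 (fun a => psc a 1)) /=/eqP; rewrite oner_eq0.
Qed.

Definition psderiv a : ps := Ps (fun k => psc a k.+1 *+ k.+1).

Lemma psderiv_is_zmod_morphism : zmod_morphism psderiv.
Proof. by move=> a b; apply: psP => k /=; rewrite mulrnDl mulNrn. Qed.
HB.instance Definition _ := GRing.isZmodMorphism.Build ps ps psderiv
  psderiv_is_zmod_morphism.

Lemma psderiv_leibniz : leibniz psderiv.
Proof.
move=> a b; apply: psP => k.
change (psc (psmul a b) k.+1 *+ k.+1 =
  \sum_(i < k.+1) psc (psderiv a) i * psc b (k - i) +
  \sum_(i < k.+1) psc a i * psc (psderiv b) (k - i)).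
rewrite (psc_mul _ _ (ltnSn k.+1)) -coef_deriv derivM coefD !coefM.
congr (_ + _); apply: eq_bigr => i _ /=; have := ltn_ord i;
  by rewrite coef_deriv !coef_poly => ?; do 2?[case: ifP => [_|]; last lia].
Qed.

Hypothesis C_char0 : forall k, k.+1%:R != 0 :> C.

Lemma psderiv_eq0 a : psderiv a = 0 -> a = psC (psc a 0).
Proof.
move=> a'; apply: psP => -[//|k] /=.
have := congr1 (fun x => psc x k) a'; rewrite /= if_same => /eqP.
by rewrite -mulr_natr mulf_eq0 (negPf (C_char0 k)) orbF => /eqP.
Qed.

Lemma psc_euler a k : psc (psX * psderiv a) k = psc a k *+ k.
Proof. by rewrite -[psX]expr1 psc_mulXn; case: k => [|k]; rewrite /= ?subn1. Qed.

Lemma char0_natr_inj p l : p%:R = l%:R :> C -> p = l.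
Proof.
wlog le_pl : p l / (p <= l)%N => [IH pl|/eqP].
  by have [/IH-> //|/ltnW/IH->] := leqP p l.
rewrite eq_sym -subr_eq0 -natrB //; case E: (l - p)%N => [|k] pl.
  by apply/eqP; rewrite eqn_leq le_pl -subn_eq0 E.
by move: pl; rewrite (negPf (C_char0 k)).
Qed.

(** Let [b] have order [l], and let [e = a - c b] have coefficient zero there.
    The Wronskian of [e] and [b] is zero as well, and comparing leading
    coefficients shows that [e] would have order [l] if it were not zero. *)
Lemma ps_wronskian a b : b != 0 -> psderiv a * b = a * psderiv b ->
  exists c, a = psC c * b.
Proof.
move=> b0 ab; have [l [bl l_min]] := ps_order b0.
exists (psc a l / psc b l); apply/eqP; rewrite -subr_eq0; apply: contraT.
set c := _ / _; set e := a - _ => /ps_order[p [ep p_min]].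
have dc : psderiv (psC c) = 0 by apply: psP => k; rewrite psc0 /= mul0rn.
have eb : psX * psderiv e * b = e * (psX * psderiv b).
  rewrite /e raddfB /= psderiv_leibniz dc mul0r add0r.
  have -> : psX * (psderiv a - psC c * psderiv b) * b =
    psX * (psderiv a * b) - psX * psC c * psderiv b * b by ring.
  by rewrite ab; ring.
have := congr1 (fun x => psc x (p + l)) eb.
rewrite !pscM_order // => [|i /l_min il|i /p_min ip]; last 2 first.
- by rewrite psc_euler il mul0rn.
- by rewrite psc_euler ip mul0rn.
rewrite !psc_euler mulrnAl mulrnAr -mulr_natr -[RHS]mulr_natr.
move/(mulfI (mulf_neq0 ep bl))/char0_natr_inj => pl.
by move: ep; rewrite pl /e pscD pscN pscCM /c divfK // subrr eqxx.
Qed.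

Section linear_system.
Context {n : nat} (B : 'M[ps]_n).
Let Bc k : 'M[C]_n := map_mx (fun a => psc a k) B.

(** [sol_table k] gives the coefficients of the solution up to [z ^ k]. *)
Fixpoint sol_table k : nat -> 'M[C]_n :=
  if k is k'.+1 then fun i =>
    if (i <= k')%N then sol_table k' i
    else k'.+1%:R^-1 *: \sum_(j < k'.+1) Bc j *m sol_table k' (k' - j)
  else fun=> 1%:M.

Lemma sol_tableE k i : (i <= k)%N -> sol_table k i = sol_table i i.
Proof.
elim: k => [|k IHk]; first by rewrite leqn0 => /eqP ->.
by rewrite leq_eqVlt => /orP[/eqP -> //|]; rewrite ltnS /= => ik; rewrite ik IHk.
Qed.

Lemma linear_system_solution :
  exists2 Phi : 'M[ps]_n, map_mx psderiv Phi = B *m Phi & map_mx ps0 Phi = 1%:M.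
Proof.
exists (\matrix_(i, j) Ps (fun k => sol_table k k i j)); last first.
  by apply/matrixP => i j; rewrite !mxE /ps0 /= mxE.
apply/matrixP => i j; rewrite !mxE; apply: psP => k; rewrite psc_sum /=.
rewrite ltnn !mxE -[LHS]mulr_natl mulrA divff // mul1r summxE.
under [RHS]eq_bigr do rewrite mxE; rewrite exchange_big /=.
apply: eq_bigr => l _; rewrite sol_tableE ?leq_subr // !mxE.
by apply: eq_bigr => m _; rewrite !mxE.
Qed.

End linear_system.

(** The inverse comes from the adjoint system: the product of the two solutions
    has derivative zero. *)
Lemma fundamental_matrix n (B : 'M[ps]_n) : exists Phi Psi : 'M[ps]_n,
  [/\ map_mx psderiv Phi = B *m Phi, map_mx ps0 Phi = 1%:M & Phi *m Psi = 1%:M].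
Proof.
have [Phi Phi' Phi0] := linear_system_solution B.
have [Psi Psi' Psi0] := linear_system_solution (- B^T).
exists Phi, Psi^T; split=> //; apply: mulmx1C.
have dPsi : map_mx psderiv Psi^T = - (Psi^T *m B).
  by rewrite -map_trmx Psi' trmx_mul linearN /= trmxK mulmxN.
have : map_mx psderiv (Psi^T *m Phi) = 0.
  by rewrite (map_mx_leibniz psderiv_leibniz) dPsi Phi' mulNmx mulmxA addNr.
move=> d0; apply/matrixP => i j.
have := congr1 (fun X : 'M[ps]_n => X i j) d0; rewrite !mxE => /psderiv_eq0.
have -> : psc (\sum_k Psi^T i k * Phi k j) 0 = (map_mx ps0 (Psi^T *m Phi)) i j.
  by rewrite !mxE.
rewrite map_mxM -map_trmx Psi0 Phi0 trmx1 mulmx1 => ->; rewrite mxE.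
by apply: psP => -[|k]; case: (i == j); rewrite /= ?psc0 ?psc1.
Qed.

End power_series.

(** * Multiplicative matrices of polynomials *)

(** The Nullstellensatz for the zero ideal. *)
Lemma mpoly_eq0_eval {C : closedFieldType} (C_unc : uncountable_like C) n
  (f : {mpoly C[n]}) : (forall c, meval c f = 0) -> f = 0.
Proof.
move=> f0; apply: contrapT => /eqP f_neq0.
have [||c [_]] := nullstellensatz C_unc (J := eq^~ 0) (h := f).
- by split=> [//|x y -> ->|a x ->]; rewrite ?addr0 ?mulr0.
- by move=> k; apply/eqP; rewrite expf_neq0.
by rewrite f0 eqxx.
Qed.

Lemma mxev_deriv_const {C T : comNzRingType} (g : {rmorphism C -> T})
    (d : {additive T -> T}) n (s : 'M[T]_n) p :
  leibniz d -> (forall c, d (g c) = 0) ->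
  d (mxev g s p) = \sum_k mxev g s (mderiv k p) * mxvec (map_mx d s) 0 k.
Proof.
move=> dM dg; pose z : {additive C -> C} := \0.
have zM : leibniz z by move=> x y; rewrite /= mul0r mulr0 addr0.
rewrite /mxev (chain_rule (D := z) zM dM) => [|c]; last by rewrite dg rmorph0.
have -> : map_mpoly z p = 0 by apply/mpolyP => k; rewrite mcoeff_map_mpoly mcoeff0.
by rewrite raddf0 add0r; apply: eq_bigr => k _; rewrite -map_mxvec mxE.
Qed.

(** Any two matrices over any algebra are specializations of two matrices of
    indeterminates, for which polynomial identities can be tested at points. *)
Lemma universal_pair (C : comNzRingType) n :
  exists l (s0 t0 : 'M[{mpoly C[l]}]_n),
  forall (U : comNzRingType) (h : {rmorphism C -> U}) (x y : 'M[U]_n),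
  exists f : {rmorphism {mpoly C[l]} -> U},
  [/\ forall c, f (mpolyC l c) = h c, map_mx f s0 = x & map_mx f t0 = y].
Proof.
exists (n * n + n * n)%N.
exists (vec_mx (\row_k mpolyX C (mnm1 (lshift _ k)))).
exists (vec_mx (\row_k mpolyX C (mnm1 (rshift _ k)))) => U h x y.
exists (mmap h (fun k => match fintype.split k with
  inl k => mxvec x 0 k | inr k => mxvec y 0 k end)); split=> [c||].
- exact: mmapC.
- apply/matrixP => i j; rewrite !mxE /= mmapX mmap1U.
  by rewrite (unsplitK (inl _)) mxvecE.
- apply/matrixP => i j; rewrite !mxE /= mmapX mmap1U.
  by rewrite (unsplitK (inr _)) mxvecE.
Qed.

Fact pmx_key : unit. Proof. by []. Qed.
Fact dpmx_key : unit. Proof. by []. Qed.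

Section polynomial_matrices.
Context {C : closedFieldType} {n m : nat}.
Variable P : 'I_m -> 'I_m -> {mpoly C[n * n]}.

Definition pmx {T : comNzRingType} (g : C -> T) (s : 'M[T]_n) : 'M[T]_m :=
  \matrix[pmx_key]_(i, j) mxev g s (P i j).

(** The differential of [pmx] at the identity matrix. *)
Definition dpmx {T : comNzRingType} (g : C -> T) (B : 'M[T]_n) : 'M[T]_m :=
  \matrix[dpmx_key]_(i, j) \sum_k mxev g 1%:M (mderiv k (P i j)) * mxvec B 0 k.

Lemma map_pmx {T U : comNzRingType} (r : {rmorphism T -> U})
    (g : {rmorphism C -> T}) s : map_mx r (pmx g s) = pmx (r \o g) (map_mx r s).
Proof. by apply/matrixP => i j; rewrite !mxE rmorph_mxev. Qed.

Lemma eq_pmx {T : comNzRingType} (g g' : C -> T) s : g =1 g' -> pmx g s = pmx g' s.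
Proof. by move=> gg'; apply/matrixP => i j; rewrite !mxE; apply: eq_mxev. Qed.

Definition multiplicative_on_units : Prop :=
  pmx idfun 1%:M = 1%:M /\ forall s t, s \in unitmx -> t \in unitmx ->
    pmx idfun (s *m t) = pmx idfun s *m pmx idfun t.

Hypotheses (C_unc : uncountable_like C) (P_mult : multiplicative_on_units).

Lemma pmx1 {T : comNzRingType} (g : {rmorphism C -> T}) : pmx g 1%:M = 1%:M.
Proof.
have [P1 _] := P_mult; rewrite -(map_mx1 g) -(map_mx1 g) -P1.
have -> : map_mx g (pmx idfun 1%:M) = pmx (g \o idfun) (map_mx g 1%:M) by rewrite -map_pmx.
exact: eq_pmx.
Qed.

(** A polynomial identity that holds for invertible complex matrices holds
    for matrices over every commutative algebra. *)
Lemma pmxM {T : comNzRingType} (g : {rmorphism C -> T}) s t :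
  pmx g (s *m t) = pmx g s *m pmx g t.
Proof.
have [l [s0 [t0 spec]]] := universal_pair C n.
have specE (U : comNzRingType) (h : {rmorphism C -> U})
    (f : {rmorphism {mpoly C[l]} -> U}) i j : (forall c, f (mpolyC l c) = h c) ->
    f (pmx (@mpolyC l C) (s0 *m t0) i j -
       (pmx (@mpolyC l C) s0 *m pmx (@mpolyC l C) t0) i j) =
    pmx h (map_mx f s0 *m map_mx f t0) i j -
      (pmx h (map_mx f s0) *m pmx h (map_mx f t0)) i j.
  move=> fC; have f_pmx z x y : f (pmx (@mpolyC l C) z x y) = pmx h (map_mx f z) x y.
    have := map_pmx f [the {rmorphism C -> {mpoly C[l]}} of @mpolyC l C] z.
    move/matrixP/(_ x y); rewrite [LHS]mxE => ->.
    by move: x y; apply/matrixP; apply: eq_pmx.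
  rewrite rmorphB /= f_pmx map_mxM; congr (_ - _).
  rewrite [in LHS]mxE [RHS]mxE rmorph_sum; apply: eq_bigr => k _.
  by rewrite rmorphM /= !f_pmx.
have det_neq0 x : x = s0 \/ x = t0 -> \det x != 0.
  have [f [fC fs ft]] := spec C [the {rmorphism C -> C} of idfun] 1%:M 1%:M.
  move=> x_st; apply/eqP => /(congr1 f)/eqP.
  by case: x_st => ->; rewrite -det_map_mx ?fs ?ft rmorph0 det1 oner_eq0.
have [f [fC fs ft]] := spec T g s t.
apply/matrixP => i j; apply/eqP; rewrite -subr_eq0.
rewrite -{1}fs -{1}ft -{1}fs -{1}ft -specE //.
suff -> : pmx (@mpolyC l C) (s0 *m t0) i j -
    (pmx (@mpolyC l C) s0 *m pmx (@mpolyC l C) t0) i j = 0 by rewrite rmorph0.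
set e := _ - _; suff /eqP : \det s0 * \det t0 * e = 0.
  rewrite !mulf_eq0 (negPf (det_neq0 s0 _)) ?(negPf (det_neq0 t0 _)) ?orbF;
  by [move/eqP | right | left].
apply: (mpoly_eq0_eval C_unc) => c; rewrite !rmorphM /= -!det_map_mx.
set x := map_mx _ s0; set y := map_mx _ t0.
have [/andP[ux uy]|] := boolP ((x \in unitmx) && (y \in unitmx)).
  rewrite /e (specE _ [the {rmorphism C -> C} of idfun]) => [|a]; last exact: mevalC.
  have [_ P_mul] := P_mult; rewrite -/x -/y /=.
  by rewrite P_mul // subrr mulr0.
rewrite negb_and !unitmxE !unitfE !negbK => /orP[] /eqP ->.
  by rewrite !mul0r.
by rewrite mulr0 mul0r.
Qed.

(** Differentiate [pmx ((1 + X B) s) = pmx (1 + X B) * pmx s] at [X = 0]. *)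
Lemma pmx_deriv {T : comNzRingType} (g : {rmorphism C -> T})
    (d : {additive T -> T}) (B s : 'M[T]_n) :
  leibniz d -> (forall c, d (g c) = 0) -> map_mx d s = B *m s ->
  map_mx d (pmx g s) = dpmx g B *m pmx g s.
Proof.
move=> dM dg ds; pose g' : {rmorphism C -> {poly T}} := @polyC T \o g.
pose d' : {additive {poly T} -> {poly T}} := @deriv T.
have d'E p : d' p = p^`() by [].
have d'M : leibniz d' by move=> p q; exact: derivM.
have d'g c : d' (g' c) = 0 by exact: derivC.
pose ev0 : {rmorphism {poly T} -> T} := horner_eval (0 : T).
have ev0E p : ev0 p = p.[0] by [].
have ev0P (a : T) : ev0 a%:P = a by exact: hornerC.
have ev0C U (x : 'M[T]_(U, U)) : map_mx ev0 (map_mx (@polyC T) x) = x.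
  by apply/matrixP => i j; rewrite !mxE /= ?ev0E hornerC.
pose b : 'M[{poly T}]_n := 1%:M + 'X *: map_mx (@polyC T) B.
have b0 : map_mx ev0 b = 1%:M.
  rewrite /b map_mxD map_mxZ map_mx1 /= ?ev0E hornerX scale0r addr0 //.
have b' : map_mx d' b = map_mx (@polyC T) B.
  apply/matrixP => i j; rewrite !mxE d'E derivD derivM derivX derivC mulr0 addr0.
  by rewrite mul1r derivMn derivC mul0rn add0r.
have constP k l (x : 'M[_]_(k, l)) : map_mx d' (map_mx (@polyC T) x) = 0.
  by apply/matrixP => i j; rewrite !mxE d'E derivC.
have constQ x : pmx g' (map_mx (@polyC T) x) = map_mx (@polyC T) (pmx g x).
  by rewrite map_pmx.
have ev0g c : (ev0 \o g') c = g c by rewrite /= ?ev0E hornerC.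
apply/matrixP => i j.
have /(congr1 (fun X : 'M[_]_m => ev0 (d' (X i j)))) := pmxM g' b (map_mx (@polyC T) s).
rewrite constQ mxE (mxev_deriv_const _ _ d'M d'g) rmorph_sum => E.
rewrite mxE [pmx g s i j]mxE (mxev_deriv_const _ _ dM dg).
transitivity (\sum_k ev0 (mxev g' (b *m map_mx (@polyC T) s) (mderiv k (P i j)) *
    mxvec (map_mx d' (b *m map_mx (@polyC T) s)) 0 k)).
  apply: eq_bigr => k _; rewrite rmorphM /= !rmorph_mxev map_mxM b0 ev0C mul1mx.
  rewrite (eq_mxev _ _ ev0g); congr (_ * _).
  have -> : map_mx d' (b *m map_mx (@polyC T) s) = map_mx (@polyC T) (map_mx d s).
    by rewrite (map_mx_leibniz d'M) b' constP mulmx0 addr0 -map_mxM -ds.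
  by rewrite -[in RHS]map_mxvec [in RHS]mxE ev0P.
have db k : ev0 (d' (pmx g' b i k)) = dpmx g B i k.
  rewrite !mxE (mxev_deriv_const _ _ d'M d'g) rmorph_sum; apply: eq_bigr => l _.
  rewrite rmorphM /= rmorph_mxev b0 (eq_mxev _ _ ev0g) b'.
  by congr (_ * _); rewrite -map_mxvec mxE ev0P.
rewrite E mxE [RHS]mxE !raddf_sum; apply: eq_bigr => k _.
have -> : (map_mx (@polyC T) (pmx g s)) k j = (pmx g s k j)%:P by rewrite mxE.
rewrite d'M [d' _%:P]derivC mulr0 addr0 -db.
by rewrite -[X in _ = _ * X]ev0P; exact: (rmorphM ev0).
Qed.

End polynomial_matrices.

(** * Systems induced by representations *)

Lemma map_mx_injective (T U : Type) (f : T -> U) m n :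
  injective f -> injective (map_mx f : 'M[_]_(m, n) -> _).
Proof.
move=> f_inj A B /matrixP AB; apply/matrixP => i j; apply: f_inj.
by have := AB i j; rewrite !mxE.
Qed.

(** The embedding of GL(n) into the matrices of size [n + 1] that makes the
    inverse of the determinant a polynomial. *)
Definition ext {T : pzRingType} {n} (s : 'M[T]_n) (c : T) : 'M[T]_(n + 1) :=
  block_mx s 0 0 c%:M.

Lemma map_ext {T U : pzRingType} (f : {rmorphism T -> U}) n (s : 'M[T]_n) c :
  map_mx f (ext s c) = ext (map_mx f s) (f c).
Proof. by rewrite /ext map_block_mx !raddf0 map_scalar_mx. Qed.

Lemma mul_ext {T : comPzRingType} n (s t : 'M[T]_n) c d :
  ext s c *m ext t d = ext (s *m t) (c * d).
Proof.
by rewrite /ext mulmx_block !(mulmx0, mul0mx, addr0, add0r) scalar_mxM.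
Qed.

Section determinant.
Context {C : closedFieldType} {n : nat}.

Definition det_poly (_ _ : 'I_1) : {mpoly C[n * n]} := \det (genmx C).

Lemma pmx_det {T : comNzRingType} (g : {rmorphism C -> T}) s :
  pmx det_poly g s = (\det s)%:M.
Proof.
apply/matrixP => i j; rewrite !ord1 !mxE eqxx mulr1n /det_poly.
by rewrite -det_map_mx mxev_genmx.
Qed.

Lemma det_poly_mult : multiplicative_on_units det_poly.
Proof.
split=> [|s t _ _]; rewrite !(pmx_det [the {rmorphism C -> C} of idfun]).
  by rewrite det1.
by rewrite det_mulmx scalar_mxM.
Qed.

(** Jacobi's formula. *)
Lemma det_inv_deriv (C_unc : uncountable_like C) {T : comNzRingType}
    (g : {rmorphism C -> T}) (d : {additive T -> T}) (B s t : 'M[T]_n) :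
  leibniz d -> (forall c, d (g c) = 0) -> map_mx d s = B *m s -> s *m t = 1%:M ->
  d (\det t) = - dpmx det_poly g B 0 0 * \det t.
Proof.
move=> dM dg ds st; set b := dpmx det_poly g B 0 0.
have det_st : \det s * \det t = 1 by rewrite -det_mulmx st det1.
have d_det : d (\det s) = b * \det s.
  have := pmx_deriv C_unc det_poly_mult dM dg ds; rewrite pmx_det.
  move/matrixP/(_ 0 0); rewrite [LHS]mxE [RHS]mxE big_ord1 !mxE eqxx !mulr1n => ->.
  by rewrite /b mxE.
have := congr1 d det_st; rewrite dM d_det (leibniz1 dM) -mulrA det_st mulr1.
move/(congr1 (fun x => x * \det t)); rewrite mul0r mulrDl mulrAC det_st mul1r.
by move/eqP; rewrite addrC addr_eq0 mulNr => /eqP.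
Qed.

End determinant.

Section representations.
Context {C : closedFieldType} (C_unc : uncountable_like C).
Context {n m : nat} (P : 'I_m -> 'I_m -> {mpoly C[n * n]}) (r : nat).
Hypothesis P_mult : multiplicative_on_units P.

(** The representation [P / det ^ r], as a function of [s] and of [u], the
    inverse of its determinant. *)
Definition rep_mx {T : comNzRingType} (g : C -> T) (s : 'M[T]_n) (u : T) : 'M[T]_m :=
  u ^+ r *: pmx P g s.

Definition drep_mx {T : comNzRingType} (g : C -> T) (B : 'M[T]_n) : 'M[T]_m :=
  dpmx P g B - (r%:R * dpmx det_poly g B 0 0)%:M.

Lemma rep_mxM {T : comNzRingType} (g : {rmorphism C -> T}) s t u v :
  rep_mx g (s *m t) (u * v) = rep_mx g s u *m rep_mx g t v.
Proof.
rewrite /rep_mx (pmxM C_unc P_mult) exprMn -scalemxAl -scalemxAr scalerA //.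
Qed.

Lemma rep_mx1 {T : comNzRingType} (g : {rmorphism C -> T}) : rep_mx g 1%:M 1 = 1%:M.
Proof. by rewrite /rep_mx expr1n scale1r (pmx1 P_mult). Qed.

Lemma map_rep_mx {T U : comNzRingType} (f : {rmorphism T -> U})
    (g : {rmorphism C -> T}) s u :
  map_mx f (rep_mx g s u) = rep_mx (f \o g) (map_mx f s) (f u).
Proof. by rewrite /rep_mx map_mxZ map_pmx rmorphXn. Qed.

Lemma eq_rep_mx {T : comNzRingType} (g g' : C -> T) s u :
  g =1 g' -> rep_mx g s u = rep_mx g' s u.
Proof. by move=> gg'; rewrite /rep_mx (eq_pmx _ _ gg'). Qed.

(** The image of a fundamental matrix is a fundamental matrix of the induced
    system; the second term of [drep_mx] comes from the power of the
    determinant. *)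
Lemma rep_mx_deriv {T : comNzRingType} (g : {rmorphism C -> T})
    (d : {additive T -> T}) (B s t : 'M[T]_n) :
  leibniz d -> (forall c, d (g c) = 0) -> map_mx d s = B *m s -> s *m t = 1%:M ->
  map_mx d (rep_mx g s (\det t)) = drep_mx g B *m rep_mx g s (\det t).
Proof.
move=> dM dg ds st; have d_u := det_inv_deriv C_unc dM dg ds st.
set b := dpmx det_poly g B 0 0 in d_u *.
have d_ur : d (\det t ^+ r) = - (r%:R * b) * \det t ^+ r.
  case: (r) => [|k]; first by rewrite expr0 (leibniz1 dM) !mul0r oppr0 mul0r.
  by rewrite (leibnizX dM) d_u exprS; ring.
have dZ (x : T) (X : 'M[T]_m) : map_mx d (x *: X) = d x *: X + x *: map_mx d X.
  by apply/matrixP => i j; rewrite !mxE dM.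
rewrite /drep_mx -/b /rep_mx dZ d_ur (pmx_deriv C_unc P_mult dM dg ds).
rewrite mulmxBl mul_scalar_mx scalerA mulNr scaleNr addrC.
by rewrite -scalemxAr.
Qed.

End representations.

(** What the local study of a system at a nonsingular point provides: a
    differential field [M] of Laurent expansions with its subring [S] of power
    series, a subfield [K] of rational functions, and a fundamental matrix
    that is the identity at the origin. *)
Section galois_group.
Context {C : closedFieldType} (C_unc : uncountable_like C).
Context {S : comNzRingType} {M : fieldType} (M_char0 : forall k, k.+1%:R != 0 :> M).
Context {cst : {rmorphism C -> S}} {F : {rmorphism S -> M}}.
Context {ev0 : {rmorphism S -> C}} {D : {additive M -> M}}.
Hypotheses (F_inj : injective F) (ev0_cst : forall c, ev0 (cst c) = c).
Hypothesis (DM : leibniz D).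
Local Notation iota := (F \o cst).
Hypothesis D_const : forall x, D x = 0 <-> exists c, x = iota c.
Context {K : M -> Prop} (subK : is_subfield K).
Hypotheses (K_const : forall c, K (iota c)) (K_D : forall x, K x -> K (D x)).
Context {n : nat} {A : 'M[M]_n} (K_A : forall i j, K (A i j)).
Context {PhiS PsiS : 'M[S]_n} (PhiPsi : PhiS *m PsiS = 1%:M).
Hypothesis Phi0 : map_mx ev0 PhiS = 1%:M.
Local Notation Phi := (map_mx F PhiS).
Local Notation Psi := (map_mx F PsiS).
Hypothesis D_Phi : map_mx D Phi = A *m Phi.

Let PhiPsiM : Phi *m Psi = 1%:M.
Proof. by rewrite -map_mxM PhiPsi map_mx1. Qed.
Let uM : M := \det Psi.
Let det_PhiPsi : \det Phi * uM = 1.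
Proof. by rewrite -det_mulmx PhiPsiM det1. Qed.
Let D_cst c : D (iota c) = 0.
Proof. by apply/D_const; exists c. Qed.
Let iota_inj : injective iota.
Proof. exact: fmorph_inj. Qed.
Let iota_eq0 c : (F (cst c) == 0) = (c == 0).
Proof. exact: (fmorph_eq0 iota). Qed.

Local Notation PhiE := (ext Phi uM).

Lemma ext_inverse : PhiE *m ext Psi (\det Phi) = 1%:M.
Proof. by rewrite mul_ext PhiPsiM mulrC det_PhiPsi /ext -scalar_mx_block. Qed.

Definition A_ext : 'M[M]_(n + 1) := ext A (- dpmx det_poly iota A 0 0).

Lemma D_ext : map_mx D PhiE = A_ext *m PhiE.
Proof.
rewrite mul_ext /ext map_block_mx D_Phi !raddf0; congr block_mx.
apply/matrixP => i j; rewrite !ord1 [LHS]mxE [uM%:M _ _]mxE.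
rewrite [RHS]mxE eqxx !mulr1n; exact: (det_inv_deriv C_unc DM D_cst D_Phi PhiPsiM).
Qed.

Lemma K_dpmx m (P : 'I_m -> 'I_m -> {mpoly C[n * n]}) i j : K (dpmx P iota A i j).
Proof.
rewrite mxE; apply: (sf_sum subK) => k _; apply: (sfM subK).
  rewrite -(map_mx1 iota) -[mxev _ _ _]/(mxev (iota \o idfun) _ _).
  rewrite -(rmorph_mxev iota [the {rmorphism C -> C} of idfun]); exact: K_const.
by case/mxvec_indexP: k => x y; rewrite mxvecE.
Qed.

Lemma K_A_ext i j : K (A_ext i j).
Proof.
rewrite /A_ext /ext; case: (split_ordP i) => i' ->; case: (split_ordP j) => j' ->.
- by rewrite block_mxEul.
- by rewrite block_mxEur mxE; apply: sf0 subK.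
- by rewrite block_mxEdl mxE; apply: sf0 subK.
- rewrite block_mxEdr !ord1 mxE eqxx; apply: (sfN subK); exact: K_dpmx.
Qed.

Local Notation spec := (specializable (iota := iota) (K := K) (Phi := PhiE)).

Let gen : 'M[{mpoly M[(n + 1) * (n + 1)]}]_(n + 1) := genmx M.

Let coefs_gen i j : coefs_in K (gen i j).
Proof. by rewrite mxE; apply: (coefs_inX subK). Qed.

Let gen_ul (Y : 'M[M]_(n + 1)) : map_mx (mxev idfun Y) (ulsubmx gen) = ulsubmx Y.
Proof. by rewrite map_ulsubmx mxev_genmx. Qed.

Let gen_dr (Y : 'M[M]_(n + 1)) : mxev idfun Y (drsubmx gen 0 0) = drsubmx Y 0 0.
Proof. by rewrite -[in RHS](mxev_genmx idfun Y) -map_drsubmx [RHS]mxE. Qed.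

Let K_gen_dr : coefs_in K (drsubmx gen 0 0).
Proof. by rewrite 2!mxE; apply: coefs_gen. Qed.

Let K_gen_ul i j : coefs_in K (ulsubmx gen i j).
Proof. by rewrite 2!mxE; apply: coefs_gen. Qed.

(** Specializations of the extended matrix are extensions of invertible
    matrices, because this property is expressed by relations. *)
Lemma specializable_ext (s : 'M[C]_(n + 1)) : spec s ->
  exists sigma c, s = ext sigma c /\ \det sigma * c = 1.
Proof.
move=> s_spec; pose X := PhiE *m map_mx iota s.
have gen_ev (Y : 'M[M]_(n + 1)) i j : mxev idfun Y (gen i j) = Y i j.
  by rewrite -[in RHS](mxev_genmx idfun Y) [RHS]mxE.
have X0 i j : PhiE i j = 0 -> X i j = 0.
  move=> ij0; rewrite -(gen_ev X) s_spec //.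
  by split; [exact: coefs_gen | rewrite gen_ev].
have XE : X = block_mx (Phi *m map_mx iota (ulsubmx s)) (Phi *m map_mx iota (ursubmx s))
    (uM *: map_mx iota (dlsubmx s)) (uM *: map_mx iota (drsubmx s)).
  rewrite /X /ext -{1}[s]submxK map_block_mx mulmx_block.
  by rewrite !mul0mx !addr0 !add0r !mul_scalar_mx.
have ur0 : ursubmx s = 0.
  have : Phi *m map_mx iota (ursubmx s) = 0.
    apply/matrixP => i j; rewrite [RHS]mxE.
    have := X0 (lshift 1 i) (rshift n j); rewrite XE /ext !block_mxEur => -> //.
    by rewrite mxE.
  move/(congr1 (mulmx Psi)); rewrite mulmx0 mulmxA (mulmx1C PhiPsiM) mul1mx.
  move=> /matrixP E; apply/matrixP => i j; have := E i j.
  by rewrite [LHS]mxE [RHS]mxE /= => /eqP; rewrite iota_eq0 [RHS]mxE => /eqP.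
have u_neq0 : uM != 0.
  by apply/eqP => u0; move/eqP: det_PhiPsi; rewrite u0 mulr0 eq_sym oner_eq0.
have dl0 : dlsubmx s = 0.
  apply/matrixP => i j; have := X0 (rshift n i) (lshift 1 j).
  rewrite XE /ext !block_mxEdl !mxE => /(_ erefl)/eqP.
  by rewrite mulf_eq0 (negPf u_neq0) iota_eq0 => /eqP.
exists (ulsubmx s), (drsubmx s 0 0); split.
  by rewrite /ext -{1}[s]submxK ur0 dl0 {1}[drsubmx s]mx11_scalar.
pose f := \det (ulsubmx gen) * drsubmx gen 0 0 - 1.
have f_ev Y : mxev idfun Y f = \det (ulsubmx Y) * drsubmx Y 0 0 - 1.
  by rewrite rmorphB rmorphM rmorph1 /= -det_map_mx gen_ul gen_dr.
have : mxev idfun X f = 0.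
  apply: s_spec; split.
    apply: (coefs_inB subK); last by rewrite -(mpolyC1 _ M); apply: (coefs_inC subK); apply: sf1 subK.
    apply: (coefs_inM subK); last exact: K_gen_dr.
    apply: (coefs_in_sum subK) => p _; apply: (coefs_inM subK).
      rewrite -(rmorph_sign (@mpolyC _ M)); apply: (coefs_inC subK).
      by rewrite -signr_odd; case: odd; [rewrite expr1; apply: (sfN subK)|]; exact: sf1 subK.
    by apply: (coefs_in_prod subK) => i _; exact: K_gen_ul.
  by rewrite f_ev /ext block_mxKul block_mxKdr mxE eqxx det_PhiPsi subrr.
rewrite f_ev XE block_mxKul block_mxKdr det_mulmx [\det (map_mx iota _)]det_map_mx 2!mxE.
move/eqP; rewrite subr_eq0 mulrACA det_PhiPsi mul1r -rmorphM => /eqP E.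
by apply: iota_inj; rewrite rmorph1.
Qed.

Section representation.
Context {m : nat} (P : 'I_m -> 'I_m -> {mpoly C[n * n]}) (r : nat).
Hypothesis P_mult : multiplicative_on_units P.
Local Notation rep := (rep_mx P r).

(** The fundamental matrix of the system induced in the representation. *)
Let RM : 'M[M]_m := rep iota Phi uM.
Let RMinv : 'M[M]_m := rep iota Psi (\det Phi).

Let RMK : RM *m RMinv = 1%:M.
Proof.
by rewrite /RM /RMinv -(rep_mxM C_unc r P_mult) PhiPsiM mulrC det_PhiPsi rep_mx1.
Qed.

Let RMS : RM = map_mx F (rep cst PhiS (\det PsiS)).
Proof. by rewrite map_rep_mx -det_map_mx; apply: eq_rep_mx. Qed.

Let RMinvS : RMinv = map_mx F (rep cst PsiS (\det PhiS)).
Proof. by rewrite map_rep_mx -det_map_mx; apply: eq_rep_mx. Qed.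

Let Psi0 : map_mx ev0 PsiS = 1%:M.
Proof. by have := congr1 (map_mx ev0) PhiPsi; rewrite map_mxM Phi0 mul1mx map_mx1. Qed.

Let ev0_rep (s : 'M[S]_n) : map_mx ev0 s = 1%:M -> forall t : 'M[S]_n, map_mx ev0 t = 1%:M ->
  map_mx ev0 (rep cst s (\det t)) = 1%:M.
Proof.
move=> s0 t t0; rewrite map_rep_mx -det_map_mx s0 t0 det1.
rewrite (@eq_rep_mx _ _ _ P r _ _ idfun) //.
exact: (rep_mx1 r P_mult [the {rmorphism C -> C} of idfun]).
Qed.

Lemma rep_solution_deriv (v : 'cV[C]_m) :
  map_mx D (RM *m map_mx iota v) = drep_mx P r iota A *m (RM *m map_mx iota v).
Proof.
rewrite (map_mx_leibniz DM) (rep_mx_deriv C_unc r P_mult DM D_cst D_Phi PhiPsiM).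
have -> : map_mx D (map_mx iota v) = 0.
  by apply/matrixP => i j; rewrite !mxE; apply: D_cst.
by rewrite mulmx0 addr0 mulmxA.
Qed.

(** Variation of constants: in the coordinates given by the fundamental matrix
    only the scalar part of the system remains. *)
Lemma variation_of_constants (w : 'cV[M]_m) b :
  map_mx D w = drep_mx P r iota A *m w - b *: w ->
  map_mx D (RMinv *m w) = - b *: (RMinv *m w).
Proof.
move=> Dw; have wE : w = RM *m (RMinv *m w) by rewrite mulmxA RMK mul1mx.
set z := RMinv *m w in wE *; move: Dw; rewrite wE (map_mx_leibniz DM).
rewrite (rep_mx_deriv C_unc r P_mult DM D_cst D_Phi PhiPsiM) -mulmxA.
move/addrI/(congr1 (mulmx RMinv)); rewrite mulmxA (mulmx1C RMK) mul1mx => ->.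
by rewrite mulmxN scalemxAr mulmxA (mulmx1C RMK) mul1mx scaleNr.
Qed.

Lemma rational_solutionE (v : 'cV[M]_m) (vS : 'cV[S]_m) :
  map_mx D v = drep_mx P r iota A *m v -> v = map_mx F vS ->
  v = RM *m map_mx iota (map_mx ev0 vS).
Proof.
move=> Dv vE; have Dz : map_mx D (RMinv *m v) = 0.
  by rewrite (@variation_of_constants v 0) ?scale0r ?subr0 // oppr0 scale0r.
have /choice[c cP] : forall i, exists c, (RMinv *m v) i 0 = iota c.
  by move=> i; apply/D_const; move/matrixP/(_ i 0): Dz; rewrite mxE [RHS]mxE.
pose z : 'cV[C]_m := \col_i c i.
have zE : RMinv *m v = map_mx iota z.
  by apply/matrixP => i j; rewrite ord1 cP !mxE.
have {zE} vz : v = RM *m map_mx iota z by rewrite -zE mulmxA RMK mul1mx.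
suff -> : map_mx ev0 vS = z by [].
have : map_mx F vS = map_mx F (rep cst PhiS (\det PsiS) *m map_mx cst z).
  by rewrite map_mxM -RMS -vE vz map_mx_comp.
move=> /(map_mx_injective F_inj) ->; rewrite map_mxM (ev0_rep Phi0 Psi0) mul1mx.
by apply/matrixP => i j; rewrite !mxE ev0_cst.
Qed.

(** After variation of constants all coordinates satisfy one scalar equation of
    order one, so that their ratios are constants, to be read at the origin. *)
Lemma pre_solutionE (w : 'cV[M]_m) (wS : 'cV[S]_m) b :
  map_mx D w = drep_mx P r iota A *m w - b *: w -> w = map_mx F wS ->
  map_mx ev0 wS != 0 ->
  exists2 h, h != 0 & w = h *: (RM *m map_mx iota (map_mx ev0 wS)).
Proof.
move=> /variation_of_constants Dz wE; set w0 := map_mx ev0 wS => w0_neq0.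
set z := RMinv *m w in Dz; pose zS := rep cst PsiS (\det PhiS) *m wS.
have zE : z = map_mx F zS by rewrite /z wE RMinvS map_mxM.
have zS0 : map_mx ev0 zS = w0 by rewrite map_mxM (ev0_rep Psi0 Phi0) mul1mx.
have [k wk] : exists k, w0 k 0 != 0.
  apply: contrapT => /forallNP w00; case/eqP: w0_neq0.
  by apply/matrixP => i j; rewrite ord1 [RHS]mxE; apply/eqP/negP => /negP/w00.
have zk : z k 0 != 0.
  apply: contraNneq wk; rewrite -zS0 zE !mxE -(rmorph0 F) => /F_inj ->.
  by rewrite rmorph0.
have Dzi i : D (z i 0) = - b * z i 0 by move/matrixP/(_ i 0): Dz; rewrite mxE [RHS]mxE.
have /choice[c cP] : forall i, exists c, z i 0 = iota c * z k 0.
  move=> i; suff [c cE] : exists c, z i 0 / z k 0 = iota c.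
    by exists c; rewrite -cE divfK.
  apply/D_const/(mulfI (expf_neq0 2 zk)); rewrite mulr0.
  have := DM (z i 0 / z k 0) (z k 0); rewrite divfK // !Dzi => E.
  have -> : z k 0 ^+ 2 * D (z i 0 / z k 0) = z k 0 * (D (z i 0 / z k 0) * z k 0) by ring.
  have -> : D (z i 0 / z k 0) * z k 0 = - b * z i 0 - z i 0 / z k 0 * (- b * z k 0).
    by rewrite E addrK.
  by rewrite mulrCA divfK // subrr mulr0.
have w0i i : w0 i 0 = c i * w0 k 0.
  have : zS i 0 = cst (c i) * zS k 0.
    by apply: F_inj; have := cP i; rewrite zE !mxE rmorphM.
  by move/(congr1 ev0); rewrite rmorphM /= ev0_cst -zS0 !mxE.
exists (z k 0 / iota (w0 k 0)); first by rewrite mulf_neq0 // invr_eq0 fmorph_eq0.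
rewrite -[w]mul1mx -RMK -mulmxA -/z scalemxAr; congr (_ *m _).
apply/matrixP => i j; rewrite ord1 cP [RHS]mxE.
have -> : map_mx iota w0 i 0 = iota (w0 i 0) by rewrite [LHS]mxE.
rewrite (w0i i) rmorphM /=.
by rewrite mulrCA divfK ?iota_eq0.
Qed.

(** The induced solution with value [v] at the origin, as a polynomial in the
    entries of the extended fundamental matrix. *)
Let sol_poly (v : 'cV[C]_m) i : {mpoly C[(n + 1) * (n + 1)]} :=
  (rep (@mpolyC ((n + 1) * (n + 1)) C) (ulsubmx (genmx C)) (drsubmx (genmx C) 0 0)
   *m map_mx (@mpolyC ((n + 1) * (n + 1)) C) v) i 0.

Let sol_poly_ext v i s u : mxev iota (ext s u) (sol_poly v i) =
  (rep iota s u *m map_mx iota v) i 0.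
Proof.
have -> : mxev iota (ext s u) (sol_poly v i) = (map_mx (mxev iota (ext s u))
   (rep (@mpolyC ((n + 1) * (n + 1)) C) (ulsubmx (genmx C)) (drsubmx (genmx C) 0 0)
     *m map_mx (@mpolyC ((n + 1) * (n + 1)) C) v)) i 0 by rewrite [RHS]mxE.
rewrite map_mxM map_rep_mx map_ulsubmx mxev_genmx block_mxKul.
have evC c : (mxev iota (ext s u) \o @mpolyC ((n + 1) * (n + 1)) C) c = iota c.
  exact: mxevC.
rewrite (eq_rep_mx _ _ _ _ evC); congr ((rep_mx P r _ _ _ *m _) _ _).
  transitivity (drsubmx (map_mx (mxev iota (ext s u)) (genmx C)) 0 0).
    by rewrite -map_drsubmx [RHS]mxE.
  by rewrite mxev_genmx block_mxKdr mxE eqxx.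
by apply/matrixP => x y; rewrite !mxE -evC.
Qed.

Let sol_poly_translate v i sigma c :
  mxev iota (PhiE *m map_mx iota (ext sigma c)) (sol_poly v i) =
  (RM *m map_mx iota (rep idfun sigma c *m v)) i 0.
Proof.
rewrite map_ext mul_ext sol_poly_ext (rep_mxM C_unc r P_mult) -mulmxA.
congr ((_ *m _) _ _); rewrite map_mxM; congr (_ *m _).
by rewrite (map_rep_mx _ _ iota [the {rmorphism C -> C} of idfun]); apply: eq_rep_mx.
Qed.

Let K_sol_poly v i : coefs_in K (map_mpoly iota (sol_poly v i)).
Proof. by move=> k; rewrite mcoeff_map_mpoly; apply: K_const. Qed.

Let sol_poly_ev v i X : mxev idfun X (map_mpoly iota (sol_poly v i)) =
  mxev iota X (sol_poly v i).
Proof. by rewrite mxev_map; apply: eq_mxev. Qed.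

Let RM_inj (x y : 'cV[M]_m) : RM *m x = RM *m y -> x = y.
Proof.
by move/(congr1 (mulmx RMinv)); rewrite !mulmxA (mulmx1C RMK) !mul1mx.
Qed.

Let map_iota_inj (x y : 'cV[C]_m) : map_mx iota x = map_mx iota y -> x = y.
Proof. exact: (map_mx_injective iota_inj). Qed.

(** A rational solution is a polynomial in the fundamental matrix that takes a
    value in [K]: this is a relation, hence it survives specialization. *)
Lemma specializable_fixes (v : 'cV[C]_m) sigma c :
  (forall i, K ((RM *m map_mx iota v) i 0)) -> spec (ext sigma c) ->
  rep idfun sigma c *m v = v.
Proof.
move=> Kv s_spec; apply/map_iota_inj/RM_inj/matrixP => i j; rewrite ord1.
apply/eqP; rewrite -subr_eq0 -sol_poly_translate; set x := (RM *m _) i 0.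
pose f := map_mpoly iota (sol_poly v i) - mpolyC _ x.
have f_ev X : mxev idfun X f = mxev iota X (sol_poly v i) - x.
  by rewrite rmorphB /= sol_poly_ev mxevC.
rewrite -f_ev s_spec //; split.
  by apply: (coefs_inB subK); [exact: K_sol_poly | apply: (coefs_inC subK); exact: Kv].
by rewrite f_ev sol_poly_ext subrr.
Qed.

(** The solution itself is not rational, but its multiple by [h] is: the minors
    of the matrix with columns [w] and the solution are relations. *)
Lemma specializable_line (v : 'cV[C]_m) (h : M) sigma c : h != 0 -> v != 0 ->
  (forall i, K ((h *: (RM *m map_mx iota v)) i 0)) -> spec (ext sigma c) ->
  exists a, rep idfun sigma c *m v = a *: v.
Proof.
move=> h0 v0 Kw s_spec; set w := h *: _ in Kw.
pose y := RM *m map_mx iota (rep idfun sigma c *m v).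
have minor i j : w i 0 * y j 0 = w j 0 * y i 0.
  pose f := mpolyC _ (w i 0) * map_mpoly iota (sol_poly v j)
    - mpolyC _ (w j 0) * map_mpoly iota (sol_poly v i).
  have f_ev X : mxev idfun X f = w i 0 * mxev iota X (sol_poly v j)
      - w j 0 * mxev iota X (sol_poly v i).
    by rewrite rmorphB !rmorphM /= !sol_poly_ev !mxevC.
  apply/eqP; rewrite -subr_eq0 /y -!sol_poly_translate -f_ev s_spec //; split.
    by apply: (coefs_inB subK); apply: (coefs_inM subK); [apply: (coefs_inC subK)
      | exact: K_sol_poly | apply: (coefs_inC subK) | exact: K_sol_poly].
  by rewrite f_ev !sol_poly_ext /w !mxE; ring.
have [k vk] : exists k, v k 0 != 0.
  apply: contrapT => /forallNP v00; case/eqP: v0.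
  by apply/matrixP => i j; rewrite ord1 [RHS]mxE; apply/eqP/negP => /negP/v00.
have [l wl] : exists l, w l 0 != 0.
  apply: contrapT => /forallNP w00.
  have : RM *m (h *: map_mx iota v) = RM *m 0.
    rewrite -scalemxAr -/w mulmx0; apply/matrixP => i j; rewrite ord1 [RHS]mxE.
    by apply/eqP/negP => /negP/w00.
  move/RM_inj/matrixP/(_ k 0); rewrite !mxE /= => /eqP.
  by rewrite mulf_eq0 (negPf h0) iota_eq0 (negPf vk).
pose a := y l 0 / w l 0 * h.
have yE : map_mx iota (rep idfun sigma c *m v) = a *: map_mx iota v.
  apply: RM_inj; rewrite -/y -scalemxAr; apply/matrixP => i j; rewrite ord1.
  have -> : (a *: (RM *m map_mx iota v)) i 0 = y l 0 / w l 0 * w i 0.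
    have -> : w i 0 = h * (RM *m map_mx iota v) i 0 by rewrite [LHS]mxE.
    by rewrite [LHS]mxE mulrA.
  by rewrite mulrAC [y l 0 * _]mulrC minor mulrC mulKf.
exists ((rep idfun sigma c *m v) k 0 / v k 0); apply: map_iota_inj.
rewrite yE map_mxZ; congr (_ *: _).
have vk' : iota (v k 0) != 0 by rewrite fmorph_eq0.
apply: (mulIf vk'); transitivity (iota ((rep idfun sigma c *m v) k 0)).
  transitivity (map_mx iota (rep idfun sigma c *m v) k 0); last by rewrite [LHS]mxE.
  by rewrite yE [RHS]mxE; congr (_ * _); rewrite [RHS]mxE.
by rewrite -rmorphM divfK.
Qed.

(** The coordinates of the solution are polynomials in the extended fundamental
    matrix, to which the Galois correspondence applies. *)
Lemma invariant_vector_rational (v : 'cV[C]_m) :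
  (forall sigma c, spec (ext sigma c) -> \det sigma * c = 1 ->
     rep idfun sigma c *m v = v) ->
  forall i, K ((RM *m map_mx iota v) i 0).
Proof.
move=> v_inv i; rewrite -sol_poly_ext.
apply: (invariant_rational C_unc M_char0 DM D_const subK K_const K_D K_A_ext
  ext_inverse D_ext) => s s_spec.
have [sigma [c [sE sc]]] := specializable_ext s_spec.
by rewrite sE sol_poly_translate v_inv -?sE // sol_poly_ext.
Qed.

End representation.

End galois_group.

(** * Polynomial vector fields *)

Section linear_substitution.
Context {n : nat}.

Definition linform {S : comNzRingType} (t : 'M[S]_n) (k : 'I_n) : {mpoly S[n]} :=
  \sum_l t k l *: mpolyX S (mnm1 l).

Definition linsubst {S : comNzRingType} (t : 'M[S]_n) : {mpoly S[n]} -> {mpoly S[n]} :=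
  mmap (@mpolyC n S) (linform t).

HB.instance Definition _ (S : comNzRingType) (t : 'M[S]_n) :=
  GRing.RMorphism.copy (linsubst t) (mmap (@mpolyC n S) (linform t)).

(** The vector field [y |-> s Y(t y)]; for [t] the inverse of [s] it is the
    image of [Y] under [s]. *)
Definition push {S : comNzRingType} (s t : 'M[S]_n) (Y : 'I_n -> {mpoly S[n]}) i :=
  \sum_j s i j *: linsubst t (Y j).

Lemma linsubstZ {S : comNzRingType} (t : 'M[S]_n) c p :
  linsubst t (c *: p) = c *: linsubst t p.
Proof. by rewrite /linsubst mmapZ mul_mpolyC. Qed.

Lemma linsubst_sum {S : comNzRingType} (t : 'M[S]_n) I (r : seq I) (P : pred I) F :
  linsubst t (\sum_(i <- r | P i) F i) = \sum_(i <- r | P i) linsubst t (F i).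
Proof. exact: rmorph_sum. Qed.

Lemma linsubst_linform {S : comNzRingType} (t t' : 'M[S]_n) k :
  linsubst t (linform t' k) = linform (t' *m t) k.
Proof.
rewrite linsubst_sum [RHS]/linform; under [RHS]eq_bigr do rewrite mxE scaler_suml.
rewrite exchange_big; apply: eq_bigr => j _ /=.
rewrite linsubstZ /linsubst mmapX mmap1U scaler_sumr.
by apply: eq_bigr => l _; rewrite scalerA.
Qed.

Lemma linsubstM {S : comNzRingType} (t t' : 'M[S]_n) p :
  linsubst t (linsubst t' p) = linsubst (t' *m t) p.
Proof.
rewrite {2}/linsubst rmorph_mmap; apply: eq_mmap => [c|k] /=.
  by rewrite /linsubst mmapC.
exact: linsubst_linform.
Qed.

Lemma linsubst1 {S : comNzRingType} (p : {mpoly S[n]}) : linsubst 1%:M p = p.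
Proof.
rewrite -[RHS]mmap_mpolyX_id; apply: eq_mmap => // k.
rewrite /linform (bigD1 k) //= mxE eqxx scale1r big1 ?addr0 // => l lk.
by rewrite mxE eq_sym (negPf lk) scale0r.
Qed.

Lemma pushM {S : comNzRingType} (s t s' t' : 'M[S]_n) Y i :
  push s t (push s' t' Y) i = push (s *m s') (t' *m t) Y i.
Proof.
rewrite /push; under [RHS]eq_bigr do rewrite mxE scaler_suml.
rewrite exchange_big; apply: eq_bigr => j _ /=.
rewrite linsubst_sum scaler_sumr; apply: eq_bigr => k _.
by rewrite linsubstZ linsubstM scalerA.
Qed.

Lemma push1 {S : comNzRingType} (Y : 'I_n -> {mpoly S[n]}) i : push 1%:M 1%:M Y i = Y i.
Proof.
rewrite /push (bigD1 i) //= mxE eqxx scale1r linsubst1 big1 ?addr0 // => j ji.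
by rewrite mxE eq_sym (negPf ji) scale0r.
Qed.

Lemma eq_push {S : comNzRingType} (s t : 'M[S]_n) Y Y' :
  Y =1 Y' -> push s t Y =1 push s t Y'.
Proof. by move=> YY' i; apply: eq_bigr => j _; rewrite YY'. Qed.

Lemma map_linform {S T : comNzRingType} (f : {rmorphism S -> T}) (t : 'M[S]_n) k :
  map_mpoly f (linform t k) = linform (map_mx f t) k.
Proof.
rewrite /linform raddf_sum; apply: eq_bigr => l _.
by rewrite /= map_mpolyZ map_mpolyX mxE.
Qed.

Lemma map_linsubst {S T : comNzRingType} (f : {rmorphism S -> T}) (t : 'M[S]_n) p :
  map_mpoly f (linsubst t p) = linsubst (map_mx f t) (map_mpoly f p).
Proof.
rewrite [LHS]rmorph_mmap [RHS]mmap_map_mpoly; apply: eq_mmap => [c|k] /=.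
  exact: map_mpolyC.
exact: map_linform.
Qed.

Lemma map_push {S T : comNzRingType} (f : {rmorphism S -> T}) (s t : 'M[S]_n) Y i :
  map_mpoly f (push s t Y i) =
  push (map_mx f s) (map_mx f t) (fun j => map_mpoly f (Y j)) i.
Proof.
rewrite /push raddf_sum; apply: eq_bigr => j _.
by rewrite /= map_mpolyZ map_linsubst mxE.
Qed.

Lemma linsubst_homog {S : comNzRingType} (t : 'M[S]_n) a b :
  mdeg b != mdeg a -> mcoeff b (linsubst t (mpolyX S a)) = 0.
Proof.
have : linsubst t (mpolyX S a) \is ishomog1 (mdeg a) mdeg.
  rewrite /linsubst mmapX mdegE /mmap1.
  apply: (big_ind2 (fun (p : {mpoly S[n]}) d => p \is ishomog1 d mdeg)) => [|p d q e|k _].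
  - exact: dhomog1.
  - exact: dhomogM.
  - rewrite -[X in ishomog1 X _]mul1n; apply: dhomogMn.
    apply: rpred_sum => l _; apply: rpredZ; rewrite dhomogX.
    by apply/eqP; exact: mdeg1.
by move=> /dhomog_nemf_coeff; apply.
Qed.

Lemma linsubst_scale {S : comNzRingType} (t : 'M[S]_n) c a :
  linsubst (c *: t) (mpolyX S a) = c ^+ mdeg a *: linsubst t (mpolyX S a).
Proof.
rewrite /linsubst !mmapX mdegE /mmap1 -prodrXr -scaler_prod.
apply: eq_bigr => k _; rewrite -exprZn; congr (_ ^+ _).
by rewrite /linform scaler_sumr; apply: eq_bigr => l _; rewrite mxE scalerA.
Qed.

End linear_substitution.

Lemma invmx_mul (K : fieldType) n (s t : 'M[K]_n) : s \in unitmx -> t \in unitmx ->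
  invmx (s *m t) = invmx t *m invmx s.
Proof.
move=> us ut; have ust : s *m t \in unitmx by rewrite unitmx_mul us.
apply: (can_inj (mulKmx ust)).
by rewrite mulmxV // mulmxA -[s *m t *m _]mulmxA mulmxV // mulmx1 mulmxV.
Qed.

Section vector_field_representation.
Context {n : nat} (d : nat).

Definition vf_index : finType := ('I_n * bmultinom n d)%type.
Definition vf_dim := #|vf_index|.

Definition deg_lt {S : nzRingType} (p : {mpoly S[n]}) : Prop :=
  forall b, (d <= mdeg b)%N -> mcoeff b p = 0.

Definition vf_vec {S : nzRingType} (Y : 'I_n -> {mpoly S[n]}) : 'cV[S]_vf_dim :=
  \col_k mcoeff (bmnm (enum_val k).2) (Y (enum_val k).1).

Definition vf_unvec {S : nzRingType} (v : 'cV[S]_vf_dim) i : {mpoly S[n]} :=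
  \sum_(b : bmultinom n d) v (enum_rank (i, b)) 0 *: mpolyX S (bmnm b).

Lemma mcoeff_bsum {S : nzRingType} (c : bmultinom n d -> S) (b : bmultinom n d) :
  mcoeff (bmnm b) (\sum_a c a *: mpolyX S (bmnm a)) = c b.
Proof.
rewrite linear_sum (bigD1 b) //= mcoeffZ mcoeffX eqxx mulr1 big1 ?addr0 // => a ab.
by rewrite mcoeffZ mcoeffX (inj_eq val_inj) (negPf ab) mulr0.
Qed.

Lemma deg_lt_bsum {S : nzRingType} (c : bmultinom n d -> S) :
  deg_lt (\sum_a c a *: mpolyX S (bmnm a)).
Proof.
move=> b le_db; rewrite linear_sum big1 // => a _ /=.
rewrite mcoeffZ mcoeffX; case: eqP => [ab|]; last by rewrite mulr0.
by move: le_db; rewrite -ab leqNgt bmdeg.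
Qed.

Lemma deg_ltE {S : nzRingType} (p : {mpoly S[n]}) : deg_lt p ->
  p = \sum_(b : bmultinom n d) mcoeff (bmnm b) p *: mpolyX S (bmnm b).
Proof.
move=> p_d; apply/mpolyP => b; have [lt_b|le_b] := ltnP (mdeg b) d.
  by rewrite (mcoeff_bsum (fun a => mcoeff (bmnm a) p) (BMultinom lt_b)).
by rewrite p_d // deg_lt_bsum.
Qed.

Lemma vf_unvecK {S : nzRingType} (v : 'cV[S]_vf_dim) : vf_vec (vf_unvec v) = v.
Proof.
apply/matrixP => k j; rewrite ord1 mxE mcoeff_bsum.
by rewrite -surjective_pairing enum_valK.
Qed.

Lemma vf_vecP {S : nzRingType} (Y Y' : 'I_n -> {mpoly S[n]}) :
  (forall i, deg_lt (Y i)) -> (forall i, deg_lt (Y' i)) ->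
  vf_vec Y = vf_vec Y' -> Y =1 Y'.
Proof.
move=> Yd Y'd YY' i; rewrite (deg_ltE (Yd i)) (deg_ltE (Y'd i)).
apply: eq_bigr => b _; congr (_ *: _).
by move/matrixP/(_ (enum_rank (i, b)) 0): YY'; rewrite !mxE enum_rankK.
Qed.

(** The matrix of [push s t] on the vector fields of degree less than [d]. *)
Definition vf_mx {S : comNzRingType} (s t : 'M[S]_n) : 'M[S]_vf_dim :=
  \matrix_(k, l) (s (enum_val k).1 (enum_val l).1 *
    mcoeff (bmnm (enum_val k).2) (linsubst t (mpolyX S (bmnm (enum_val l).2)))).

Lemma deg_lt_linsubst {S : comNzRingType} (t : 'M[S]_n) p :
  deg_lt p -> deg_lt (linsubst t p).
Proof.
move=> /deg_ltE -> b le_db; rewrite linsubst_sum linear_sum big1 // => a _ /=.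
rewrite linsubstZ mcoeffZ linsubst_homog ?mulr0 //.
by rewrite gtn_eqF // (leq_trans (bmdeg a)).
Qed.

Lemma deg_lt_push {S : comNzRingType} (s t : 'M[S]_n) Y i :
  (forall j, deg_lt (Y j)) -> deg_lt (push s t Y i).
Proof.
move=> Yd b le_db; rewrite linear_sum big1 // => j _ /=.
by rewrite mcoeffZ deg_lt_linsubst ?mulr0.
Qed.

Lemma vf_vec_push {S : comNzRingType} (s t : 'M[S]_n) Y :
  (forall i, deg_lt (Y i)) -> vf_vec (push s t Y) = vf_mx s t *m vf_vec Y.
Proof.
move=> Yd; apply/matrixP => k j; rewrite ord1 [RHS]mxE mxE linear_sum /=.
rewrite [RHS](reindex (@enum_rank vf_index)) /=; last first.
  by exists enum_val => ? _; rewrite ?enum_valK ?enum_rankK.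
pose G i (b : bmultinom n d) := s (enum_val k).1 i *
  mcoeff (bmnm (enum_val k).2) (linsubst t (mpolyX S (bmnm b))) * mcoeff (bmnm b) (Y i).
rewrite [RHS](eq_bigr (fun x => G x.1 x.2)); last first.
  by move=> x _; rewrite !mxE enum_rankK.
rewrite -(pair_bigA _ G) /=; apply: eq_bigr => i _.
rewrite mcoeffZ {1}(deg_ltE (Yd i)) linsubst_sum linear_sum mulr_sumr.
apply: eq_bigr => b _ /=; rewrite linsubstZ mcoeffZ /G; ring.
Qed.

Lemma vf_mxM {S : comNzRingType} (s t s' t' : 'M[S]_n) :
  vf_mx (s *m s') (t' *m t) = vf_mx s t *m vf_mx s' t'.
Proof.
apply/matrixP => k l; pose e : 'cV[S]_vf_dim := delta_mx l 0.
have col_l (X : 'M[S]_vf_dim) : X k l = (X *m e) k 0 by rewrite -colE mxE.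
rewrite !col_l -mulmxA -[e]vf_unvecK.
have e_d i : deg_lt (vf_unvec e i) by exact: deg_lt_bsum.
have push_d i : deg_lt (push s' t' (vf_unvec e) i) by exact: deg_lt_push.
rewrite -(vf_vec_push _ _ e_d) -(vf_vec_push s' t' e_d) -(vf_vec_push s t push_d).
by rewrite [LHS]mxE [RHS]mxE pushM.
Qed.

Lemma vf_mx1 {S : comNzRingType} : vf_mx 1%:M 1%:M = 1%:M :> 'M[S]_vf_dim.
Proof.
apply/matrixP => k l; pose e : 'cV[S]_vf_dim := delta_mx l 0.
have col_l (X : 'M[S]_vf_dim) : X k l = (X *m e) k 0 by rewrite -colE mxE.
rewrite !col_l mul1mx -[e]vf_unvecK -vf_vec_push; last by move=> i; exact: deg_lt_bsum.
by rewrite [LHS]mxE [RHS]mxE push1.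
Qed.

(** The inverse of [s] is its adjugate over the determinant, and linear
    substitution multiplies a monomial of degree [a] by the power [a] of a
    scalar factor: [\det s ^+ d] clears all denominators of [vf_mx]. *)
Definition vf_poly {C : comNzRingType} (k l : 'I_vf_dim) : {mpoly C[n * n]} :=
  genmx C (enum_val k).1 (enum_val l).1 *
  (\det (genmx C) ^+ (d - mdeg (bmnm (enum_val l).2)) *
   mcoeff (bmnm (enum_val k).2)
     (linsubst (\adj (genmx C)) (mpolyX _ (bmnm (enum_val l).2)))).

Lemma mxev_vf_poly {C : comNzRingType} {T : comNzRingType} (g : {rmorphism C -> T})
    (s : 'M[T]_n) k l :
  mxev g s (vf_poly k l) = s (enum_val k).1 (enum_val l).1 *
  (\det s ^+ (d - mdeg (bmnm (enum_val l).2)) *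
   mcoeff (bmnm (enum_val k).2)
     (linsubst (\adj s) (mpolyX _ (bmnm (enum_val l).2)))).
Proof.
rewrite !rmorphM rmorphXn /= -det_map_mx mxev_genmx; congr (_ * (_ * _)).
  by rewrite -[in RHS](mxev_genmx g s) [RHS]mxE.
by rewrite -mcoeff_map_mpoly map_linsubst map_mx_adj mxev_genmx map_mpolyX.
Qed.

Lemma vf_poly_unit {C : closedFieldType} {T : comNzRingType} (g : {rmorphism C -> T})
    (s t : 'M[T]_n) : s *m t = 1%:M ->
  rep_mx (@vf_poly C) d g s (\det t) = vf_mx s t.
Proof.
move=> st; have det_st : \det t * \det s = 1 by rewrite mulrC -det_mulmx st det1.
have tE : t = \det t *: \adj s.
  rewrite -[\adj s]mulmx1 -st mulmxA mul_adj_mx mul_scalar_mx scalerA det_st.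
  by rewrite scale1r.
apply/matrixP => k l; rewrite mxE [pmx _ _ _ _ _]mxE mxev_vf_poly [RHS]mxE.
rewrite [in RHS]tE linsubst_scale mcoeffZ; set a := mdeg _.
have a_d : (a <= d)%N by exact/ltnW/bmdeg.
rewrite -[in X in _ ^+ X * _](subnK a_d) exprD.
move: (mcoeff _ _) (s _ _) => x y.
have -> : \det t ^+ (d - a) * \det t ^+ a * (y * (\det s ^+ (d - a) * x)) =
  (\det t * \det s) ^+ (d - a) * (y * (\det t ^+ a * x)) by rewrite exprMn; ring.
by rewrite det_st expr1n mul1r.
Qed.

Lemma vf_poly_mult {C : closedFieldType} : multiplicative_on_units (@vf_poly C).
Proof.
have pmxE (s : 'M[C]_n) : s \in unitmx ->
    pmx (@vf_poly C) idfun s = \det s ^+ d *: vf_mx s (invmx s).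
  move=> us; rewrite -(vf_poly_unit [the {rmorphism C -> C} of idfun] (mulmxV us)).
  rewrite /rep_mx scalerA -exprMn -det_mulmx mulmxV // det1 expr1n scale1r //.
split=> [|s t us ut].
  by rewrite pmxE ?unitmx1 // det1 expr1n scale1r invmx1 vf_mx1.
have ust : s *m t \in unitmx by rewrite unitmx_mul us.
rewrite !pmxE // -scalemxAl -scalemxAr scalerA -exprMn -det_mulmx -vf_mxM.
by rewrite invmx_mul.
Qed.

End vector_field_representation.

(** * Lie brackets with a linear vector field *)

Section lie_derivative.
Context {n : nat} {S : comNzRingType} {D : {additive S -> S}} (DM : leibniz D).
Context {A s t : 'M[S]_n} (Ds : map_mx D s = A *m s) (st : s *m t = 1%:M).
Implicit Type Y : 'I_n -> {mpoly S[n]}.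

Lemma map_mpoly_linform (B : 'M[S]_n) k :
  map_mpoly D (linform B k) = linform (map_mx D B) k.
Proof.
rewrite /linform raddf_sum; apply: eq_bigr => l _ /=.
rewrite (map_mpoly_leibnizZ DM) mxE.
suff -> : map_mpoly D (mpolyX S (mnm1 l)) = 0 :> {mpoly S[n]} by rewrite scaler0 addr0.
apply/mpolyP => m; rewrite mcoeff_map_mpoly mcoeffX mcoeff0.
by case: eqP; rewrite ?raddf0 ?(leibniz1 DM).
Qed.

Lemma linsubst_deriv (p : {mpoly S[n]}) : map_mpoly D (linsubst s p) =
  linsubst s (map_mpoly D p + \sum_k linform A k * mderiv k p).
Proof.
have DM' := @leibniz_map_mpoly _ _ DM n.
rewrite [linsubst s p]/(mmap _ _ _) (chain_rule (d := map_mpoly D) DM DM') => [|x].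
  rewrite [RHS]rmorphD /= [linsubst s (\sum_k _)]linsubst_sum; congr (_ + _).
  apply: eq_bigr => k _.
  by rewrite rmorphM /= linsubst_linform mulrC map_mpoly_linform Ds.
by rewrite /= map_mpolyC.
Qed.

Lemma mderiv_linform (B : 'M[S]_n) i k : mderiv k (linform B i) = mpolyC n (B i k).
Proof.
rewrite /linform linear_sum (bigD1 k) //= mderivZ mderivX mnm1E eqxx scale1r.
rewrite big1 ?addr0 => [|l lk]; last first.
  by rewrite mderivZ mderivX mnm1E (negPf lk) scale0r scaler0.
have -> : mnm_sub (mnm1 k) (mnm1 k) = mnm0 by apply/mnmP => j; rewrite mnmBE mnm0E subnn.
by rewrite mpolyX0 -mul_mpolyC mulr1.
Qed.

Lemma bracketE Y i : bracket D (vfieldX A) (vertical Y) (Some i) =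
  map_mpoly D (Y i) + \sum_k linform A k * mderiv k (Y i) - \sum_j A i j *: Y j.
Proof.
rewrite /bracket /vf_act /= mul1r mul0r add0r; congr (_ - _).
apply: eq_bigr => k _; rewrite -[\sum_(j < n) _]/(linform A i) mderiv_linform.
by rewrite mulrC mul_mpolyC.
Qed.

Lemma map_mx_deriv_inverse : t *m s = 1%:M -> map_mx D t = - (t *m A).
Proof.
move=> ts; have := congr1 (map_mx D) ts; rewrite (map_mx_leibniz DM) Ds.
have -> : map_mx D (1%:M : 'M[S]_n) = 0.
  by apply/matrixP => i j; rewrite !mxE; case: eqP; rewrite ?raddf0 ?(leibniz1 DM).
move/(congr1 (mulmx^~ t)); rewrite mul0mx mulmxDl -!mulmxA st !mulmx1.
by move/eqP; rewrite addr_eq0 => /eqP.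
Qed.

(** Differentiating the vector field that is transported to the origin along
    the fundamental matrix amounts to transporting the bracket with [X]. *)
Lemma push_bracket Y i : map_mpoly D (push t s Y i) =
  push t s (fun j => bracket D (vfieldX A) (vertical Y) (Some j)) i.
Proof.
have tD := map_mx_deriv_inverse (mulmx1C st).
rewrite /push raddf_sum /=.
under eq_bigr do rewrite (map_mpoly_leibnizZ DM) linsubst_deriv.
under [RHS]eq_bigr do rewrite bracketE rmorphB /= scalerBr.
rewrite big_split sumrB addrC; congr (_ + _) => /=.
under [X in - X]eq_bigr do rewrite linsubst_sum scaler_sumr.
rewrite exchange_big -sumrN; apply: eq_bigr => j _ /=.
move/matrixP/(_ i j): tD; rewrite mxE => ->; rewrite !mxE scaleNr scaler_suml.
by congr (- _); apply: eq_bigr => k _; rewrite linsubstZ scalerA.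
Qed.

Lemma bracket_None Y : bracket D (vfieldX A) (vertical Y) None = 0.
Proof.
rewrite /bracket /vf_act /= mul1r mul0r add0r raddf0 add0r.
rewrite !big1 ?subrr // => k _; last by rewrite mderiv0 mulr0.
by rewrite -(mpolyC1 n S) mderivC mulr0.
Qed.

Lemma bracket_eq0_push Y :
  (forall k, bracket D (vfieldX A) (vertical Y) k = 0) <->
  (forall i, map_mpoly D (push t s Y i) = 0).
Proof.
split=> [XY i|XY [i|]]; last exact: bracket_None.
  rewrite push_bracket /push big1 // => j _.
  by rewrite XY raddf0 scaler0.
pose B j := bracket D (vfieldX A) (vertical Y) (Some j).
rewrite -[LHS](push1 B i) -{1}st -st -pushM; apply: big1 => j _.
by rewrite -push_bracket XY raddf0 scaler0.
Qed.

End lie_derivative.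

Section vector_field_values.
Context {R : realType} {n : nat} (C_unc : uncountable_like R[i]).
Implicit Type Y : 'I_n -> {mpoly R[i][n]}.

Lemma vf_map_inj Y Y' : vf_map Y = vf_map Y' -> Y =1 Y'.
Proof.
move=> YY' i; apply/eqP; rewrite -subr_eq0; apply/eqP/(mpoly_eq0_eval C_unc) => c.
have /matrixP/(_ i 0) := congr1 (fun f => f (\col_j c j)) YY'; rewrite !mxE.
have cE : (fun j => (\col_k c k : 'cV_n) j 0) = c by apply/funext => j; rewrite mxE.
by rewrite cE mevalB => ->; rewrite subrr.
Qed.

Lemma vf_push_map (s : 'M[R[i]]_n) Y :
  vf_push s (vf_map Y) = vf_map (push s (invmx s) Y).
Proof.
apply/funext => y; apply/matrixP => i j; rewrite !mxE raddf_sum.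
apply: eq_bigr => k _; rewrite mxE /= mevalZ; congr (_ * _).
rewrite /meval [RHS]rmorph_mmap; apply: eq_mmap => [c|l] /=.
  by rewrite mmapC.
rewrite raddf_sum mxE; apply: eq_bigr => m _ /=.
by rewrite mmapZ mmapX mmap1U.
Qed.

Lemma vf_push_fixed (s : 'M[R[i]]_n) Y :
  vf_push s (vf_map Y) = vf_map Y <-> push s (invmx s) Y =1 Y.
Proof.
rewrite vf_push_map; split=> [/vf_map_inj //|/funext -> //].
Qed.

End vector_field_values.

(** * Convergent power series *)

Section complex_analysis.
Context {R : realType}.
Local Notation C := R[i].
Local Notation nrm := (@ComplexField.Normc.normc R).

Lemma nrmE (z : C) : `|z| = (nrm z)%:C%C.
Proof. by []. Qed.

Lemma nrm_ge0 (z : C) : 0 <= nrm z.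
Proof. by have := normr_ge0 z; rewrite nrmE ler0c. Qed.

Lemma nrm_eq0 (z : C) : (nrm z == 0) = (z == 0).
Proof.
by apply/eqP/eqP => [/ComplexField.Normc.eq0_normc //|->]; rewrite ComplexField.Normc.normc0.
Qed.

Lemma nrm_gt0 (z : C) : (0 < nrm z) = (z != 0).
Proof. by rewrite lt_neqAle nrm_ge0 andbT eq_sym nrm_eq0. Qed.

Lemma nrmM (x y : C) : nrm (x * y) = nrm x * nrm y.
Proof. exact: ComplexField.Normc.normcM. Qed.

Lemma nrmX (x : C) k : nrm (x ^+ k) = nrm x ^+ k.
Proof.
elim: k => [|k IHk]; first by rewrite !expr0 ComplexField.Normc.normc1.
by rewrite !exprS nrmM IHk.
Qed.

Lemma nrmN (x : C) : nrm (- x) = nrm x.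
Proof. by have := normrN x; rewrite !nrmE => -[]. Qed.

Lemma nrmB (x y : C) : nrm (x - y) = nrm (y - x).
Proof. by rewrite -opprB nrmN. Qed.

Lemma nrmD (x y : C) : nrm (x + y) <= nrm x + nrm y.
Proof. by have := ler_normD x y; rewrite !nrmE -rmorphD lecR. Qed.

Lemma nrm_sum I (r : seq I) (P : pred I) (f : I -> C) :
  nrm (\sum_(i <- r | P i) f i) <= \sum_(i <- r | P i) nrm (f i).
Proof.
apply: (big_ind2 (fun x y => nrm x <= y)) => //.
  by rewrite ComplexField.Normc.normc0.
by move=> x x' y y' xx' yy'; apply: le_trans (nrmD _ _) (lerD xx' yy').
Qed.

Lemma nrm_nat k : nrm k%:R = k%:R.
Proof. by have := normr_nat C k; rewrite nrmE -(rmorph_nat (real_complex R)) => -[]. Qed.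

Lemma gt0_real_complex (x : R) : (0 < x%:C%C) = (0 < x).
Proof. exact: (ltcR 0 x). Qed.

Lemma gt0_ReE (e : C) : 0 < e -> e = (complex.Re e)%:C%C.
Proof. by case: e => a b; rewrite ltcE /= => /andP[/eqP -> _]. Qed.

Lemma near_puncturedP (P : C -> Prop) :
  (\forall z \near (0 : C^o)^', P z) <->
  exists2 e : R, 0 < e & forall z, z != 0 -> nrm z < e -> P z.
Proof.
rewrite /dnbhs -nearE near_withinE; split=> [/nbhs_ballP[e /= e0 eP]|[e e0 eP]].
  have eE := gt0_ReE e0.
  exists (complex.Re e); first by rewrite -gt0_real_complex -eE.
  move=> z z0 ze; apply: eP => //; rewrite /ball /= sub0r normrN nrmE eE.
  by rewrite ltcR.
apply/nbhs_ballP; exists e%:C%C => /=; first by rewrite gt0_real_complex.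
move=> z; rewrite /ball /= sub0r normrN nrmE ltcR => ze z0.
exact: eP.
Qed.

Lemma cvg_seqP (u : nat -> C) (l : C) :
  ((u : nat -> C^o) @ \oo --> (l : C^o)) <->
  forall e : R, 0 < e -> exists k, forall j, (k <= j)%N -> nrm (u j - l) < e.
Proof.
split=> [/cvgrPdist_lt ul e e0|ul].
  have /= := ul e%:C%C; rewrite gt0_real_complex => /(_ e0)[k _ kP].
  by exists k => j /kP /=; rewrite nrmE ltcR nrmB.
apply/cvgrPdist_lt => e e0.
have eE := gt0_ReE e0.
have [|k kP] := ul (complex.Re e); first by rewrite -gt0_real_complex -eE.
by exists k => // j /kP; rewrite nrmE eE ltcR nrmB.
Qed.

Lemma cvg_seq_unique (u : nat -> C) (l l' : C) :
  (u : nat -> C^o) @ \oo --> (l : C^o) -> (u : nat -> C^o) @ \oo --> (l' : C^o) -> l = l'.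
Proof. by move=> ul ul'; exact: (cvg_unique (@norm_hausdorff _ C^o) ul ul'). Qed.

Lemma half_exp_lt (e : R) : 0 < e -> exists k, forall j, (k <= j)%N -> 2^-1 ^+ j < e.
Proof.
move=> e0; have := @cvg_geometric R 1 2^-1.
rewrite ger0_norm ?invr_ge0 // invf_lt1 // ltr1n => /(_ erefl).
move/cvgrPdist_lt/(_ _ e0) => [k _ kP]; exists k => j /kP /=.
by rewrite sub0r normrN /geometric /= mul1r ger0_norm // exprn_ge0 // invr_ge0.
Qed.

Lemma Re_lip (x : C) : `|complex.Re x| <= nrm x.
Proof.
case: x => a b /=; rewrite -sqrtr_sqr ler_wsqrtr // lerDl sqr_ge0 //.
Qed.

Lemma Im_lip (x : C) : `|complex.Im x| <= nrm x.
Proof.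
case: x => a b /=; rewrite -sqrtr_sqr ler_wsqrtr // lerDr sqr_ge0 //.
Qed.

Lemma nrm_le_ReIm (x : C) : nrm x <= `|complex.Re x| + `|complex.Im x|.
Proof.
case: x => a b /=; rewrite -[leRHS]ger0_norm ?addr_ge0 // -sqrtr_sqr ler_wsqrtr //.
by rewrite sqrrD !real_normK ?num_real // -addrA lerD2l lerDr mulrn_wge0 ?mulr_ge0.
Qed.

(** Completeness, from that of the real line applied to real and imaginary
    parts. *)
Lemma complex_complete (u : nat -> C) :
  (forall e : R, 0 < e -> exists k, forall i j, (k <= i)%N -> (k <= j)%N ->
     nrm (u i - u j) < e) ->
  exists l : C, (u : nat -> C^o) @ \oo --> (l : C^o).
Proof.
move=> u_cauchy.
have proj_cvg (f : C -> R) : (forall x y, `|f x - f y| <= nrm (x - y)) ->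
    exists l, forall e, 0 < e -> exists k, forall j, (k <= j)%N -> `|f (u j) - l| < e.
  move=> f_lip; have : cauchy ((fun j => f (u j)) @ \oo).
    apply/cauchyP => e e0; have [k kP] := u_cauchy e e0.
    exists (f (u k)); exists k => // j /= kj; rewrite /ball /=.
    exact: le_lt_trans (f_lip _ _) (kP _ _ _ _).
  move/cauchy_cvg/cvg_ex => [l /cvgrPdist_lt lP]; exists l => e /lP[k _ kP].
  by exists k => j /kP; rewrite distrC.
have Re_sub_lip x y : `|complex.Re x - complex.Re y| <= nrm (x - y).
  by apply: le_trans (Re_lip _); rewrite raddfB.
have Im_sub_lip x y : `|complex.Im x - complex.Im y| <= nrm (x - y).
  by apply: le_trans (Im_lip _); rewrite raddfB.
have [a aP] := proj_cvg (@complex.Re R) Re_sub_lip.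
have [b bP] := proj_cvg (@complex.Im R) Im_sub_lip.
exists (a +i* b)%C; apply/cvg_seqP => e e0.
have [k kP] := aP _ (divr_gt0 e0 (ltr0n _ 2)).
have [l lP] := bP _ (divr_gt0 e0 (ltr0n _ 2)).
exists (maxn k l) => j; rewrite geq_max => /andP[/kP ka /lP lb].
apply: le_lt_trans (nrm_le_ReIm _) _; rewrite [ltRHS]splitr.
by apply: ltrD; case: (u j) ka lb.
Qed.

End complex_analysis.

Section convergent_series.
Context {R : realType}.
Local Notation C := R[i].
Local Notation nrm := (@ComplexField.Normc.normc R).
Implicit Types (a b : ps C) (z l : C) (B r : R).

Definition partial_sum a z k : C := \sum_(i < k) psc a i * z ^+ i.

Definition psum a z l : Prop := (partial_sum a z : nat -> C^o) @ \oo --> (l : C^o).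

Lemma psum_series a z l :
  (series (fun k => psc a k * z ^+ k : C^o) @ \oo --> (l : C^o)) <-> psum a z l.
Proof.
suff -> : series (fun k => psc a k * z ^+ k : C^o) = partial_sum a z by [].
by apply/funext => k; rewrite /series /= big_mkord.
Qed.

Lemma psum_unique a z l l' : psum a z l -> psum a z l' -> l = l'.
Proof. exact: cvg_seq_unique. Qed.

Lemma partial_sumS a z k : partial_sum a z k.+1 = partial_sum a z k + psc a k * z ^+ k.
Proof. exact: big_ord_recr. Qed.

(** The Cauchy estimates. *)
Definition geometric_bound a B r : Prop :=
  [/\ 0 < r, 0 <= B & forall k, nrm (psc a k) * r ^+ k <= B].

Lemma psum_geometric_bound a z l : psum a z l -> z != 0 ->
  exists B, geometric_bound a B (nrm z).
Proof.
move=> /cvg_seqP/(_ 1 ltr01)[k kP] z0.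
exists (2 + \sum_(i < k) nrm (psc a i * z ^+ i)); split.
- by rewrite nrm_gt0.
- by rewrite addr_ge0 // sumr_ge0 // => i _; apply: nrm_ge0.
move=> i; rewrite -nrmX -nrmM; have [ltik|leki] := ltnP i k.
  rewrite (bigD1 (Ordinal ltik)) //= addrCA lerDl addr_ge0 // sumr_ge0 // => j _.
  exact: nrm_ge0.
have -> : psc a i * z ^+ i = (partial_sum a z i.+1 - l) + (l - partial_sum a z i).
  by rewrite partial_sumS; ring.
apply: le_trans (nrmD _ _) _.
have := kP _ leki; have := kP _ (leqW leki); rewrite (nrmB l).
set x := nrm _; set y := nrm _; set s := \sum_(_ < _) _.
have : 0 <= s by apply: sumr_ge0 => j _; apply: nrm_ge0.
lra.
Qed.

Section bounded.
Variables (a : ps C) (B r : R).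
Hypothesis a_bnd : geometric_bound a B r.

Lemma geometric_term z k : nrm (psc a k * z ^+ k) <= B * (nrm z / r) ^+ k.
Proof.
have [r0 B0 aP] := a_bnd; rewrite nrmM nrmX expr_div_n mulrA ler_pdivlMr ?exprn_gt0 //.
by rewrite mulrAC ler_wpM2r // exprn_ge0 // nrm_ge0.
Qed.

Lemma half_ratio z : nrm z <= r / 2 -> 0 <= nrm z / r <= 2^-1.
Proof.
have [r0 _ _] := a_bnd => zr; rewrite divr_ge0 ?nrm_ge0 ?(ltW r0) //=.
by rewrite ler_pdivrMr // mulrC.
Qed.

Lemma geometric_tail z m k : nrm z <= r / 2 -> (m <= k)%N ->
  nrm (partial_sum a z k - partial_sum a z m) <= 2 * B * (nrm z / r) ^+ m.
Proof.
have [r0 B0 _] := a_bnd; move=> /half_ratio/andP[q0 q2]; set q := nrm z / r in q0 q2 *.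
have qm0 : 0 <= B * q ^+ m by rewrite mulr_ge0 // exprn_ge0.
move=> /subnKC <-; apply: (@le_trans _ _ (B * q ^+ m * (2 - 2 * 2^-1 ^+ (k - m)))).
  elim: (k - m)%N => [|i IHi].
    by rewrite addn0 subrr expr0 mulr1 subrr mulr0 ComplexField.Normc.normc0.
  rewrite addnS partial_sumS addrAC; apply: le_trans (nrmD _ _) _.
  have := geometric_term z (m + i); rewrite -/q [q ^+ (m + i)]exprD mulrA.
  have : B * q ^+ m * q ^+ i <= B * q ^+ m * 2^-1 ^+ i.
    by rewrite ler_wpM2l // lerXn2r // nnegrE invr_ge0.
  move: IHi; rewrite exprS; set x := nrm _; set y := nrm _; set w := B * q ^+ m.
  set h := 2^-1 ^+ i; set v := q ^+ i; move: x y w h v => x y w h v h1 h2 h3; lra.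
have -> : 2 * B * q ^+ m = B * q ^+ m * 2 by ring.
by rewrite ler_wpM2l // lerBlDl lerDr mulr_ge0 // exprn_ge0 // invr_ge0.
Qed.

Lemma psum_tail z l m : nrm z <= r / 2 -> psum a z l ->
  nrm (l - partial_sum a z m) <= 2 * B * (nrm z / r) ^+ m.
Proof.
move=> zr /cvg_seqP az; apply/ler_addgt0Pr => e /az[k kP].
have -> : l - partial_sum a z m = (l - partial_sum a z (maxn k m)) +
   (partial_sum a z (maxn k m) - partial_sum a z m) by ring.
apply: le_trans (nrmD _ _) _; rewrite addrC lerD ?geometric_tail ?leq_maxr //.
by rewrite nrmB ltW // kP ?leq_maxl.
Qed.

Lemma psum_exists z : nrm z <= r / 2 -> exists l, psum a z l.
Proof.
have [r0 B0 _] := a_bnd; move=> zr; apply: complex_complete => e e0.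
have [k kP] := half_exp_lt (divr_gt0 e0 (ltr_wpDl (mulr_ge0 (ler0n _ 4) B0) ltr01)).
exists k => i j ki kj.
have -> : partial_sum a z i - partial_sum a z j = (partial_sum a z i - partial_sum a z k) +
  - (partial_sum a z j - partial_sum a z k) by ring.
apply: le_lt_trans (nrmD _ _) _; rewrite nrmN.
have := geometric_tail zr ki; have := geometric_tail zr kj.
have /andP[q0 q2] := half_ratio zr.
have : (nrm z / r) ^+ k <= 2^-1 ^+ k by rewrite lerXn2r // nnegrE invr_ge0.
have := kP _ (leqnn k); rewrite ltr_pdivlMr ?ltr_wpDl ?mulr_ge0 //.
have : 0 <= 2^-1 ^+ k :> R by rewrite exprn_ge0 // invr_ge0.
set x := nrm _; set y := nrm _; set h := 2^-1 ^+ k; set v := _ ^+ k; nra.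
Qed.

Lemma psum_leading m z l : (forall i, (i < m)%N -> psc a i = 0) ->
  nrm z <= r / 2 -> psum a z l ->
  nrm (l - psc a m * z ^+ m) <= 2 * B * (nrm z / r) ^+ m.+1.
Proof.
move=> a_m zr az; have := psum_tail m.+1 zr az; rewrite partial_sumS.
suff -> : partial_sum a z m = 0 by rewrite add0r.
by apply: big1 => i _; rewrite a_m ?mul0r.
Qed.

End bounded.

(** Close to the origin the first nonzero term dominates the others. *)
Lemma psum_neq0 a B r : geometric_bound a B r -> a != 0 ->
  exists2 e : R, 0 < e & forall z l, z != 0 -> nrm z < e -> psum a z l -> l != 0.
Proof.
move=> a_bnd /ps_order[m [am a_m]]; have [r0 B0 _] := a_bnd.
have am0 : 0 < nrm (psc a m) by rewrite nrm_gt0.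
pose e := Num.min (r / 2) (nrm (psc a m) * r ^+ m.+1 / (2 * B + 1)).
have B1 : 0 < 2 * B + 1 by rewrite ltr_wpDl // mulr_ge0.
exists e; first by rewrite lt_min !divr_gt0 // mulr_gt0 // exprn_gt0.
move=> z l z0; rewrite lt_min => /andP[/ltW zr]; rewrite ltr_pdivlMr // => ze az.
apply: contraTneq ze => l0; rewrite -leNgt.
have := psum_leading a_bnd a_m zr az; rewrite l0 sub0r nrmN nrmM nrmX.
rewrite expr_div_n mulrA ler_pdivlMr ?exprn_gt0 // [nrm z ^+ m.+1]exprSr mulrA.
rewrite mulrAC [leRHS]mulrAC ler_pM2r ?exprn_gt0 ?nrm_gt0 // => /le_trans; apply.
by rewrite mulrC ler_wpM2l ?nrm_ge0 // lerDl.
Qed.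

Lemma psum_cst c z : psum (psC c) z c.
Proof.
apply/cvg_seqP => e e0; exists 1%N => -[//|k] _.
rewrite /partial_sum big_ord_recl big1 /= => [|i _]; last by rewrite mul0r.
by rewrite mulr1 addr0 subrr ComplexField.Normc.normc0.
Qed.

Lemma psumB a b z l l' : psum a z l -> psum b z l' -> psum (a - b) z (l - l').
Proof.
move=> al bl; rewrite /psum.
suff -> : partial_sum (a - b) z = (partial_sum a z : nat -> C^o) \- partial_sum b z.
  exact: cvgB al bl.
apply/funext => k /=; rewrite /partial_sum -sumrB; apply: eq_bigr => i _.
by rewrite /= -mulrBl.
Qed.

Lemma partial_sum_mulX a z k : partial_sum (psX * a) z k.+1 = z * partial_sum a z k.
Proof.
rewrite /partial_sum big_ord_recl.
have XE i : psc (psX * a) i = if (i < 1)%N then 0 else psc a (i - 1).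
  by rewrite -[psX]expr1 psc_mulXn.
rewrite XE mul0r add0r mulr_sumr; apply: eq_bigr => i _.
by rewrite XE /= subn1 /= exprS; ring.
Qed.

Lemma psum_mulX a z l : psum a z l -> psum (psX * a) z (z * l).
Proof.
move=> /cvg_seqP al; apply/cvg_seqP => e e0.
have z1 : 0 < nrm z + 1 by rewrite ltr_wpDl // nrm_ge0.
have [k kP] := al _ (divr_gt0 e0 z1); exists k.+1 => -[//|j] /kP.
rewrite partial_sum_mulX -mulrBr nrmM ltr_pdivlMr // => h; apply: le_lt_trans h.
by rewrite mulrC ler_wpM2l ?nrm_ge0 // lerDl.
Qed.

Lemma psum_divX a z l : z != 0 -> psum (psX * a) z (z * l) -> psum a z l.
Proof.
move=> z0 /cvg_seqP al; have nz : 0 < nrm z by rewrite nrm_gt0.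
apply/cvg_seqP => e e0; have [k kP] := al _ (mulr_gt0 nz e0).
exists k => j /leqW/kP; rewrite partial_sum_mulX -mulrBr nrmM.
by rewrite ltr_pM2l.
Qed.

Lemma psum_mulXn a z l k : psum a z l -> psum (psX ^+ k * a) z (z ^+ k * l).
Proof.
move=> al; elim: k => [|k IHk]; first by rewrite !expr0 !mul1r.
by rewrite !exprS -!mulrA; apply: psum_mulX.
Qed.

Lemma partial_sum_mul a b z k :
  partial_sum (a * b) z k = \sum_(i < k) psc a i * z ^+ i * partial_sum b z (k - i).
Proof.
elim: k => [|k IHk]; first by rewrite /partial_sum !big_ord0.
rewrite partial_sumS IHk pscM !big_ord_recr /= subSnn subnn mulrDl addrA.
congr (_ + _); last first.
  by rewrite /partial_sum big_ord_recl big_ord0 /= expr0; ring.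
rewrite mulr_suml -big_split; apply: eq_bigr => i _ /=.
have ik : (i <= k)%N by exact: ltnW.
have -> : z ^+ k = z ^+ i * z ^+ (k - i) by rewrite -exprD subnKC.
rewrite subSn // partial_sumS.
move: (psc a i) (psc b _) (z ^+ i) (z ^+ (k - i)) (partial_sum _ _ _) => x y u v w.
by rewrite mulrDr mulrACA !mulrA [x * u * y]mulrAC.
Qed.

(** Up to a constant factor, the partial sums of order [k] of the product differ
    from the products of the partial sums by [k q ^ k], where [q < 1]. *)
Lemma psumM a b z l l' B B' r : geometric_bound a B r -> geometric_bound b B' r ->
  nrm z <= r / 4 -> psum a z l -> psum b z l' -> psum (a * b) z (l * l').
Proof.
move=> a_bnd b_bnd zr4 al bl; have [r0 B0 _] := a_bnd; have [_ B'0 _] := b_bnd.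
have zr : nrm z <= r / 2 by lra.
have diff_le k : nrm (partial_sum a z k * partial_sum b z k - partial_sum (a * b) z k)
    <= 2 * B * B' * 2^-1 ^+ k.
  rewrite partial_sum_mul /partial_sum mulr_suml -sumrB.
  apply: le_trans (nrm_sum _ _ _) _.
  apply: (@le_trans _ _ (\sum_(i < k) 2 * B * B' * 4^-1 ^+ k)).
    apply: ler_sum => i _; rewrite -mulrBr nrmM.
    have ik : (k - i <= k)%N by exact: leq_subr.
    have := geometric_tail b_bnd zr ik; have := geometric_term a_bnd z i.
    rewrite -!/(partial_sum _ _ _); set q := nrm z / r.
    have q0 : 0 <= q by rewrite divr_ge0 ?nrm_ge0 // ltW.
    have q4 : q ^+ k <= 4^-1 ^+ k.
      by rewrite lerXn2r ?nnegrE ?invr_ge0 // ler_pdivrMr // mulrC.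
    move=> t1 t2; apply: le_trans (ler_pM (nrm_ge0 _) (nrm_ge0 _) t1 t2) _.
    have -> : B * q ^+ i * (2 * B' * q ^+ (k - i)) = 2 * B * B' * (q ^+ i * q ^+ (k - i)) by ring.
    by rewrite -exprD subnKC ?(ltnW (ltn_ord i)) // ler_wpM2l ?mulr_ge0.
  rewrite sumr_const card_ord -[_ *+ k]mulr_natr -[leLHS]mulrA ler_wpM2l ?mulr_ge0 //.
  have k2 : k%:R <= 2 ^+ k :> R by rewrite -natrX ler_nat ltnW // ltn_expl.
  have -> : 4^-1 = 2^-1 * 2^-1 :> R by rewrite -invfM -natrM.
  rewrite exprMn -mulrA ler_piMr ?exprn_ge0 ?invr_ge0 // exprVn.
  by rewrite mulrC ler_pdivrMr ?exprn_gt0 // mul1r.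
have prod_cvg : (fun k => partial_sum a z k * partial_sum b z k : C^o) @ \oo --> (l * l' : C^o).
  exact: cvgM al bl.
move/cvg_seqP: prod_cvg => prod_cvg; apply/cvg_seqP => e e0.
have [k kP] := prod_cvg _ (divr_gt0 e0 (ltr0n _ 2)).
have BB : 0 < 2 * B * B' + 1 by rewrite ltr_wpDl // !mulr_ge0.
have [j jP] := half_exp_lt (divr_gt0 (divr_gt0 e0 (ltr0n _ 2)) BB).
exists (maxn k j) => i; rewrite geq_max => /andP[/kP ki /jP].
rewrite ltr_pdivlMr // => ji.
have -> : partial_sum (a * b) z i - l * l' =
   (partial_sum a z i * partial_sum b z i - l * l') -
   (partial_sum a z i * partial_sum b z i - partial_sum (a * b) z i) by ring.
apply: le_lt_trans (nrmD _ _) _; rewrite nrmN [ltRHS]splitr; apply: ltrD => //.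
apply: le_lt_trans (diff_le i) _; apply: le_lt_trans ji.
by rewrite mulrC ler_wpM2l ?lerDl // exprn_ge0 // invr_ge0.
Qed.

Lemma geometric_bound_le a B r r' : geometric_bound a B r -> 0 < r' -> r' <= r ->
  geometric_bound a B r'.
Proof.
move=> [r0 B0 aP] r'0 rr'; split=> // k; apply: le_trans (aP k).
by rewrite ler_wpM2l ?nrm_ge0 //; apply: lerXn2r => //; rewrite nnegrE ltW.
Qed.

End convergent_series.

Section series_derivative.
Context {R : realType}.
Local Notation C := R[i].
Local Notation nrm := (@ComplexField.Normc.normc R).
Implicit Types (a b : ps C) (z w l : C) (B r : R).

Lemma nrm_real (x : R) : nrm x%:C%C = `|x|.
Proof. by rewrite /= expr0n addr0 sqrtr_sqr. Qed.

Lemma exists_small (e : R) : 0 < e -> exists z : C, z != 0 /\ nrm z < e.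
Proof.
move=> e0; have e2 : 0 < e / 2 by rewrite divr_gt0.
exists (e / 2)%:C%C; split; first by apply: lt0r_neq0; rewrite gt0_real_complex.
by rewrite nrm_real gtr0_norm // ltr_pdivrMr // ltr_pMr // ltr1n.
Qed.

Lemma cvg_seq_shift (u : nat -> C) (l : C) :
  (u : nat -> C^o) @ \oo --> (l : C^o) -> (fun k => u k.+1 : C^o) @ \oo --> (l : C^o).
Proof.
move=> /cvg_seqP ul; apply/cvg_seqP => e /ul[k kP].
by exists k => j kj; apply: kP; exact: leqW.
Qed.

Lemma cvg_seq_nrm_le (u : nat -> C) (l : C) B :
  (u : nat -> C^o) @ \oo --> (l : C^o) -> (forall k, nrm (u k) <= B) -> nrm l <= B.
Proof.
move=> /cvg_seqP ul uB; apply/ler_addgt0Pr => e /ul[k /(_ k (leqnn k)) kP].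
have -> : l = u k - (u k - l) by ring.
by apply: le_trans (nrmD _ _) _; rewrite nrmN lerD // ltW.
Qed.

Lemma exp_diff_le (s : R) z w k : nrm z <= s -> nrm w <= s ->
  s * nrm (w ^+ k - z ^+ k) <= k%:R * s ^+ k * nrm (w - z).
Proof.
move=> zs ws; have s0 : 0 <= s by exact: le_trans (nrm_ge0 z) zs.
elim: k => [|k IHk].
  by rewrite !expr0 subrr ComplexField.Normc.normc0 mulr0 mul0r mul0r.
have -> : w ^+ k.+1 - z ^+ k.+1 = w * (w ^+ k - z ^+ k) + z ^+ k * (w - z).
  by rewrite !exprS; ring.
apply: le_trans (ler_wpM2l s0 (nrmD _ _)) _; rewrite mulrDr !nrmM nrmX.
have : nrm w * (s * nrm (w ^+ k - z ^+ k)) <= s * (k%:R * s ^+ k * nrm (w - z)).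
  by apply: ler_pM => //; rewrite ?nrm_ge0 ?mulr_ge0 ?nrm_ge0.
have : s * (nrm z ^+ k * nrm (w - z)) <= s * (s ^+ k * nrm (w - z)).
  by rewrite ler_wpM2l // ler_wpM2r ?nrm_ge0 // lerXn2r ?nnegrE ?nrm_ge0.
rewrite -natr1 exprS; move: (nrm (w - z)) (s ^+ k) (nrm z ^+ k) (nrm w) (nrm _).
by move=> x y t u v h1 h2; lra.
Qed.

Definition dpow z k : C := if k is j.+1 then j.+1%:R * z ^+ j else 0.

Lemma exp_quadratic_le (s : R) z w k : nrm z <= s -> nrm w <= s ->
  s ^+ 2 * nrm (w ^+ k - z ^+ k - (w - z) * dpow z k) <=
  k%:R ^+ 2 * s ^+ k * nrm (w - z) ^+ 2.
Proof.
move=> zs ws; have s0 : 0 <= s by exact: le_trans (nrm_ge0 z) zs.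
elim: k => [|k IHk].
  by rewrite !expr0 subrr mulr0 subrr ComplexField.Normc.normc0 mulr0 expr0n /= !mul0r.
have zd : z * dpow z k = k%:R * z ^+ k.
  by case: (k) => [|j]; rewrite /= ?mul0r ?mulr0 // exprS; ring.
have -> : w ^+ k.+1 - z ^+ k.+1 - (w - z) * dpow z k.+1 =
    z * (w ^+ k - z ^+ k - (w - z) * dpow z k) + (w - z) * (w ^+ k - z ^+ k).
  by rewrite mulrBr [z * (_ * dpow z k)]mulrCA zd !exprS /= -natr1; ring.
apply: le_trans (ler_wpM2l (exprn_ge0 2 s0) (nrmD _ _)) _; rewrite mulrDr !nrmM.
have := exp_diff_le k zs ws; set d := nrm (w - z) in IHk *.
set x := nrm (_ - _ - _) in IHk *; set y := nrm (_ - _) => Hy.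
have d0 : 0 <= d by exact: nrm_ge0.
have : nrm z * (s ^+ 2 * x) <= s * (k%:R ^+ 2 * s ^+ k * d ^+ 2).
  by apply: ler_pM; rewrite ?nrm_ge0 ?mulr_ge0 ?exprn_ge0 ?nrm_ge0.
have : s * d * (s * y) <= s * d * (k%:R * s ^+ k * d).
  by rewrite ler_wpM2l // mulr_ge0.
have k0 : 0 <= k%:R :> R by exact: ler0n.
have sk0 : 0 <= s ^+ k by exact: exprn_ge0.
have : 0 <= (k%:R + 1) * (s * s ^+ k * d ^+ 2) by rewrite !mulr_ge0 ?addr_ge0 ?exprn_ge0.
rewrite -natr1 [s ^+ k.+1]exprS; move: (s ^+ k) (k%:R) (nrm z) => t m u h1 h2 h3.
by rewrite sqrrD expr1n mulr1 mulr2n; lra.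
Qed.

Lemma partial_sum_deriv a z k :
  partial_sum (psderiv a) z k = \sum_(i < k.+1) psc a i * dpow z i.
Proof.
rewrite big_ord_recl /= mulr0 add0r; apply: eq_bigr => i _.
by rewrite /= -mulr_natl; ring.
Qed.

Lemma geometric_bound_deriv a B r : geometric_bound a B r ->
  geometric_bound (psderiv a) (B / r) (r / 2).
Proof.
move=> [r0 B0 aP]; split; [exact: divr_gt0 | by rewrite divr_ge0 // ltW | move=> k].
rewrite ler_pdivlMr //= -[_ *+ k.+1]mulr_natl nrmM nrm_nat; apply: le_trans (aP k.+1).
rewrite exprS expr_div_n.
have k2 : k.+1%:R / 2 ^+ k <= 1 :> R.
  by rewrite ler_pdivrMr ?exprn_gt0 // mul1r -natrX ler_nat ltn_expl.
have x0 : 0 <= nrm (psc a k.+1) * (r * r ^+ k).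
  by rewrite !mulr_ge0 ?nrm_ge0 ?exprn_ge0 // ltW.
have -> : k.+1%:R * nrm (psc a k.+1) * (r ^+ k / 2 ^+ k) * r =
  k.+1%:R / 2 ^+ k * (nrm (psc a k.+1) * (r * r ^+ k)) by ring.
by rewrite -[leRHS]mul1r ler_wpM2r.
Qed.

(** The factor [k ^ 2] in the bound for monomials is absorbed by taking [z] and
    [w] in a disc of radius [r / 8]. *)
Lemma psum_quadratic a B r z w lz lw g : geometric_bound a B r ->
  nrm z <= r / 8 -> nrm w <= r / 8 -> psum a z lz -> psum a w lw ->
  psum (psderiv a) z g ->
  nrm (lw - lz - (w - z) * g) <= 2 * B / (r / 8) ^+ 2 * nrm (w - z) ^+ 2.
Proof.
move=> [r0 B0 aP] zs ws az aw a'z; set s := r / 8 in zs ws *.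
have s0 : 0 < s by rewrite divr_gt0.
pose u k := partial_sum a w k.+1 - partial_sum a z k.+1 -
  (w - z) * partial_sum (psderiv a) z k.
apply: (@cvg_seq_nrm_le u) => [|k].
  apply: (@cvgB _ C^o) (@cvgB _ C^o _ _ _ _ _ _ _ _ _) _.
  - exact: cvg_seq_shift aw.
  - exact: cvg_seq_shift az.
  - by apply: cvgM a'z; exact: cvg_cst.
rewrite /u partial_sum_deriv /partial_sum mulr_sumr -!sumrB.
apply: le_trans (nrm_sum _ _ _) _.
set d := nrm (w - z); have d0 : 0 <= d by exact: nrm_ge0.
apply: (@le_trans _ _ (\sum_(i < k.+1) B / s ^+ 2 * d ^+ 2 * 2^-1 ^+ i)).
  apply: ler_sum => i _.
  have -> : psc a i * w ^+ i - psc a i * z ^+ i - (w - z) * (psc a i * dpow z i) =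
     psc a i * (w ^+ i - z ^+ i - (w - z) * dpow z i) by ring.
  rewrite nrmM; have := exp_quadratic_le i zs ws; rewrite -/d.
  set x := nrm (_ - _) => Hx.
  have i2 : i%:R ^+ 2 * s ^+ i <= (r / 2) ^+ i.
    have -> : (r / 2) ^+ i = (2 ^+ i) ^+ 2 * s ^+ i.
      by rewrite -exprM mulnC exprM -exprMn; congr (_ ^+ _); rewrite /s; field.
    rewrite ler_wpM2r ?exprn_ge0 ?(ltW s0) // lerXn2r ?nnegrE ?ler0n ?exprn_ge0 //.
    by rewrite -natrX ler_nat ltnW // ltn_expl.
  have s20 : 0 < s ^+ 2 by exact: exprn_gt0.
  have {Hx i2} Hx : x <= (r / 2) ^+ i * d ^+ 2 / s ^+ 2.
    rewrite ler_pdivlMr // mulrC; apply: le_trans Hx _.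
    by rewrite ler_wpM2r ?exprn_ge0.
  apply: le_trans (ler_wpM2l (nrm_ge0 _) Hx) _.
  have -> : nrm (psc a i) * ((r / 2) ^+ i * d ^+ 2 / s ^+ 2) =
     nrm (psc a i) * r ^+ i * (d ^+ 2 / s ^+ 2 * 2^-1 ^+ i).
    by rewrite expr_div_n exprVn; ring.
  have -> : B / s ^+ 2 * d ^+ 2 * 2^-1 ^+ i = B * (d ^+ 2 / s ^+ 2 * 2^-1 ^+ i) by ring.
  apply: ler_wpM2r (aP i).
  by rewrite !mulr_ge0 ?exprn_ge0 ?invr_ge0 // exprn_ge0 // ltW.
rewrite -mulr_sumr.
have -> : 2 * B / s ^+ 2 * d ^+ 2 = B / s ^+ 2 * d ^+ 2 * 2 by ring.
rewrite ler_wpM2l //.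
  by rewrite !mulr_ge0 ?invr_ge0 ?exprn_ge0 // ltW.
have half_sum j : \sum_(i < j) 2^-1 ^+ i = 2 - 2 * 2^-1 ^+ j :> R.
  elim: j => [|j IHj]; first by rewrite big_ord0 expr0 mulr1 subrr.
  by rewrite big_ord_recr /= IHj exprS; field.
by rewrite half_sum lerBlDl lerDr mulr_ge0 // exprn_ge0 // invr_ge0.
Qed.

(** Term by term differentiation, by the bound of [psum_quadratic] on the error
    of the linear approximation. *)
Lemma psum_is_derive a (F : C -> C) :
  (exists2 e : R, 0 < e & forall z, z != 0 -> nrm z < e -> psum a z (F z)) ->
  exists2 e : R, 0 < e & forall z, z != 0 -> nrm z < e ->
    exists2 g, psum (psderiv a) z g & is_derive (z : C^o) (1 : C^o) (F : C^o -> C^o) (g : C^o).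
Proof.
move=> [e e0 aF].
have [z1 [z1_neq0 z1_e]] := exists_small e0.
have [B a_bnd] := psum_geometric_bound (aF _ z1_neq0 z1_e) z1_neq0.
set r := nrm z1 in a_bnd; have [r0 B0 _] := a_bnd.
exists (Num.min e (r / 8)); first by rewrite lt_min e0 divr_gt0.
move=> z z0; rewrite lt_min => /andP[ze zr].
have [g a'g] : exists g, psum (psderiv a) z g.
  by apply: (psum_exists (geometric_bound_deriv a_bnd)); lra.
exists g; first exact: a'g.
pose K := 2 * B / (r / 8) ^+ 2.
have K0 : 0 <= K by rewrite !mulr_ge0 // invr_ge0 exprn_ge0 // divr_ge0 // ltW.
have F_cvg : (fun h : C => h^-1 *: (((F : C^o -> C^o) \o shift (z : C^o))
    (h *: (1 : C^o)) - (F z : C^o))) @ (0 : C^o)^' --> (g : C^o).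
  apply/cvgrPdist_lt => eps eps0; rewrite (gt0_ReE eps0).
  have eps'0 : 0 < complex.Re eps by rewrite -gt0_real_complex -gt0_ReE.
  move: (complex.Re eps) eps'0 => {eps0}{}eps eps0.
  apply/near_puncturedP.
  exists (Num.min (Num.min (nrm z) (eps / (K + 1))) (Num.min (e - nrm z) (r / 8 - nrm z))).
    rewrite !lt_min nrm_gt0 z0 divr_gt0 ?(ltr_wpDl K0 ltr01) //=.
    by apply/andP; split; rewrite subr_gt0.
  move=> h h0; rewrite !lt_min => /andP[/andP[hz heps] /andP[he hr]].
  rewrite /= -[h *: 1]/(h * 1) mulr1 nrmE ltcR.
  have w0 : h + z != 0.
    apply: contraTneq hz => /eqP; rewrite addr_eq0 => /eqP ->.
    by rewrite nrmN ltxx.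
  have we : nrm (h + z) < e by apply: le_lt_trans (nrmD _ _) _; lra.
  have wr : nrm (h + z) <= r / 8 by apply: le_trans (nrmD _ _) _; lra.
  have := psum_quadratic a_bnd (ltW zr) wr (aF _ z0 ze) (aF _ w0 we) a'g.
  rewrite addrK -/K => quad.
  have -> : g - h^-1 *: (F (h + z) - F z) = - (h^-1 * (F (h + z) - F z - h * g)).
    by rewrite [in RHS]mulrBr mulKf // opprB.
  rewrite nrmN nrmM ComplexField.Normc.normcV.
  have nh : 0 < nrm h by rewrite nrm_gt0.
  rewrite mulrC ltr_pdivrMr //; apply: le_lt_trans quad _.
  rewrite expr2 mulrA ltr_pM2r //; apply: (@le_lt_trans _ _ ((K + 1) * nrm h)).
    by rewrite ler_wpM2r ?(ltW nh) // lerDl.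
  by rewrite mulrC -ltr_pdivlMr // ltr_wpDl.
apply: DeriveDef; first by apply/cvg_ex; exists (g : C^o).
exact: cvg_lim F_cvg.
Qed.

End series_derivative.

(** * Laurent expansions *)

Lemma is_derive_comp_num (K : numFieldType) (phi G : K^o -> K^o) (x dphi dG : K^o) :
  is_derive x (1:K^o) phi dphi -> is_derive (phi x) (1:K^o) G dG ->
  derive1 (fun w : K => G (phi w)) x = dG * dphi.
Proof.
move=> [/derivable1_diffP df dfE] [/derivable1_diffP dg dgE].
have dGphi : differentiable (G \o phi) x by exact: differentiable_comp.
transitivity ('d (G \o phi) x (1 : K^o)).
  by rewrite derive1E deriveE.
have dphiE : 'd phi x (1 : K^o) = dphi *: (1 : K^o).
  by rewrite -deriveE // dfE -[RHS]/(dphi * 1) mulr1.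
transitivity ('d G (phi x) ('d phi x (1 : K^o))).
  exact: (congr1 (fun u : K^o -> K^o => u (1 : K^o)) (diff_comp df dg)).
transitivity ('d G (phi x) (dphi *: (1 : K^o))); first exact: congr1 dphiE.
rewrite linearZ /= -deriveE // dgE.
exact: mulrC.
Qed.

Lemma near_eq_derive1 (K : numFieldType) (f g : K -> K^o) (x : K) :
  (\forall y \near (x : K^o), f y = g y) -> derive1 f x = derive1 g x.
Proof. by move=> fg; rewrite !derive1E; apply: near_eq_derive. Qed.

Section laurent_expansions.
Context {R : realType}.
Local Notation C := R[i].
Local Notation nrm := (@ComplexField.Normc.normc R).
Local Notation fct := (CP1 R -> C).
Implicit Types (f g : fct) (p q : CP1 R) (A B : ps C).

Definition laurent f p N A : Prop :=
  \forall z \near (0 : C^o)^', psum A z (z ^+ N * f (chart p z)).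

Lemma laurent_atP f p N (a : nat -> C) : laurent_at f p N a <-> laurent f p N (Ps a).
Proof.
by split; apply: filterS => z; [move/(psum_series (Ps a)) | move=> ?; apply/(psum_series (Ps a))].
Qed.

Lemma near_nonempty (P : C -> Prop) : (\forall z \near (0 : C^o)^', P z) ->
  exists z, z != 0 /\ P z.
Proof.
move=> /near_puncturedP[e /exists_small[z [z0 ze]] eP].
by exists z; split=> //; apply: eP.
Qed.

Lemma near_neq0 : \forall z \near (0 : C^o)^', z != 0 :> C.
Proof. by apply/near_puncturedP; exists 1. Qed.

Lemma near_small (e : R) : 0 < e -> \forall z \near (0 : C^o)^', nrm z < e.
Proof. by move=> e0; apply/near_puncturedP; exists e. Qed.

Lemma laurent_near f g p N A : laurent f p N A ->
  (\forall z \near (0 : C^o)^', f (chart p z) = g (chart p z)) -> laurent g p N A.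
Proof. by move=> Af fg; move: Af fg; apply: filterS2 => z + <-. Qed.

Lemma laurent_shift f p N k A : laurent f p N A -> laurent f p (N + k) (psX ^+ k * A).
Proof.
by apply: filterS => z /(@psum_mulXn _ _ _ _ k); rewrite mulrA -exprD addnC.
Qed.

Lemma laurent_bound f p N A : laurent f p N A -> exists b r : R, geometric_bound A b r.
Proof.
move=> /near_nonempty[z [z0 Az]]; have [b bz] := psum_geometric_bound Az z0.
by exists b, (nrm z).
Qed.

Lemma laurentB f g p N A B : laurent f p N A -> laurent g p N B -> laurent (f - g) p N (A - B).
Proof.
move=> Af Bg; move: Af Bg; apply: filterS2 => z Af Bg.
have -> : z ^+ N * (f - g) (chart p z) = z ^+ N * f (chart p z) - z ^+ N * g (chart p z).
  by rewrite -mulrBr.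
exact: psumB.
Qed.

Lemma laurent_neq0 f p N A : laurent f p N A -> A != 0 ->
  \forall z \near (0 : C^o)^', f (chart p z) != 0.
Proof.
move=> Af A0; have [b [r AB]] := laurent_bound Af; have [e e0 eP] := psum_neq0 AB A0.
move: Af near_neq0 (near_small e0); apply: filterS3 => z Af z0 ze.
by have := eP _ _ z0 ze Af; apply: contraNneq => ->; rewrite mulr0.
Qed.

Lemma laurent_eq0 f p N : laurent f p N 0 -> \forall z \near (0 : C^o)^', f (chart p z) = 0.
Proof.
move=> f0; move: f0 near_neq0; apply: filterS2 => z f0 z0.
have /(psum_unique f0)/eqP : psum (0 : ps C) z 0 by exact: psum_cst.
by rewrite mulf_eq0 expf_eq0 (negPf z0) andbF => /eqP.
Qed.

Lemma laurent_unique f p N A B : laurent f p N A -> laurent f p N B -> A = B.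
Proof.
move=> Af Bf; apply/eqP; rewrite -subr_eq0; apply: contraT.
move=> /(laurent_neq0 (laurentB Af Bf))/near_nonempty[z [_ /eqP]]; case.
exact: subrr.
Qed.

Lemma laurentM f g p N M A B : laurent f p N A -> laurent g p M B -> laurent (f * g) p (N + M) (A * B).
Proof.
move=> Af Bg; have [BA [r Ar]] := laurent_bound Af; have [BB [r' Br']] := laurent_bound Bg.
have [r0 _ _] := Ar; have [r'0 _ _] := Br'; pose s := Num.min r r'.
have s0 : 0 < s by rewrite lt_min r0.
have As : geometric_bound A BA s by apply: (geometric_bound_le Ar) => //; rewrite ge_min lexx.
have Bs : geometric_bound B BB s by apply: (geometric_bound_le Br') => //; rewrite ge_min lexx orbT.
have s4 : 0 < s / 4 by rewrite divr_gt0.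
move: Af Bg (near_small s4); apply: filterS3 => z Af Bg zs.
have -> : z ^+ (N + M) * (f * g) (chart p z) =
    z ^+ N * f (chart p z) * (z ^+ M * g (chart p z)).
  by rewrite exprD mulrACA.
exact: (psumM As Bs (ltW zs) Af Bg).
Qed.

Lemma laurent_cst c p : laurent (cst c) p 0 (psC c).
Proof. by apply: filterE => z; rewrite expr0 mul1r; exact: psum_cst. Qed.

Lemma near_pointP (P : C -> Prop) (z : C) :
  (\forall w \near (z : C^o), P w) <->
  exists2 e : R, 0 < e & forall w, nrm (w - z) < e -> P w.
Proof.
rewrite -nbhs_nearE; split=> [/nbhs_ballP[e /= e0 eP]|[e e0 eP]].
  have eE := gt0_ReE e0.
  exists (complex.Re e); first by rewrite -gt0_real_complex -eE.
  move=> w we; apply: eP; rewrite /ball /= distrC nrmE eE.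
  by rewrite ltcR.
apply/nbhs_ballP; exists e%:C%C => /=; first by rewrite gt0_real_complex.
by move=> w; rewrite /ball /= distrC nrmE ltcR => /eP.
Qed.

(** The derivation [d/dx] is [d/dz] in the coordinate [z = x - a] and
    [- z ^ 2 d/dz] in the coordinate [z = 1 / x]. *)
Definition chart_factor p : ps C := if p is Some _ then 1 else - psX ^+ 2.

Lemma laurent_is_derive (G F : C -> C) N (z g : C) :
  z != 0 -> (forall w, w != 0 -> G w = (w ^+ N)^-1 * F w) ->
  is_derive (z : C^o) (1 : C^o) (F : C^o -> C^o) (g : C^o) ->
  is_derive (z : C^o) (1 : C^o) (G : C^o -> C^o)
    ((z * g - N%:R * F z) / z ^+ N.+1 : C^o).
Proof.
move=> z0 GF dF.
have zN : z ^+ N != 0 by rewrite expf_neq0.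
pose P : C^o -> C^o := fun w => w ^+ N.
have dP : is_derive (z : C^o) (1 : C^o) P ((N%:R * z ^+ N.-1) : C^o).
  have -> : P = (id : C^o -> C^o) ^+ N by apply/funext => w; rewrite exprfctE.
  by apply: is_derive_eq; exact: mulr1.
have dPV : is_derive (z : C^o) (1 : C^o) (fun w => (P w)^-1)
    (- (z ^+ N) ^- 2 * (N%:R * z ^+ N.-1) : C^o).
  apply: DeriveDef; first by apply: derivableV => //; case: dP.
  by rewrite deriveV //; case: dP => _ ->.
apply: (@near_eq_is_derive _ _ _ ((fun w => (P w)^-1 : C^o) * (F : C^o -> C^o))).
  apply/near_pointP; exists (nrm z); first by rewrite nrm_gt0.
  move=> w wz; rewrite GF //; apply: contraTneq wz => ->.
  by rewrite sub0r nrmN ltxx.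
apply: is_derive_eq.
rewrite -[_ *: _ + _]/((z ^+ N)^-1 * g + F z * (- (z ^+ N) ^- 2 * (N%:R * z ^+ N.-1))).
case: N zN {GF P dP dPV} => [|N] zN; first by rewrite expr0 expr1; field.
by rewrite /= ![z ^+ _.+1]exprS; field; rewrite z0 expf_neq0.
Qed.

Lemma chart_derive f p N (F : C -> C) (z g : C) : z != 0 ->
  (forall w, w != 0 -> f (chart p w) = (w ^+ N)^-1 * F w) ->
  is_derive (z : C^o) (1 : C^o) (F : C^o -> C^o) (g : C^o) ->
  ddx f (chart p z) = (z * g - N%:R * F z) / z ^+ N.+1 *
    (if p is Some _ then 1 else - z ^+ 2).
Proof.
move=> z0 fF dF.
have dG := @laurent_is_derive (fun w => f (chart p w)) F N z g z0 fF dF.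
case: p fF dG => [a|] fF dG /=.
  have phi_d : is_derive (a + z : C^o) (1 : C^o) (fun w : C^o => w - a : C^o) (1 : C^o).
    by apply: is_derive_eq; rewrite subr0.
  have := @is_derive_comp_num C (fun w => w - a) (fun w => f (Some (a + w))) (a + z) 1 _ phi_d.
  rewrite [a + z - a]addrC addKr => /(_ _ dG) <-.
  apply: (congr1 (fun h : C -> C^o => derive1 h (a + z))); apply/funext => w.
  by rewrite addrCA subrr addr0.
rewrite (negPf z0) /=.
have zV0 : z^-1 != 0 by rewrite invr_eq0.
have phi_d : is_derive (z^-1 : C^o) (1 : C^o) (fun w : C^o => w^-1 : C^o) (- z ^+ 2 : C^o).
  apply: DeriveDef; first exact: (@derivableV _ _ id).
  rewrite (@deriveV _ _ id) // derive_id /= -[LHS]/(- z^-1 ^- 2 * 1).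
  by rewrite mulr1 -exprVn invrK.
have := @is_derive_comp_num C (fun w => w^-1) (fun w => f (chart None w)) z^-1 _ _ phi_d.
rewrite invrK => /(_ _ dG) <-; apply: near_eq_derive1.
apply/near_pointP; exists (nrm z^-1); first by rewrite nrm_gt0.
move=> w wz; rewrite /= invr_eq0 invrK ifN //.
by apply: contraTneq wz => ->; rewrite sub0r nrmN ltxx.
Qed.

Lemma laurent_ddx f p N A : laurent f p N A ->
  laurent (ddx f) p N.+1 (chart_factor p * (psX * psderiv A - psC N%:R * A)).
Proof.
move=> Af; pose F z := z ^+ N * f (chart p z).
have fF w : w != 0 -> f (chart p w) = (w ^+ N)^-1 * F w.
  by move=> w0; rewrite /F mulKf // expf_neq0.
have [|e e0 eP] := @psum_is_derive _ A F; first exact/near_puncturedP.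
move: Af near_neq0 (near_small e0); apply: filterS3 => z Az z0 ze.
have [g Ag dF] := eP z z0 ze; rewrite (chart_derive z0 fF dF).
have psum_aux : psum (psX * psderiv A - psC N%:R * A) z (z * g - N%:R * F z).
  apply: psumB; first exact: psum_mulX.
  have -> : psC N%:R * A = A *+ N by rewrite rmorph_nat mulr_natl.
  have psum0 : psum (0 : ps C) z 0 by exact: psum_cst.
  rewrite mulr_natl; elim: (N) => [|k IHk]; first by rewrite !mulr0n.
  have -> : A *+ k.+1 = A *+ k - (0 - A) by rewrite mulrSr sub0r opprK.
  have -> : F z *+ k.+1 = F z *+ k - (0 - F z) by rewrite mulrSr sub0r opprK.
  exact: psumB IHk (psumB psum0 Az).
rewrite /chart_factor; move: psum_aux.
move: (psX * psderiv A - _) (z * g - _) => T t Tt.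
have zN : z ^+ N.+1 != 0 by rewrite expf_neq0.
have cancel_zN (u v : C) : z ^+ N.+1 * (u / z ^+ N.+1 * v) = u * v.
  by rewrite mulrA [_ * (u / _)]mulrC divfK.
rewrite cancel_zN.
case: (p) => [a|]; first by rewrite mul1r mulr1.
have -> : - psX ^+ 2 * T = 0 - psX ^+ 2 * T by rewrite sub0r mulNr.
have -> : t * - z ^+ 2 = 0 - z ^+ 2 * t by rewrite sub0r mulrN mulrC.
have psum0 : psum (0 : ps C) z 0 by exact: psum_cst.
exact: psumB psum0 (@psum_mulXn _ _ _ _ 2 Tt).
Qed.

Lemma closed_disc_closed (r : R) : closed ([set z | nrm z <= r] : set C^o).
Proof.
move=> z zr; rewrite /= leNgt; apply/negP => rz.
have e0 : 0 < nrm z - r by rewrite subr_gt0.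
have [|w [wr wz]] := zr [set w : C^o | nrm (w - z) < nrm z - r].
  by apply/near_pointP; exists (nrm z - r).
have : nrm z <= nrm (z - w) + nrm w by rewrite -[X in nrm X <= _](subrK w) nrmD.
by move: wr wz => /=; rewrite (nrmB w); lra.
Qed.

Lemma closed_disc_compact (r : R) : compact ([set z | nrm z <= r] : set C^o).
Proof.
pose I := `[- r, r]%classic; pose f (q : R * R) : C^o := (q.1 +i* q.2)%C.
have f_cont : continuous f.
  move=> q; apply/cvgrPdist_lt => e e0; rewrite (gt0_ReE e0).
  have {e0} : 0 < complex.Re e by rewrite -gt0_real_complex -gt0_ReE.
  move: (complex.Re e) => {}e e0; have e2 : 0 < e / 2 by rewrite divr_gt0.
  near=> q'; rewrite nrmE ltcR; apply: le_lt_trans (nrm_le_ReIm _) _.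
  rewrite [ltRHS]splitr; apply: ltrD; rewrite /f /=; near: q'.
    exact: (@cvgr_dist_lt _ _ _ _ _ fst q.1 cvg_fst _ e2).
  exact: (@cvgr_dist_lt _ _ _ _ _ snd q.2 cvg_snd _ e2).
apply: (@subclosed_compact C^o _ (f @` (I `*` I)) (closed_disc_closed (r := r))).
  apply: continuous_compact; first exact: continuous_subspaceT.
  by apply: compact_setX; exact: segment_compact.
move=> z /= zr; exists (complex.Re z, complex.Im z); last by case: (z).
have := le_trans (Re_lip z) zr; have := le_trans (Im_lip z) zr.
by rewrite !ler_norml /I /= !in_itv /=.
Unshelve. all: by end_near. Qed.

(** A property of the points close to [p] also holds for the points close to
    those that are close to [p]. At infinity this says that the closed discs
    are compact. *)
Lemma near_charts (P : CP1 R -> Prop) p :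
  (\forall z \near (0 : C^o)^', P (chart p z)) ->
  \forall q \near p, \forall z \near (0 : C^o)^', P (chart q z).
Proof.
case: p => [a|] /near_puncturedP[e e0 eP].
  rewrite /prop_near1 /= /nbhs /= /one_point_nbhs.
  apply/(near_pointP (fun b => \forall z \near (0 : C^o)^', P (chart (Some b) z)) a).
  exists e => // b ba; apply/near_puncturedP.
  have [->|ba0] := eqVneq b a; first by exists e.
  have ba1 : 0 < nrm (b - a) by rewrite nrm_gt0 subr_eq0.
  exists (Num.min (nrm (b - a)) (e - nrm (b - a))); first by rewrite lt_min ba1 subr_gt0.
  move=> z z0; rewrite lt_min => /andP[z1 z2].
  have := eP (b + z - a); rewrite /= addrCA subrr addr0; apply.
    apply: contraTneq z1 => /eqP; rewrite addrAC addr_eq0 => /eqP ->.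
    by rewrite nrmN ltxx.
  by rewrite addrAC; apply: le_lt_trans (nrmD _ _) _; lra.
have PM x : e^-1 < nrm x -> P (Some x).
  move=> xe; have x0 : x != 0.
    by apply: contraTneq xe => ->; rewrite ComplexField.Normc.normc0 -leNgt invr_ge0 ltW.
  have := eP x^-1; rewrite /= invr_eq0 invrK (negPf x0); apply.
    by rewrite ?invr_eq0.
  by rewrite ComplexField.Normc.normcV invf_plt // posrE nrm_gt0.
exists [set z : C^o | nrm z <= e^-1].
  by split; [exact: closed_disc_compact | exact: closed_disc_closed].
move=> _ [[b /= /negP b_e <-]|->]; last by apply/near_puncturedP; exists e.
rewrite -ltNge in b_e; apply/near_puncturedP.
exists (nrm b - e^-1); first by rewrite subr_gt0.
move=> z z0 zb; apply: PM.
have : nrm b <= nrm (b + z) + nrm z.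
  by rewrite -[X in nrm X <= _](addrK z) -[nrm z]nrmN nrmD.
lra.
Qed.

(** The points near which [f] vanishes and those near which it has no zero form
    two open sets, and expansions leave no third possibility. *)
Lemma identity_theorem (U : set (CP1 R)) f p :
  open U -> connected U -> (forall q, U q -> meromorphic_at f q) -> U p ->
  (\forall z \near (0 : C^o)^', f (chart p z) = 0) -> mero_eq U f (cst 0).
Proof.
move=> U_open U_conn f_mero Up fp.
pose Z := [set q | \forall z \near (0 : C^o)^', f (chart q z) = 0].
pose NZ := [set q | \forall z \near (0 : C^o)^', f (chart q z) != 0].
have Z_open : open Z.
  by rewrite openE => q Zq; exact: (@near_charts (fun x => f x = 0) q Zq).
have NZ_open : open NZ.
  by rewrite openE => q Zq; exact: (@near_charts (fun x => f x != 0) q Zq).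
have dichotomy q : U q -> Z q \/ NZ q.
  move=> /f_mero[N [a /laurent_atP fa]].
  have [a0|a0] := eqVneq (Ps a) 0; last by right; exact: laurent_neq0 fa a0.
  by left; rewrite a0 in fa; exact: laurent_eq0 fa.
have ZNZ q : Z q -> NZ q -> False.
  move=> Zq NZq; have : \forall z \near (0 : C^o)^', False.
    by move: Zq NZq; apply: filterS2 => z ->; rewrite eqxx.
  by move=> /near_nonempty[z []].
suff UZ : U `&` Z = U by move=> q; rewrite -{1}UZ => -[_].
apply: U_conn; first by exists p.
  by exists Z.
exists (~` NZ); first exact: open_closedC.
apply/seteqP; split=> q [Uq].
  by move=> Zq; split=> // NZq; exact: ZNZ Zq NZq.
by move=> NZq; split=> //; case: (dichotomy q Uq).
Qed.

End laurent_expansions.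

(** * Algebraic representations of the complex linear group *)

(** If all classes of a countable partition of the reals were finite, the unit
    interval would be countable and of measure zero. *)
Lemma complex_uncountable (R : realType) : uncountable_like R[i].
Proof.
move=> g; apply: contrapT => /forallNP no_k.
pose fib k : set R := [set x | g x%:C%C = k].
have fib_fin k : finite_set (fib k).
  apply: contrapT => /infiniteP/pcard_leP[f].
  apply: (no_k k) => t; exists (fun i : 'I_t => (f i)%:C%C); split.
    move=> i j /complexI fij; apply: val_inj.
    by apply: ('inj_f) fij; rewrite in_setT.
  by move=> i; apply: (@funS _ _ _ _ f (i : nat)).
have R_count : countable [set: R].
  have -> : [set: R] = \bigcup_(k in [set: nat]) fib k.
    by apply/seteqP; split=> // x _; exists (g x%:C%C).
  by apply: bigcup_countable => // k _; exact: finite_set_countable.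
have itv_count : countable `[0 : R, 1]%classic by exact: sub_countable (subset_card_le _) R_count.
have := countable_lebesgue_measure0 itv_count.
rewrite lebesgue_measure_itv /= lte_fin ltr01 oppr0 adde0 => /eqP.
by rewrite eqe oner_eq0.
Qed.

Section polynomial_derivative.
Context {K : numFieldType}.

Lemma is_derive_horner (p : {poly K}) (x : K) :
  is_derive (x : K^o) (1 : K^o) (fun t : K^o => p.[t] : K^o) (p^`().[x] : K^o).
Proof.
elim/poly_ind: p => [|p c IHp].
  have -> : (fun t : K^o => (0 : {poly K}).[t] : K^o) = cst 0.
    by apply/funext => t; rewrite horner0.
  by rewrite deriv0 horner0; exact: is_derive_cst.
have -> : (fun t : K^o => (p * 'X + c%:P).[t] : K^o) =
    (fun t : K^o => p.[t] : K^o) * (id : K^o -> K^o) + cst c.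
  by apply/funext => t; rewrite hornerD hornerMX hornerC.
apply: is_derive_eq.
rewrite addr0 derivD derivM derivX derivC addr0 mulr1 hornerD hornerMX.
by rewrite -[_ *: _]/(p.[x] * 1) -[x *: _]/(x * _) mulr1 addrC mulrC.
Qed.

Lemma derive1_horner_ratio (f : K -> K^o) (H Q : {poly K}) r : Q.[0] = 1 ->
  (forall t, Q.[t] != 0 -> f t = H.[t] / Q.[t] ^+ r) ->
  derive1 f 0 = H^`().[0] - r%:R * Q^`().[0] * H.[0].
Proof.
move=> Q0 fHQ; pose q : K^o -> K^o := fun t => Q.[t].
have dq : is_derive (0 : K^o) (1 : K^o) q (Q^`().[0] : K^o) by exact: is_derive_horner.
have dh := is_derive_horner H 0.
have dqr : is_derive (0 : K^o) (1 : K^o) (q ^+ r) (r%:R * Q^`().[0] : K^o).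
  by apply: is_derive_eq; rewrite /q Q0 expr1n mulr1.
have qr0 : (q ^+ r) 0 = 1 by rewrite exprfctE /q Q0 expr1n.
have dV : is_derive (0 : K^o) (1 : K^o) (fun t => ((q ^+ r) t)^-1) (- (r%:R * Q^`().[0]) : K^o).
  have qr_neq0 : (q ^+ r) 0 != 0 by rewrite qr0 oner_eq0.
  apply: DeriveDef; first by apply: derivableV => //; case: dqr.
  rewrite deriveV //; case: dqr => _ ->; rewrite qr0 expr1n invr1 //.
  by rewrite -[_ *: _]/(-1 * _) mulN1r.
rewrite (@near_eq_derive1 _ f ((fun t : K^o => H.[t] : K^o) * (fun t => ((q ^+ r) t)^-1 : K^o))).
  rewrite derive1E; have [_ ->] := is_deriveM dh dV.
  rewrite qr0 invr1 -[_ *: _]/(H.[0] * - (r%:R * Q^`().[0])) -[1 *: _]/(1 * _).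
  by rewrite mul1r addrC mulrN mulrC.
have q_cont : {for (0 : K^o), continuous q}.
  by apply: differentiable_continuous; apply/derivable1_diffP; case: dq.
have : \forall t \near (0 : K^o), q t != 0.
  by apply: (cvgr_neq0 _ q_cont); rewrite /q Q0 oner_eq0.
by apply: filterS => t qt; rewrite fHQ // exprfctE.
Qed.

End polynomial_derivative.

Lemma drep_mx_coef {C : closedFieldType} {T : comNzRingType} n m
    (P : 'I_m -> 'I_m -> {mpoly C[n * n]}) r (g : C -> T) B i j :
  drep_mx P r g B i j =
  dpmx P g B i j - (r%:R * dpmx det_poly g B 0 0) *+ (i == j).
Proof. by rewrite /drep_mx mxE [X in _ + X]mxE [X in _ - X]mxE. Qed.

Lemma algebraic_rep_mult {R : realType} n m (Psi : 'M[R[i]]_n -> 'M[R[i]]_m) P r :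
  algebraic_rep Psi ->
  (forall s, s \in unitmx -> forall i j,
     Psi s i j = meval (fun k => mxvec s 0 k) (P i j) / \det s ^+ r) ->
  multiplicative_on_units P /\
  forall s c, \det s * c = 1 -> Psi s = rep_mx P r idfun s c.
Proof.
move=> Psi_rep PsiP.
have PsiE s : s \in unitmx -> pmx P idfun s = \det s ^+ r *: Psi s.
  move=> us; apply/matrixP => i j; rewrite !mxE PsiP // mulrC divfK //.
  by rewrite expf_neq0 // -unitfE -unitmxE.
split.
  split=> [|s t us ut]; first by rewrite PsiE ?unitmx1 // (rep1 Psi_rep) det1 expr1n scale1r.
  rewrite !PsiE // ?unitmx_mul ?us // (repM Psi_rep us ut) det_mulmx exprMn.
  by rewrite -scalemxAl -scalemxAr scalerA.
move=> s c sc; have us : s \in unitmx.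
  by rewrite unitmxE unitfE; apply/eqP => s0; move/eqP: sc; rewrite s0 mul0r eq_sym oner_eq0.
by rewrite /rep_mx PsiE // scalerA -exprMn mulrC sc expr1n scale1r.
Qed.

(** Both sides are the derivative at [t = 0] of the polynomials [P] at
    [1 + t B] over a power of the determinant of this matrix. *)
Lemma drepE {R : realType} n m (Psi : 'M[R[i]]_n -> 'M[R[i]]_m) P r B :
  algebraic_rep Psi ->
  (forall s, s \in unitmx -> forall i j,
     Psi s i j = meval (fun k => mxvec s 0 k) (P i j) / \det s ^+ r) ->
  drep Psi B = drep_mx P r idfun B.
Proof.
move=> Psi_rep PsiP; have [[P1 _] _] := algebraic_rep_mult Psi_rep PsiP.
pose C := R[i]; pose b : 'M[{poly C}]_n := 1%:M + 'X *: map_mx (@polyC C) B.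
pose ev (t : C) : {rmorphism {poly C} -> C} := horner_eval t.
have evE t p : ev t p = p.[t] by [].
have evb t : map_mx (ev t) b = 1%:M + t *: B.
  apply/matrixP => i j; rewrite !mxE evE hornerD hornerM hornerX hornerC.
  by rewrite hornerMn hornerC.
have evPC (t : C) : ev t \o @polyC C =1 idfun by move=> c; rewrite /= evE hornerC.
pose H i j : {poly C} := mxev (@polyC C) b (P i j).
have HE i j t : (H i j).[t] = mxev idfun (1%:M + t *: B) (P i j).
  by rewrite -evE rmorph_mxev evb; apply: eq_mxev.
pose Q := \det b.
have QE t : Q.[t] = \det (1%:M + t *: B) by rewrite -evE -det_map_mx evb.
have b1 : 1%:M + 0 *: B = 1%:M by rewrite scale0r addr0.
have deriv_b : map_mx (@deriv C) b = map_mx (@polyC C) B.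
  apply/matrixP => i j; rewrite !mxE derivD derivM derivX derivC mulr0 addr0.
  by rewrite mul1r derivMn derivC mul0rn add0r.
have deriv_ev p : (mxev (@polyC C) b p)^`().[0] =
    \sum_k mxev idfun 1%:M (mderiv k p) * mxvec B 0 k.
  have dM : leibniz (@deriv C) by move=> x y; exact: derivM.
  rewrite (mxev_deriv_const (d := @deriv C) b p dM (@derivC C)) -evE rmorph_sum.
  apply: eq_bigr => k _; rewrite rmorphM rmorph_mxev evb b1 deriv_b.
  congr (_ * _); first exact: eq_mxev.
  by rewrite -map_mxvec mxE evE hornerC.
apply/matrixP => i j; rewrite mxE.
rewrite (@derive1_horner_ratio C _ (H i j) Q r).
- rewrite deriv_ev HE b1 drep_mx_coef [dpmx P _ _ _ _]mxE; congr (_ - _).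
  have -> : Q = mxev (@polyC C) b (det_poly 0 0).
    by rewrite /det_poly -det_map_mx mxev_genmx.
  rewrite deriv_ev -[LHS]/(_ * _ * (mxev idfun 1%:M (P i j))).
  have -> : mxev idfun 1%:M (P i j) = (pmx P idfun 1%:M) i j by rewrite mxE.
  by rewrite P1 mxE [dpmx _ _ _ 0 0]mxE mulr_natr.
- by rewrite QE b1 det1.
- move=> t; rewrite QE HE => Qt; apply: PsiP.
  by rewrite unitmxE unitfE.
Qed.

(** * Expansions at a point as elements of a differential field *)

(** The derivation of the field of formal Laurent series that is [kappa d/dz]. *)
Definition scaled_deriv {C : fieldType} (kappa : ps C) (x : {fraction ps C}) :=
  FracField.tofrac kappa * frac_deriv (@psderiv_leibniz C) x.

Section scaled_derivation.
Context {C : fieldType} (C_char0 : forall k, k.+1%:R != 0 :> C).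
Context {kappa : ps C} (kappa_neq0 : kappa != 0).
Local Notation F := (@FracField.tofrac (ps C)).
Local Notation D := (scaled_deriv kappa).

Lemma scaled_deriv_is_zmod_morphism : zmod_morphism D.
Proof. by move=> x y; rewrite /scaled_deriv raddfB mulrBr. Qed.
HB.instance Definition _ := GRing.isZmodMorphism.Build _ _ D
  scaled_deriv_is_zmod_morphism.

Lemma scaled_deriv_leibniz : leibniz D.
Proof.
move=> x y; rewrite /scaled_deriv (frac_deriv_leibniz (@psderiv_leibniz C)).
by rewrite mulrDr; congr (_ + _); [exact: mulrA | exact: mulrCA].
Qed.

Lemma scaled_derivF a : D (F a) = F (kappa * psderiv a).
Proof. by rewrite /scaled_deriv frac_derivF -tofracM. Qed.

Lemma tofrac_inj : injective F.
Proof. by move=> a b /eqP; rewrite tofrac_eq => /eqP. Qed.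

(** If the derivative of [a / b] is zero, so is the Wronskian of [a] and [b]. *)
Lemma scaled_deriv_eq0 x : D x = 0 <-> exists c, x = F (psC c).
Proof.
split=> [|[c ->]]; last first.
  rewrite scaled_derivF; have -> : psderiv (psC c) = 0 :> ps C.
    by apply: psP => k; rewrite psc0 /= mul0rn.
  by rewrite mulr0 tofrac0.
have [a [b [b0 ->]]] := fracE x; rewrite /scaled_deriv frac_derivE //.
move/eqP; rewrite !mulf_eq0 invr_eq0 !tofrac_eq0 expf_eq0 (negPf kappa_neq0).
rewrite (negPf b0) andbF orbF /= subr_eq0 => /eqP /(ps_wronskian C_char0 b0)[c ->].
by exists c; rewrite tofracM mulfK // tofrac_eq0.
Qed.

Lemma frac_char0 k : k.+1%:R != 0 :> {fraction ps C}.
Proof.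
have -> : k.+1%:R = F (psC k.+1%:R) by rewrite !rmorph_nat.
by rewrite tofrac_eq0 fmorph_eq0.
Qed.

End scaled_derivation.

Lemma ps_euler (C : fieldType) N : psX * psderiv (psX ^+ N) = psC N%:R * psX ^+ N :> ps C.
Proof.
case: N => [|k].
  have := leibniz1 (@psderiv_leibniz C); rewrite expr0 /= => ->.
  by rewrite mulr0 rmorph0 mul0r.
have dX : psderiv psX = 1 :> ps C.
  by apply: psP => -[|l]; rewrite psc1 /= ?mulr1n ?mul0rn.
have := leibnizX (@psderiv_leibniz C) psX k; rewrite /= dX mulr1 => ->.
by rewrite rmorph_nat mulrCA -exprS.
Qed.

Lemma euler_rearrange (L : comPzRingType) (a u v n x dx : L) : a * v = n * u ->
  dx * (a * u) = a * (dx * u + x * v) - n * (x * u).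
Proof.
move=> E; have -> : n * (x * u) = x * (a * v) by rewrite E; ring.
ring.
Qed.

Section expansions.
Context {R : realType}.
Local Notation C := R[i].
Local Notation fct := (CP1 R -> C).
Local Notation F := (@FracField.tofrac (ps C)).
Implicit Types (f g : fct) (p q : CP1 R) (A B : ps C) (x y : {fraction ps C}).

(** The Laurent expansion of [f] at [p] is [x], a quotient of power series. *)
Definition expands f p x : Prop :=
  exists N A, laurent f p N A /\ x * F (psX ^+ N) = F A.

Lemma tofrac_psXn_neq0 N : F (psX ^+ N) != 0.
Proof. by rewrite tofrac_eq0 expf_neq0 // psX_neq0. Qed.

Lemma expands_exists f p : meromorphic_at f p -> exists x, expands f p x.
Proof.
move=> [N [a /laurent_atP fa]]; exists (F (Ps a) / F (psX ^+ N)), N, (Ps a).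
by rewrite divfK // tofrac_psXn_neq0.
Qed.

Lemma expands_common f g p x y : expands f p x -> expands g p y ->
  exists N A B, [/\ laurent f p N A, laurent g p N B, x * F (psX ^+ N) = F A
    & y * F (psX ^+ N) = F B].
Proof.
move=> [N [A [Af xA]]] [M [B [Bg yB]]].
exists (N + M)%N, (psX ^+ M * A), (psX ^+ N * B); split.
- exact: laurent_shift.
- by rewrite addnC; exact: laurent_shift.
- by rewrite exprD !tofracM mulrA xA mulrC.
- by rewrite addnC exprD !tofracM mulrA yB mulrC.
Qed.

Lemma expands_near f g p x : expands f p x ->
  (\forall z \near (0 : C^o)^', f (chart p z) = g (chart p z)) -> expands g p x.
Proof. by move=> [N [A [Af xA]]] fg; exists N, A; split; [exact: (laurent_near Af fg) | exact: xA]. Qed.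

Lemma expands_unique f p x y : expands f p x -> expands f p y -> x = y.
Proof.
move=> fx fy; have [N [A [B [Af Bf xA yB]]]] := expands_common fx fy.
by apply: (mulIf (tofrac_psXn_neq0 N)); rewrite xA yB (laurent_unique Af Bf).
Qed.

Lemma expandsB f g p x y : expands f p x -> expands g p y -> expands (f - g) p (x - y).
Proof.
move=> fx gy; have [N [A [B [Af Bg xA yB]]]] := expands_common fx gy.
by exists N, (A - B); split; [exact: laurentB | rewrite mulrBl xA yB -tofracB].
Qed.

Lemma expandsM f g p x y : expands f p x -> expands g p y -> expands (f * g) p (x * y).
Proof.
move=> [N [A [Af xA]]] [M [B [Bg yB]]]; exists (N + M)%N, (A * B); split.
  exact: laurentM.
by rewrite exprD !tofracM mulrACA xA yB.
Qed.

Lemma expands_cst c p : expands (cst c) p (F (psC c)).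
Proof. by exists 0%N, (psC c); rewrite expr0 tofrac1 mulr1; split; [exact: laurent_cst|]. Qed.

Lemma expands0 f p : expands f p 0 -> \forall z \near (0 : C^o)^', f (chart p z) = 0.
Proof.
move=> [N [A [Af]]]; rewrite mul0r => /esym/eqP; rewrite tofrac_eq0 => /eqP A0.
by rewrite A0 in Af; exact: laurent_eq0 Af.
Qed.

Lemma expands_neq0 f p x : expands f p x -> x != 0 ->
  \forall z \near (0 : C^o)^', f (chart p z) != 0.
Proof.
move=> [N [A [Af xA]]] x0; apply: (laurent_neq0 Af); apply: contraNneq x0 => A0.
move/eqP: xA; rewrite A0 tofrac0 mulf_eq0 (negPf (tofrac_psXn_neq0 N)) orbF.
by move/eqP ->.
Qed.

(** Meromorphic functions whose product is one near [p] have inverse expansions,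
    which spares estimates for the inverse series. *)
Lemma expands_inv f p x : expands f p x ->
  meromorphic_at (fun q => (f q)^-1) p -> expands (fun q => (f q)^-1) p x^-1.
Proof.
move=> fx /expands_exists[y fVy]; have [x0|x0] := eqVneq x 0.
  rewrite x0 in fx *; rewrite invr0 -[0]tofrac0 -(rmorph0 psC).
  apply: (expands_near (expands_cst 0 p)).
  by move: (expands0 fx); apply: filterS => z ->; rewrite invr0.
suff -> : x^-1 = y by [].
apply: (mulfI x0); rewrite divff //; apply/esym.
apply: (expands_unique (expandsM fx fVy)).
rewrite -[1]tofrac1 -(rmorph1 psC); apply: (expands_near (expands_cst 1 p)).
move: (expands_neq0 fx x0); apply: filterS => z fz.
by rewrite -[RHS]/(f (chart p z) * (f (chart p z))^-1) divff.
Qed.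

Lemma chart_factor_neq0 p : chart_factor p != 0.
Proof.
case: p => [a|] /=; first exact: oner_neq0.
by rewrite oppr_eq0 expf_neq0 // psX_neq0.
Qed.

Lemma expands_ddx f p x : expands f p x ->
  expands (ddx f) p (scaled_deriv (chart_factor p) x).
Proof.
move=> [N [A [Af xA]]].
exists N.+1, (chart_factor p * (psX * psderiv A - psC N%:R * A)).
split; first exact: laurent_ddx.
have := frac_deriv_leibniz (@psderiv_leibniz C) x (F (psX ^+ N)).
rewrite xA !frac_derivF => E.
have XdX : F psX * F (psderiv (psX ^+ N)) = F (psC N%:R) * F (psX ^+ N).
  by rewrite -!tofracM ps_euler.
rewrite /scaled_deriv tofracM -mulrA; congr (_ * _).
rewrite tofracB [F (psX * _)]tofracM [F (psC _ * _)]tofracM E -xA exprS.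
rewrite [F (psX * _)]tofracM; exact: (euler_rearrange _ _ XdX).
Qed.

Lemma expands_psE f p A : expands f p (F A) <-> laurent f p 0 A.
Proof.
split=> [[N [B [Bf AB]]]|Af]; last first.
  by exists 0%N, A; rewrite expr0 tofrac1 mulr1; split; [exact: Af|].
have {AB} BE : B = psX ^+ N * A by apply: tofrac_inj; rewrite -AB mulrC tofracM.
rewrite {}BE in Bf; elim: N Bf => [|N IHN]; first by rewrite expr0 mul1r.
move=> Bf; apply: IHN; move: Bf (@near_neq0 R); apply: filterS2 => z Bz z0.
by apply: (psum_divX z0); move: Bz; rewrite !exprS -!mulrA.
Qed.

Lemma has_valueP f p c :
  has_value f p c <-> exists A, expands f p (F A) /\ ps0 A = c.
Proof.
split=> [[a fa ac]|[[a] [/expands_psE fa ac]]].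
  exists (Ps a); split; [apply/expands_psE; exact/laurent_atP | exact: ac].
by exists a; [exact/laurent_atP | exact: ac].
Qed.

End expansions.

(** * Rational functions and their expansions *)

Section germs.
Context {R : realType} {U : set (CP1 R)} (U_open : open U) (U_conn : connected U).
Context {K : set (CP1 R -> R[i])} (K_field : function_field U K).
Context {p : CP1 R} (Up : U p).
Local Notation C := R[i].
Local Notation fct := (CP1 R -> C).
Local Notation F := (@FracField.tofrac (ps C)).
Local Notation M := {fraction ps C}.
Local Notation iota := (F \o psC).
Local Notation D := (scaled_deriv (chart_factor p)).

(** The embedding of [K] into the field of Laurent series. It is a relation, as
    equality of functions in [K] is [mero_eq]. *)
Definition germ (f : fct) (x : M) : Prop := K f /\ expands f p x.

Lemma germ_exists f : K f -> exists x, germ f x.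
Proof.
by move=> Kf; have [x fx] := expands_exists (ff_mero K_field Kf Up); exists x.
Qed.

Lemma germB f g x y : germ f x -> germ g y -> germ (f - g) (x - y).
Proof.
by move=> [Kf fx] [Kg gy]; split; [exact: (ff_sub K_field) | exact: expandsB].
Qed.

Lemma germM f g x y : germ f x -> germ g y -> germ (f * g) (x * y).
Proof.
by move=> [Kf fx] [Kg gy]; split; [exact: (ff_mul K_field) | exact: expandsM].
Qed.

Lemma germ_cst c : germ (cst c) (iota c).
Proof. by split; [exact: (ff_cst K_field) | exact: expands_cst]. Qed.

Lemma germ0 : germ 0 0.
Proof. by have := germB (germ_cst 0) (germ_cst 0); rewrite !subrr. Qed.

Lemma germN f x : germ f x -> germ (- f) (- x).
Proof. by move=> /(germB germ0); rewrite !sub0r. Qed.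

Lemma germD f g x y : germ f x -> germ g y -> germ (f + g) (x + y).
Proof. by move=> fx /germN/(germB fx); rewrite !opprK. Qed.

Lemma germ_sum I (r : seq I) (P : pred I) (f : I -> fct) (x : I -> M) :
  (forall i, P i -> germ (f i) (x i)) ->
  germ (\sum_(i <- r | P i) f i) (\sum_(i <- r | P i) x i).
Proof.
by move=> fx; apply: (big_rec2 germ germ0) => i y1 y2 Pi; apply: germD; exact: fx.
Qed.

Lemma germMn f x k : germ f x -> germ (f *+ k) (x *+ k).
Proof.
move=> fx; elim: k => [|k IHk]; first by rewrite !mulr0n; exact: germ0.
by rewrite !mulrS; exact: germD.
Qed.

Lemma germ_ddx f x : germ f x -> germ (ddx f) (D x).
Proof.
by move=> [Kf fx]; split; [exact: (ff_ddx K_field) | exact: expands_ddx].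
Qed.

(** By the identity theorem the expansion at [p] determines a function on [U]. *)
Lemma germ_eq f g x y : germ f x -> germ g y -> mero_eq U f g <-> x = y.
Proof.
move=> fx gy; split=> [fg|xy].
  exact: (expands_unique (expands_near fx.2 (fg p Up)) gy.2).
have [Kfg fg] := germB fx gy; rewrite xy subrr in fg.
have := identity_theorem U_open U_conn (ff_mero K_field Kfg) Up (expands0 fg).
move=> fg0 q Uq; move: (fg0 q Uq); apply: filterS => z /eqP.
by rewrite -[(f - g) _]/(f (chart q z) - g (chart q z)) subr_eq0 => /eqP.
Qed.

Definition germ_field (x : M) : Prop := exists f, germ f x.

Lemma germ_field_subfield : is_subfield germ_field.
Proof.
split=> [|x y [f fx] [g gy]|x y [f fx] [g gy]|x [f [Kf fx]]].
- by exists (cst 1); have := germ_cst 1; rewrite rmorph1.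
- by exists (f - g); exact: germB.
- by exists (f * g); exact: germM.
exists (fun q => (f q)^-1); have KV := ff_inv K_field Kf.
split; [exact: KV | apply: (expands_inv fx); exact: (ff_mero K_field KV Up)].
Qed.

Lemma ddx0 : ddx (0 : fct) = 0.
Proof. apply/funext => -[a|] //; exact: (@derive1_cst _ _ (0 : C^o) a). Qed.

Section polynomials.
Context {n : nat}.

Definition mgerm (f : {mpoly fct[n]}) (x : {mpoly M[n]}) : Prop :=
  forall m, germ (mcoeff m f) (mcoeff m x).

Lemma mgermB f g x y : mgerm f x -> mgerm g y -> mgerm (f - g) (x - y).
Proof. by move=> fx gy m; rewrite !mcoeffB; exact: germB. Qed.

Lemma mgermD f g x y : mgerm f x -> mgerm g y -> mgerm (f + g) (x + y).
Proof. by move=> fx gy m; rewrite !mcoeffD; exact: germD. Qed.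

Lemma mgerm0 : mgerm 0 0.
Proof. by move=> m; rewrite !mcoeff0; exact: germ0. Qed.

Lemma mgermM f g x y : mgerm f x -> mgerm g y -> mgerm (f * g) (x * y).
Proof.
move=> fx gy m; rewrite !mcoeffM; apply: germ_sum => k _.
by apply: germM.
Qed.

Lemma mgermZ f g x y : germ f x -> mgerm g y -> mgerm (f *: g) (x *: y).
Proof. by move=> fx gy m; rewrite !mcoeffZ; apply: germM. Qed.

Lemma mgermX m : mgerm (mpolyX _ m) (mpolyX _ m).
Proof.
move=> k; rewrite !mcoeffX.
by have := germMn (m == k) (germ_cst 1); rewrite [iota 1]rmorph1.
Qed.

Lemma mgerm_sum I (r : seq I) (P : pred I) f x :
  (forall i, P i -> mgerm (f i) (x i)) ->
  mgerm (\sum_(i <- r | P i) f i) (\sum_(i <- r | P i) x i).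
Proof.
by move=> fx; apply: (big_rec2 mgerm mgerm0) => i y1 y2 Pi; apply: mgermD; exact: fx.
Qed.

Lemma mgerm_ddx f x : mgerm f x -> mgerm (map_mpoly (@ddx R) f) (map_mpoly D x).
Proof.
by move=> fx m; rewrite (mcoeff_map_mpoly0 _ _ ddx0) mcoeff_map_mpoly; exact: (germ_ddx (fx m)).
Qed.

Lemma mgerm_mderiv i f x : mgerm f x -> mgerm (mderiv i f) (mderiv i x).
Proof. by move=> fx m; rewrite !mcoeff_deriv; apply: germMn. Qed.

Lemma mgerm_bracket (A : 'M[fct]_n) (A' : 'M[M]_n) Y Y' k :
  (forall i j, germ (A i j) (A' i j)) -> (forall i, mgerm (Y i) (Y' i)) ->
  mgerm (bracket (@ddx R) (vfieldX A) (vertical Y) k)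
    (bracket D (vfieldX A') (vertical Y') k).
Proof.
move=> AA' YY'.
have mgerm1 : mgerm 1 1 by rewrite -!mpolyX0; exact: mgermX.
have actP Z Z' W W' : (forall k, mgerm (Z k) (Z' k)) -> mgerm W W' ->
    mgerm (vf_act (@ddx R) Z W) (vf_act D Z' W').
  move=> ZZ' WW'; apply: mgermD; first exact: mgermM (mgerm_ddx _).
  by apply: mgerm_sum => i _; apply: mgermM (mgerm_mderiv _ _).
have XX' l : mgerm (vfieldX A l) (vfieldX A' l).
  case: l => [i|] //=; apply: mgerm_sum => j _; apply: mgermZ (AA' i j) _.
  exact: mgermX.
have VV' l : mgerm (vertical Y l) (vertical Y' l).
  by case: l => [i|] /=; [exact: YY' | exact: mgerm0].
by apply: mgermB; apply: actP.
Qed.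

End polynomials.

Lemma germ_regular f c : K f -> has_value f p c <-> exists a, germ f (F a) /\ ps0 a = c.
Proof.
move=> Kf; rewrite has_valueP; split=> -[a [fa ac]]; exists a; split=> //.
by case: fa.
Qed.

Lemma germ_mx_exists m k (A : 'M[fct]_(m, k)) : (forall i j, K (A i j)) ->
  exists A' : 'M[M]_(m, k), forall i j, germ (A i j) (A' i j).
Proof.
move=> KA; have /choice[g gP] : forall ij : 'I_m * 'I_k, exists x, germ (A ij.1 ij.2) x.
  by move=> ij; apply: germ_exists.
by exists (\matrix_(i, j) g (i, j)) => i j; rewrite mxE; exact: (gP (i, j)).
Qed.

Section system.
Context {n : nat} {A : 'M[fct]_n} {A' : 'M[M]_n}.
Hypothesis AA' : forall i j, germ (A i j) (A' i j).

(** In the coordinate [z] the system reads [dy/dz = B y] with [B] regular. *)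
Lemma nonsingular_regular : nonsingular A p ->
  exists B : 'M[ps C]_n, A' = map_mx F (chart_factor p *: B).
Proof.
move=> A_reg.
suff /choice[B BP] : forall ij : 'I_n * 'I_n, exists b, A' ij.1 ij.2 = F (chart_factor p * b).
  by exists (\matrix_(i, j) B (i, j)); apply/matrixP => i j; rewrite !mxE -BP.
move=> [i j] /=; have [_ Ax] := AA' i j; have := A_reg i j.
case: (p) Ax => [a|] Ax [c /has_valueP[b [bA _]]]; exists b.
  by rewrite mul1r; exact: (expands_unique Ax bA).
(* At infinity regularity concerns [- x ^ 2 A], and [A] is the product of this
   function with [h = - x ^ -2], which expands as [- z ^ 2]. *)
pose h (q : CP1 R) : C := if q is Some x then - (x^-1) ^+ 2 else 0.
have hx : expands h None (F (- psX ^+ 2)).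
  apply/expands_psE; have h0 : \forall z \near (0 : C^o)^', psum (psX ^+ 2) z (z ^+ 2).
    have h1 z : psum (1 : ps C) z 1 by exact: psum_cst.
    by apply: filterE => z; have := @psum_mulXn _ _ _ _ 2 (h1 z); rewrite !mulr1.
  move: h0 (@near_neq0 R); apply: filterS2 => z hz z0.
  rewrite expr0 mul1r /h /= (negPf z0) invrK -[- psX ^+ 2]sub0r -[- z ^+ 2]sub0r.
  by apply: psumB; [exact: psum_cst | exact: hz].
rewrite tofracM; apply: (expands_unique Ax).
apply: (expands_near (expandsM hx bA)).
move: (@near_neq0 R); apply: filterS => z z0.
rewrite -[(_ * _) _]/(h (chart None z) * _) /h /= (negPf z0) invrK.
by rewrite mulrA mulrNN exprVn divff ?mul1r // expf_neq0.
Qed.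

Context {m : nat} {Psi : 'M[C]_n -> 'M[C]_m} (Psi_rep : algebraic_rep Psi).
Context {P : 'I_m -> 'I_m -> {mpoly C[n * n]}} {r : nat}.
Hypothesis PsiP : forall s, s \in unitmx -> forall i j,
  Psi s i j = meval (fun k => mxvec s 0 k) (P i j) / \det s ^+ r.

Lemma germ_dpmx l (Q : 'I_l -> 'I_l -> {mpoly C[n * n]}) i j :
  germ (fun q => dpmx Q idfun (mx_at A q) i j) (dpmx Q iota A' i j).
Proof.
pose c k := mxev idfun 1%:M (mderiv k (Q i j)).
have -> : (fun q => dpmx Q idfun (mx_at A q) i j) = \sum_k cst (c k) * mxvec A 0 k.
  apply/funext => q; rewrite mxE fct_sumE; apply: eq_bigr => k _.
  by rewrite -map_mxvec mxE.
rewrite mxE; apply: germ_sum => k _; apply: germM.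
  have -> : mxev iota 1%:M (mderiv k (Q i j)) = iota (c k).
    by rewrite -[RHS]/([the {rmorphism C -> M} of iota] _) rmorph_mxev map_mx1; apply: eq_mxev.
  exact: germ_cst.
by case/mxvec_indexP: k => x y; rewrite !mxvecE.
Qed.

Lemma germ_drep i j :
  germ (fun q => drep Psi (mx_at A q) i j) (drep_mx P r iota A' i j).
Proof.
have -> : (fun q => drep Psi (mx_at A q) i j) = (fun q => dpmx P idfun (mx_at A q) i j)
    - (cst r%:R * (fun q => dpmx det_poly idfun (mx_at A q) 0 0)) *+ (i == j).
  apply/funext => q; rewrite (drepE _ Psi_rep PsiP) drep_mx_coef.
  by case: (i == j).
rewrite drep_mx_coef; apply: germB; first exact: germ_dpmx.
apply: germMn; apply: germM; last exact: germ_dpmx.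
by have := germ_cst r%:R; rewrite [iota _]rmorph_nat.
Qed.

(** A solution on [U] can be tested on expansions at [p]. *)
Lemma pre_solutionP (w : 'cV[fct]_m) (w' : 'cV[M]_m) b b' :
  (forall i j, germ (w i j) (w' i j)) -> germ b b' ->
  pre_solution U A Psi b w <->
  map_mx D w' = drep_mx P r iota A' *m w' - b' *: w'.
Proof.
move=> ww' bb'.
have germ_eqn i : mero_eq U
    (fun p => ddx (w i 0) p - (drep Psi (mx_at A p) *m mx_at w p) i 0)
    (fun p => - b p * w i 0 p) <->
  D (w' i 0) - (drep_mx P r iota A' *m w') i 0 = - b' * w' i 0.
  apply: germ_eq; last exact: (germM (germN bb') (ww' i 0)).
  apply: germB; first exact: germ_ddx.
  have -> : (fun q => (drep Psi (mx_at A q) *m mx_at w q) i 0) =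
      \sum_k (fun q => drep Psi (mx_at A q) i k) * w k 0.
    apply/funext => q; rewrite mxE fct_sumE; apply: eq_bigr => k _.
    by congr (_ * _); rewrite mxE.
  rewrite mxE; apply: germ_sum => k _; apply: germM.
    refine (germ_drep i k).
  exact: ww'.
split=> [sol|/matrixP sol i].
  apply/matrixP => i j; rewrite ord1; have /germ_eqn := sol i.
  by rewrite !mxE => /eqP; rewrite subr_eq addrC -mulNr => /eqP ->.
apply/germ_eqn; have := sol i 0; rewrite !mxE => ->.
by rewrite mulNr addrAC subrr add0r.
Qed.

End system.
End germs.

(** * Symmetries and the Galois group *)

Lemma map_mpoly_comp {S T V : nzRingType} (f : {rmorphism T -> V})
    (g : {rmorphism S -> T}) n (q : {mpoly S[n]}) :
  map_mpoly f (map_mpoly g q) = map_mpoly (f \o g) q.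
Proof. by apply/mpolyP => m; rewrite !mcoeff_map_mpoly. Qed.

Lemma map_mpoly_cancel {S T V : nzRingType} (f : {rmorphism T -> V})
    (g : {rmorphism S -> T}) n (p : {mpoly T[n]}) (q : {mpoly S[n]}) :
  injective f -> map_mpoly f p = map_mpoly (f \o g) q -> p = map_mpoly g q.
Proof.
move=> f_inj E; apply/mpolyP => m; apply: f_inj; have := congr1 (mcoeff m) E.
by rewrite !mcoeff_map_mpoly.
Qed.

Lemma deg_ltW {S : nzRingType} n d (p : {mpoly S[n]}) : (msize p <= d)%N -> deg_lt d p.
Proof.
move=> le_pd m le_dm; apply: memN_msupp_eq0; apply: msize_mdeg_ge.
exact: leq_trans le_dm.
Qed.

Lemma deg_lt_map {S T : nzRingType} (f : {additive S -> T}) n d (p : {mpoly S[n]}) :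
  deg_lt d p -> deg_lt d (map_mpoly f p).
Proof. by move=> p_d m le_dm; rewrite mcoeff_map_mpoly p_d // raddf0. Qed.

Lemma vf_vec_map {S T : nzRingType} (f : {additive S -> T}) n d
    (Y : 'I_n -> {mpoly S[n]}) :
  vf_vec d (fun i => map_mpoly f (Y i)) = map_mx f (vf_vec d Y).
Proof. by apply/matrixP => k j; rewrite !mxE mcoeff_map_mpoly. Qed.

Lemma vf_vec_coef {S : nzRingType} n d (Q : S -> Prop) (Y : 'I_n -> {mpoly S[n]}) :
  (forall i, deg_lt d (Y i)) -> Q 0 -> (forall k, Q (vf_vec d Y k 0)) ->
  forall i m, Q (mcoeff m (Y i)).
Proof.
move=> Yd Q0 QY i m; have [lt_m|le_m] := ltnP (mdeg m) d; last by rewrite Yd.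
by have := QY (enum_rank (i, BMultinom lt_m)); rewrite mxE enum_rankK.
Qed.

Section vector_field_algebraic_rep.
Context {R : realType} {n : nat} (d : nat).

Lemma vf_rep_regular (s : 'M[R[i]]_n) : s \in unitmx -> forall k l,
  vf_mx d s (invmx s) k l =
  meval (fun j => mxvec s 0 j) (@vf_poly n d R[i] k l) / \det s ^+ d.
Proof.
move=> us k l.
rewrite -(vf_poly_unit d [the {rmorphism R[i] -> R[i]} of idfun] (mulmxV us)).
by rewrite mxE [pmx _ _ _ _ _]mxE det_inv exprVn mulrC.
Qed.

Lemma vf_algebraic_rep : algebraic_rep (fun s : 'M[R[i]]_n => vf_mx d s (invmx s)).
Proof.
split=> [|s t us ut|]; first by rewrite invmx1 vf_mx1.
  by rewrite invmx_mul // vf_mxM.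
by exists d, (@vf_poly n d R[i]); exact: vf_rep_regular.
Qed.

End vector_field_algebraic_rep.

Section galois_symmetries.
Context {R : realType} {U : set (CP1 R)} (U_open : open U) (U_conn : connected U).
Context {K : set (CP1 R -> R[i])} (K_field : function_field U K).
Context {p : CP1 R} (Up : U p).
Local Notation C := R[i].
Local Notation fct := (CP1 R -> C).
Local Notation F := (@FracField.tofrac (ps C)).
Local Notation M := {fraction ps C}.
Local Notation iota := (F \o psC).
Local Notation ev0 := (@ps0 C).
Local Notation D := (scaled_deriv (chart_factor p)).
Local Notation germ := (@germ R K p).
Local Notation KM := (@germ_field R K p).
Context {n : nat} {A : 'M[fct]_n} {A' : 'M[M]_n}.
Hypothesis AA' : forall i j, germ (A i j) (A' i j).
Context {PhiS PsiS : 'M[ps C]_n} (PhiPsi : PhiS *m PsiS = 1%:M).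
Hypothesis Phi0 : map_mx ev0 PhiS = 1%:M.
Local Notation Phi := (map_mx F PhiS).
Local Notation Psi := (map_mx F PsiS).
Hypothesis D_Phi : map_mx D Phi = A' *m Phi.

Let C_unc := @complex_uncountable R.
Let C_char0 (k : nat) : k.+1%:R != 0 :> C. Proof. by rewrite pnatr_eq0. Qed.
Let DM : leibniz D := scaled_deriv_leibniz.
Let D_const x : D x = 0 <-> exists c, x = iota c.
Proof. exact: (scaled_deriv_eq0 C_char0 (chart_factor_neq0 p) x). Qed.
Let D_iota c : D (iota c) = 0.
Proof. by apply/D_const; exists c. Qed.
Let ev0_psC c : ev0 (psC c) = c. Proof. by []. Qed.
Let subK := germ_field_subfield K_field Up.
Let K_const c : KM (iota c).
Proof. by exists (cst c); exact: (germ_cst K_field c). Qed.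
Let K_D x : KM x -> KM (D x).
Proof. by move=> [f fx]; exists (ddx f); refine (germ_ddx K_field fx). Qed.
Let K_A i j : KM (A' i j).
Proof. by exists (A i j). Qed.
Let PhiPsiM : Phi *m Psi = 1%:M.
Proof. by rewrite -map_mxM PhiPsi map_mx1. Qed.
Let Psi0 : map_mx ev0 PsiS = 1%:M.
Proof. by have := congr1 (map_mx ev0) PhiPsi; rewrite map_mxM Phi0 mul1mx map_mx1. Qed.

Local Notation spec := (specializable (iota := iota) (K := KM)
  (Phi := ext Phi (\det Psi))).

Lemma germ_values m (w : 'cV[fct]_m) w0 : (forall i, K (w i 0)) ->
  mx_has_value w p w0 -> exists wS : 'cV[ps C]_m,
    (forall i j, germ (w i j) (map_mx F wS i j)) /\ map_mx ev0 wS = w0.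
Proof.
move=> Kw ww0.
have /choice[a aP] : forall i, exists a, germ (w i 0) (F a) /\ ev0 a = w0 i 0.
  by move=> i; apply/germ_regular.
exists (\col_i a i); split=> [i j|]; first by rewrite ord1 !mxE; case: (aP i).
by apply/matrixP => i j; rewrite ord1 !mxE; case: (aP i).
Qed.

(** Rational solutions are fixed, and exponential ones are preserved up to a
    factor, by the specializations of the fundamental matrix. *)
Lemma specializable_galoisian sigma c :
  spec (ext sigma c) -> \det sigma * c = 1 -> galoisian U K A p sigma.
Proof.
move=> s_spec sc; split.
  rewrite unitmxE unitfE; apply/eqP => s0; move/eqP: sc.
  by rewrite s0 mul0r eq_sym oner_eq0.
move=> m Rho Rho_rep; have [r [P RhoP]] := rep_regular Rho_rep.
have [P_mult RhoE] := algebraic_rep_mult Rho_rep RhoP.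
split=> [v v0 [Kv sol] /(germ_values Kv)[vS [vvS vS0]]|].
  have Dv := (pre_solutionP U_open U_conn K_field Up AA' Rho_rep RhoP vvS
    (germ_cst K_field 0)).1 sol.
  rewrite rmorph0 scale0r subr0 in Dv.
  have vE := rational_solutionE C_unc tofrac_inj ev0_psC DM D_const PhiPsi Phi0 D_Phi
    P_mult Dv erefl.
  rewrite (RhoE _ _ sc) -vS0.
  apply: (specializable_fixes C_unc subK K_const PhiPsi P_mult _ s_spec) => i.
  by rewrite -vE; exists (v i 0).
move=> w w0 [Kw [b Kb sol]] /(germ_values Kw)[wS [wwS wS0]].
have [w00|w0_neq0] := eqVneq w0 0; first by exists 0; rewrite w00 mulmx0 scale0r.
have [b' bb'] := germ_exists K_field Up Kb.
have Dw := (pre_solutionP U_open U_conn K_field Up AA' Rho_rep RhoP wwS bb').1 sol.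
rewrite -wS0 in w0_neq0 *.
have [h h0 wE] := pre_solutionE C_unc tofrac_inj ev0_psC DM D_const PhiPsi Phi0 D_Phi
  P_mult Dw erefl w0_neq0.
rewrite (RhoE _ _ sc).
apply: (specializable_line C_unc subK K_const PhiPsi P_mult h0 w0_neq0 _ s_spec) => i.
by rewrite -wE; exists (w i 0).
Qed.

Context {Y0 : 'I_n -> {mpoly C[n]}}.

(** The symmetry with initial value [Y0] over the field of formal Laurent
    series. *)
Let Y' : 'I_n -> {mpoly M[n]} := push Phi Psi (fun i => map_mpoly iota (Y0 i)).

Let d := (\max_i msize (Y0 i))%N.

Let Y0_d i : deg_lt d (Y0 i).
Proof. by apply: deg_ltW; apply: leq_bigmax. Qed.

Let Y'_d i : deg_lt d (Y' i).
Proof. by apply: deg_lt_push => j; exact: deg_lt_map. Qed.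

Let Y'_vec : vf_vec d Y' =
  rep_mx (@vf_poly n d C) d iota Phi (\det Psi) *m map_mx iota (vf_vec d Y0).
Proof.
rewrite vf_poly_unit // -vf_vec_map vf_vec_push // => i.
exact: deg_lt_map.
Qed.

(** The coefficients of [Y'] are a solution of the system induced on vector
    fields of degree less than [d]. Its initial value is fixed by the
    specializations of the fundamental matrix, which are Galoisian, so it is
    rational; and the bracket of [X] with [Y'] is zero because [Y'] is constant
    along the solutions. *)
Lemma invariant_symmetry :
  (forall s, galoisian U K A p s -> vf_push s (vf_map Y0) = vf_map Y0) ->
  exists Y, vertical_symmetry U K A Y /\ restricts_to Y p Y0.
Proof.
move=> inv.
have K_Y' i m : KM (mcoeff m (Y' i)).
  apply: (vf_vec_coef Y'_d (sf0 subK)) => k; rewrite Y'_vec.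
  refine (invariant_vector_rational C_unc (frac_char0 C_char0) DM D_const subK K_const K_D K_A
    PhiPsi D_Phi (vf_poly_mult d) _ k) => sigma c s_spec sc.
  have s_gal := specializable_galoisian s_spec sc; have us := s_gal.1.
  have cE : c = \det (invmx sigma).
    have s0 : \det sigma != 0 by rewrite -unitfE -unitmxE.
    by apply: (mulfI s0); rewrite sc det_inv divff.
  rewrite cE (vf_poly_unit d [the {rmorphism C -> C} of idfun] (mulmxV us)).
  rewrite -vf_vec_push //; have /(vf_push_fixed C_unc) YY := inv _ s_gal.
  by apply/matrixP => x y; rewrite !mxE YY.
have /choice[Y YP] : forall i, exists f, forall m, germ (mcoeff m f) (mcoeff m (Y' i)).
  move=> i; apply: (@mpoly_choice _ _ _ (fun x f => germ f x)); first exact: (germ0 K_field).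
  exact: K_Y'.
exists Y; split; last first.
  move=> i m; apply/(germ_regular _ (YP i m).1).
  pose YS := push PhiS PsiS (fun j => map_mpoly psC (Y0 j)) i.
  exists (mcoeff m YS); split.
    have := YP i m.
    suff -> : Y' i = map_mpoly F YS by rewrite mcoeff_map_mpoly.
    by rewrite map_push; apply: eq_push => j; rewrite map_mpoly_comp.
  rewrite -mcoeff_map_mpoly map_push Phi0 Psi0 push1.
  by rewrite !mcoeff_map_mpoly.
have bracket0 : forall k, bracket D (vfieldX A') (vertical Y') k = 0.
  apply/(bracket_eq0_push DM D_Phi PhiPsiM) => i; rewrite pushM (mulmx1C PhiPsiM) push1.
  by apply/mpolyP => m; rewrite !mcoeff_map_mpoly mcoeff0; exact: D_iota.
split=> [i m|k m]; first by case: (YP i m).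
apply/(germ_eq U_open U_conn K_field Up (mgerm_bracket K_field k AA' YP m) (germ_cst K_field 0)).
by rewrite bracket0 mcoeff0 [iota 0]rmorph0.
Qed.

(** The expansion of a symmetry, transported to the origin along the fundamental
    matrix, is constant and thus equal to [Y0]. Therefore the coefficients of
    the symmetry are a rational solution of the system induced on vector fields,
    and Galoisian matrices fix its initial value. *)
Lemma symmetry_invariant Y : vertical_symmetry U K A Y -> restricts_to Y p Y0 ->
  forall s, galoisian U K A p s -> vf_push s (vf_map Y0) = vf_map Y0.
Proof.
move=> [KY XY] Y_Y0 s [us s_gal].
have /choice[YS YP] : forall i, exists a : {mpoly (ps C)[n]},
    forall m, germ (mcoeff m (Y i)) (F (mcoeff m a)).
  move=> i; apply: (@mpoly_choice _ _ _ (fun f a => germ f (F a))).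
    by rewrite tofrac0; exact: (germ0 K_field).
  by move=> m; have [a [fa _]] := (germ_regular _ (KY i m)).1 (Y_Y0 i m); exists a.
have YS0 i : map_mpoly ev0 (YS i) = Y0 i.
  apply/mpolyP => m; rewrite mcoeff_map_mpoly.
  have [a [[_ fa] <-]] := (germ_regular _ (KY i m)).1 (Y_Y0 i m).
  by congr ev0; apply: tofrac_inj; exact: expands_unique (YP i m).2 fa.
have YgermF i m : germ (mcoeff m (Y i)) (mcoeff m (map_mpoly F (YS i))).
  by rewrite mcoeff_map_mpoly; exact: YP.
have bracket0 k : bracket D (vfieldX A') (vertical (fun i => map_mpoly F (YS i))) k = 0.
  apply/mpolyP => m; rewrite mcoeff0 -[RHS](rmorph0 iota).
  exact/(germ_eq U_open U_conn K_field Up (mgerm_bracket K_field k AA' YgermF m) (germ_cst K_field 0)).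
have T_const := (bracket_eq0_push DM D_Phi PhiPsiM _).1 bracket0.
have /choice[Z ZP] : forall i, exists Z, forall m,
    mcoeff m (push Psi Phi (fun j => map_mpoly F (YS j)) i) = iota (mcoeff m Z).
  move=> i; apply: (@mpoly_choice _ _ _ (fun x c => x = iota c)); first by rewrite rmorph0.
  by move=> m; apply/D_const; rewrite -mcoeff_map_mpoly T_const mcoeff0.
have TZ i : push Psi Phi (fun j => map_mpoly F (YS j)) i = map_mpoly iota (Z i).
  by apply/mpolyP => m; rewrite ZP mcoeff_map_mpoly.
have ZE i : Z i = Y0 i.
  have E : map_mpoly F (push PsiS PhiS YS i) = map_mpoly iota (Z i).
    by rewrite map_push TZ.
  have : push PsiS PhiS YS i = map_mpoly psC (Z i).
    exact: (map_mpoly_cancel tofrac_inj E).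
  move/(congr1 (map_mpoly ev0)); rewrite map_push Psi0 Phi0 push1 YS0 => ->.
  by apply/mpolyP => m; rewrite !mcoeff_map_mpoly.
have YE i : map_mpoly F (YS i) = Y' i.
  rewrite -[LHS](push1 (fun j => map_mpoly F (YS j)) i) -PhiPsiM -pushM.
  by apply: eq_push => j; rewrite TZ ZE.
have [fixes _] := s_gal _ _ (vf_algebraic_rep d).
apply/(vf_push_fixed C_unc); apply: (vf_vecP _ Y0_d).
  by move=> i; exact: deg_lt_push.
rewrite vf_vec_push //; apply: (fixes (vf_vec d Y)); last first.
  by move=> k j; rewrite !mxE; exact: Y_Y0.
split=> [k|]; first by rewrite mxE; exact: KY.
have YY' k j : germ (vf_vec d Y k j) (vf_vec d Y' k j).
  by rewrite [vf_vec d Y k j]mxE [vf_vec d Y' k j]mxE -YE; exact: YgermF.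
refine ((pre_solutionP (P := @vf_poly n d C) (r := d) U_open U_conn K_field Up AA'
  (vf_algebraic_rep d) (@vf_rep_regular _ _ d) YY' (germ_cst K_field 0)).2 _).
rewrite [iota 0]rmorph0 scale0r subr0 Y'_vec.
refine (rep_solution_deriv C_unc DM D_const PhiPsi D_Phi d (vf_poly_mult d) (vf_vec d Y0)).
Qed.

End galois_symmetries.

Theorem theorem6p4 (R : realType) (U : set (CP1 R)) (U_neq0 : U !=set0)
    (U_open : open U) (U_connected : connected U)
    (K : set (CP1 R -> R[i])) (K_field : function_field U K)
    (n : nat) (n_ge1 : (0 < n)%N)
    (A : 'M[CP1 R -> R[i]]_n) (K_A : forall i j, K (A i j))
    (Y0 : 'I_n -> {mpoly R[i][n]})
    (x0 : CP1 R) (U_x0 : U x0) (x0_nonsingular : nonsingular A x0) :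
  (exists Y : 'I_n -> {mpoly (CP1 R -> R[i])[n]},
     vertical_symmetry U K A Y /\ restricts_to Y x0 Y0) <->
  (forall s : 'M[R[i]]_n, galoisian U K A x0 s ->
     vf_push s (vf_map Y0) = vf_map Y0).
Proof.
have [A' AA'] := germ_mx_exists K_field U_x0 K_A.
have [B A'E] := nonsingular_regular AA' x0_nonsingular.
have C_char0 (k : nat) : k.+1%:R != 0 :> R[i] by rewrite pnatr_eq0.
have [Phi [Psi [dPhi Phi0 PhiPsi]]] := fundamental_matrix C_char0 B.
have D_Phi : map_mx (scaled_deriv (chart_factor x0)) (map_mx (@FracField.tofrac _) Phi) =
    A' *m map_mx (@FracField.tofrac _) Phi.
  rewrite A'E -map_mxM -scalemxAl -dPhi; apply/matrixP => i j.
  by rewrite !mxE scaled_derivF.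
split=> [[Y [Y_sym Y_Y0]]|].
  exact: (symmetry_invariant U_open U_connected K_field U_x0 AA' PhiPsi Phi0 D_Phi Y_sym Y_Y0).
exact: (invariant_symmetry U_open U_connected K_field U_x0 AA' PhiPsi Phi0 D_Phi).
Qed.
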